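(* Let $k$ be an algebraically closed field of characteristic $2$ and let $G$ be a finite group with a dihedral Sylow $2$-subgroup of order at least $8$. Suppose that $\mathcal{D}$ is a component of the Auslander-Reiten quiver of $kG$ that contains a module of odd dimension. Then for any $n>0$ there exists a natural transformation $\psi:\mathrm{Id}\to\Omega^{2n-1}$ in the stable category $\mathbf{stmod}(kG)$ with the property that $\psi$ is supported only on the set of modules in $\mathcal{D}$.
   Context: $\mathbf{stmod}(kG)$ is the stable category of finitely generated $kG$-modules (modulo maps factoring through projectives), a triangulated category with shift $\Sigma=\Omega^{-1}$, where $\Omega$ is the Heller (syzygy) operator. The support of a natural transformation $\psi:\mathrm{Id}\to F$ is the set of isomorphism classes of indecomposable objects $M$ for which $\psi_M:M\to F(M)$ is non-zero. *)

(* Defs.v *)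
From mathcomp Require Import all_boot all_order all_algebra all_fingroup.
From mathcomp Require Import all_solvable all_character.
From mathcomp.classical Require Import boolp.
From Stdlib Require Import Relation_Operators.

Set Implicit Arguments.
Unset Strict Implicit.
Unset Printing Implicit Defensive.

Import GRing.Theory.
Local Open Scope ring_scope.

(* Categories whose hom-sets are setoids: [heq] is the equality of morphisms.
   Composition is written in diagrammatic order. *)
Record category := Category {
  obj :> Type;
  hom : obj -> obj -> Type;
  heq : forall A B : obj, hom A B -> hom A B -> Prop;
  idm : forall A : obj, hom A A;
  hcomp : forall A B C : obj, hom A B -> hom B C -> hom A C;
  heq_refl : forall A B (f : hom A B), heq f f;
  heq_sym : forall A B (f g : hom A B), heq f g -> heq g f;
  heq_trans : forall A B (f g h : hom A B), heq f g -> heq g h -> heq f h;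
  hcomp_heq : forall A B C (f f' : hom A B) (g g' : hom B C),
    heq f f' -> heq g g' -> heq (hcomp f g) (hcomp f' g');
  hcomp_idl : forall A B (f : hom A B), heq (hcomp (idm A) f) f;
  hcomp_idr : forall A B (f : hom A B), heq (hcomp f (idm B)) f;
  hcompA : forall A B C D (f : hom A B) (g : hom B C) (h : hom C D),
    heq (hcomp f (hcomp g h)) (hcomp (hcomp f g) h) }.

Record functor (C D : category) := Functor {
  fob :> C -> D;
  fmap : forall A B : C, hom A B -> hom (fob A) (fob B);
  fmap_heq : forall A B (f g : hom A B), heq f g -> heq (fmap f) (fmap g);
  fmap_id : forall A : C, heq (fmap (idm A)) (idm (fob A));
  fmap_comp : forall A B E (f : hom A B) (g : hom B E),
    heq (fmap (hcomp f g)) (hcomp (fmap f) (fmap g)) }.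

Record nat_trans (C D : category) (F H : functor C D) := NatTrans {
  component :> forall A : C, hom (F A) (H A);
  naturality : forall (A B : C) (f : hom A B),
    heq (hcomp (fmap F f) (component B)) (hcomp (component A) (fmap H f)) }.

Definition id_functor (C : category) : functor C C :=
  @Functor C C id (fun _ _ f => f) (fun _ _ _ _ e => e)
    (fun A => heq_refl (idm A)) (fun _ _ _ f g => heq_refl (hcomp f g)).

Definition comp_functor (C D E : category) (F : functor C D)
    (H : functor D E) : functor C E :=
  @Functor C E (fun A => H (F A)) (fun A B f => fmap H (fmap F f))
    (fun A B f g e => fmap_heq H (fmap_heq F e))
    (fun A => heq_trans (fmap_heq H (fmap_id F A)) (fmap_id H (F A)))
    (fun A B C' f g => heq_trans (fmap_heq H (fmap_comp F f g))
                                 (fmap_comp H (fmap F f) (fmap F g))).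

Fixpoint functor_pow (C : category) (F : functor C C) (m : nat) :
    functor C C :=
  if m is m'.+1 then comp_functor (functor_pow F m') F else id_functor C.

(* A finitely generated kG-module is a term of [representation k G], that is, a
   space of row vectors on which the group acts on the right by matrices; the
   matrix of a map acts on row vectors too, so that [f *m g] is "f, then g". *)
Section Modules.

Variables (k : fieldType) (gT : finGroupType) (G : {group gT}).
Local Notation module := (representation k G).

Record ghom (M N : module) := GHom {
  ghom_mx :> 'M[k]_(rdegree M, rdegree N);
  ghomP : forall x, x \in G -> M x *m ghom_mx = ghom_mx *m N x }.

Definition surjective M N (f : ghom M N) := row_full f.

Definition split_mono M N (f : ghom M N) : Prop :=
  exists g : ghom N M, f *m g = 1%:M.

Definition split_epi M N (f : ghom M N) : Prop :=
  exists g : ghom N M, g *m f = 1%:M.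

Definition isomorphic (M N : module) : Prop := mx_rsim M N.

(* Submodules are row spaces of square matrices stable under the action. *)
Definition indecomposable (M : module) : Prop :=
  (0 < rdegree M)%N /\
  forall U V : 'M[k]_(rdegree M), mxmodule M U -> mxmodule M V ->
    (U + V :=: 1%:M)%MS -> (U :&: V)%MS = 0 -> U = 0 \/ V = 0.

Definition projective (P : module) : Prop :=
  forall (A B : module) (p : ghom A B) (f : ghom P B), surjective p ->
  exists g : ghom P A, g *m p = f.

Definition irreducible_map M N (f : ghom M N) : Prop :=
  [/\ ~ split_mono f, ~ split_epi f &
      forall (X : module) (g : ghom M X) (h : ghom X N),
        ghom_mx f = g *m h -> split_mono g \/ split_epi h].

Definition AR_arrow (M N : module) : Prop :=
  [/\ indecomposable M, indecomposable N &
      exists f : ghom M N, irreducible_map f].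

(* The vertices of the quiver are isomorphism classes, hence the isomorphisms
   among the generators.  A set of vertices is an isomorphism-invariant
   predicate on modules. *)
Definition AR_connected : module -> module -> Prop :=
  clos_refl_sym_trans module (fun M N => isomorphic M N \/ AR_arrow M N).

Definition AR_component (D : module -> Prop) : Prop :=
  exists2 M, indecomposable M &
    forall N, D N <-> indecomposable N /\ AR_connected M N.

Lemma ghom_id_subproof (M : module) x :
  x \in G -> M x *m 1%:M = 1%:M *m M x.
Proof. by move=> _; rewrite mulmx1 mul1mx. Qed.
Definition ghom_id (M : module) : ghom M M := GHom (@ghom_id_subproof M).

Lemma ghom_comp_subproof M N L (f : ghom M N) (g : ghom N L) x :
  x \in G -> M x *m (f *m g) = (f *m g) *m L x.
Proof. by move=> Gx; rewrite mulmxA ghomP // -!mulmxA ghomP. Qed.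
Definition ghom_comp M N L (f : ghom M N) (g : ghom N L) : ghom M L :=
  GHom (ghom_comp_subproof f g).

Lemma ghom0_subproof (M N : module) x :
  x \in G -> M x *m 0 = (0 : 'M_(rdegree M, rdegree N)) *m N x.
Proof. by move=> _; rewrite mulmx0 mul0mx. Qed.
Definition ghom0 (M N : module) : ghom M N := GHom (@ghom0_subproof M N).

Lemma ghom_sub_subproof M N (f g : ghom M N) x :
  x \in G -> M x *m (ghom_mx f - ghom_mx g) = (ghom_mx f - ghom_mx g) *m N x.
Proof. by move=> Gx; rewrite mulmxBr mulmxBl !ghomP. Qed.
Definition ghom_sub M N (f g : ghom M N) : ghom M N :=
  GHom (ghom_sub_subproof f g).

Definition stable_eq M N (f g : ghom M N) : Prop :=
  exists P : module, projective P /\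
  exists (a : ghom M P) (b : ghom P N),
    ghom_mx f - ghom_mx g = a *m b.

Lemma projective0 : projective (grepr0 : module).
Proof.
move=> A B p f _; exists (ghom0 _ _).
by rewrite /= mul0mx; symmetry; apply: flatmx0.
Qed.

Lemma row_ghom_subproof M P Q (a : ghom M P) (b : ghom M Q) x : x \in G ->
  M x *m row_mx a b = row_mx a b *m (dadd_grepr P Q) x.
Proof.
by move=> Gx; rewrite /= mul_mx_row mul_row_block !mulmx0 addr0 add0r !ghomP.
Qed.

Lemma col_ghom_subproof M P Q (a : ghom P M) (b : ghom Q M) x : x \in G ->
  (dadd_grepr P Q) x *m col_mx a b = col_mx a b *m M x.
Proof.
by move=> Gx; rewrite /= mul_block_col mul_col_mx !mul0mx addr0 add0r !ghomP.
Qed.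

Definition row_ghom M P Q (a : ghom M P) (b : ghom M Q) :
  ghom M (dadd_grepr P Q) := @GHom M (dadd_grepr P Q) _ (row_ghom_subproof a b).
Definition col_ghom M P Q (a : ghom P M) (b : ghom Q M) :
  ghom (dadd_grepr P Q) M := @GHom (dadd_grepr P Q) M _ (col_ghom_subproof a b).

Lemma projectiveD P Q :
  projective P -> projective Q -> projective (dadd_grepr P Q).
Proof.
move=> prP prQ A B p f surp.
have [g gE] := prP A B p (ghom_comp (row_ghom (ghom_id P) (ghom0 P Q)) f) surp.
have [h hE] := prQ A B p (ghom_comp (row_ghom (ghom0 Q P) (ghom_id Q)) f) surp.
exists (col_ghom g h).
rewrite /= mul_col_mx gE hE /= -mul_col_mx.
rewrite -[X in X *m _](_ : 1%:M = _) ?mul1mx //.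
by rewrite (scalar_mx_block (rdegree P) (rdegree Q) 1).
Qed.

Lemma stable_refl M N (f : ghom M N) : stable_eq f f.
Proof.
exists grepr0; split; first exact: projective0.
by exists (ghom0 _ _), (ghom0 _ _); rewrite subrr mul0mx.
Qed.

Lemma stable_sym M N (f g : ghom M N) : stable_eq f g -> stable_eq g f.
Proof.
case=> P [prP [a [b E]]]; exists P; split=> //.
exists (ghom_sub (ghom0 _ _) a), b.
by rewrite /= sub0r mulNmx -E opprB.
Qed.

Lemma stable_trans M N (f g h : ghom M N) :
  stable_eq f g -> stable_eq g h -> stable_eq f h.
Proof.
case=> P [prP [a [b E]]] [Q [prQ [c [d E']]]].
exists (dadd_grepr P Q); split; first exact: projectiveD.
exists (row_ghom a c), (col_ghom b d).
by rewrite /= mul_row_col -E -E' addrA subrK.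
Qed.

Lemma stable_comp L M N (f f' : ghom L M) (g g' : ghom M N) :
  stable_eq f f' -> stable_eq g g' ->
  stable_eq (ghom_comp f g) (ghom_comp f' g').
Proof.
case=> P [prP [a [b E]]] [Q [prQ [c [d E']]]].
apply: (@stable_trans _ _ _ (ghom_comp f' g)).
  exists P; split=> //; exists a, (ghom_comp b g).
  by rewrite /= -mulmxBl E mulmxA.
exists Q; split=> //; exists (ghom_comp f' c), d.
by rewrite /= -mulmxBr E' mulmxA.
Qed.

Lemma stable_of_eq M N (f g : ghom M N) :
  ghom_mx f = ghom_mx g -> stable_eq f g.
Proof.
move=> E; exists grepr0; split; first exact: projective0.
by exists (ghom0 _ _), (ghom0 _ _); rewrite E subrr mul0mx.
Qed.

Lemma stable_idl M N (f : ghom M N) : stable_eq (ghom_comp (ghom_id M) f) f.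
Proof. by apply: stable_of_eq; rewrite /= mul1mx. Qed.

Lemma stable_idr M N (f : ghom M N) : stable_eq (ghom_comp f (ghom_id N)) f.
Proof. by apply: stable_of_eq; rewrite /= mulmx1. Qed.

Lemma stable_compA K L M N (f : ghom K L) (g : ghom L M) (h : ghom M N) :
  stable_eq (ghom_comp f (ghom_comp g h)) (ghom_comp (ghom_comp f g) h).
Proof. by apply: stable_of_eq; rewrite /= mulmxA. Qed.

Definition stmod : category :=
  Category stable_refl stable_sym stable_trans stable_comp
    stable_idl stable_idr stable_compA.

(* The last clause says that the kernel is superfluous: no proper submodule of
   the source maps onto the target. *)
Definition projective_cover M P (p : ghom P M) : Prop :=
  [/\ projective P, surjective p &
      forall U : 'M[k]_(rdegree P), mxmodule P U ->
        row_full (U *m p) -> row_full U].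

Definition regular_module : module := Representation (regular_repr k G).

Lemma regular_ghom_subproof (M : module) (v : 'rV[k]_(rdegree M)) x : x \in G ->
  regular_module x *m (\matrix_i (v *m M (enum_val i)))
  = (\matrix_i (v *m M (enum_val i))) *m M x.
Proof.
move=> Gx; apply/row_matrixP=> i.
rewrite !row_mul !rowK -rowE rowK gring_indexK ?groupM ?enum_valP //.
by rewrite repr_mxM ?enum_valP // mulmxA.
Qed.

Definition regular_ghom (M : module) (v : 'rV[k]_(rdegree M)) :
  ghom regular_module M := @GHom regular_module M _ (regular_ghom_subproof v).

Lemma projective_regular : projective regular_module.
Proof.
move=> A B p f surp.
pose e1 : 'I_(gcard G) := gring_index G 1.
have /submxP[v vE] : (row e1 f <= p)%MS by apply: submx_full.
exists (regular_ghom v); apply/row_matrixP=> i /=.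
rewrite row_mul rowK -mulmxA ghomP ?enum_valP // mulmxA -vE.
rewrite -row_mul -(ghomP f) ?enum_valP //= row_mul rowK -rowE.
by rewrite gring_indexK ?group1 // mul1g gring_valK.
Qed.

Lemma projective_onto (M : module) : exists (P : module) (p : ghom P M),
  projective P /\ surjective p.
Proof.
suff H m (W : 'M[k]_(m, rdegree M)) : exists (P : module) (p : ghom P M),
    projective P /\ (W <= p)%MS.
  have [P [p [prP sub]]] := H _ 1%:M.
  by exists P, p; split=> //; rewrite /surjective -sub1mx.
elim: m W => [|m IH] W.
  exists grepr0, (ghom0 _ _); split; first exact: projective0.
  by rewrite [W]flatmx0 sub0mx.
rewrite -[W](@vsubmxK _ 1 m).
have [P [p [prP sub]]] := IH (@dsubmx _ 1 m _ W).
pose v := @usubmx _ 1 m _ W; pose q := regular_ghom v.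
exists (dadd_grepr regular_module P), (col_ghom q p).
split; first by apply: projectiveD => //; apply: projective_regular.
rewrite /= (@col_mx_sub _ 1 m) -!(addsmxE q p); apply/andP; split; last first.
  by apply: submx_trans sub _; apply: addsmxSr.
apply: submx_trans (addsmxSl _ _).
have vE : row (gring_index G 1) q = v.
  by rewrite rowK gring_indexK ?group1 // repr_mx1 mulmx1.
by rewrite -[X in (X <= _)%MS]vE; apply: row_sub.
Qed.

Section Submodules.
Variables (P : module) (U : 'M[k]_(rdegree P)) (modU : mxmodule P U).

Definition submodule : module := Representation (submod_repr modU).

Lemma incl_subproof x : x \in G ->
  submodule x *m val_submod 1%:M = (val_submod 1%:M : 'M_(\rank U, _)) *m P x.
Proof.
move=> Gx; rewrite /= -val_submodE -[submod_mx modU x]mul1mx.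
exact: val_submodJ.
Qed.
Definition incl : ghom submodule P := @GHom submodule P _ incl_subproof.

Lemma corestrict (L : module) (f : ghom L P) :
  (f <= U)%MS -> exists g : ghom L submodule, g *m incl = f.
Proof.
move=> fU.
have homg x : x \in G -> L x *m in_submod U f = in_submod U f *m submodule x.
  move=> Gx /=; rewrite -(in_submodJ modU) // -ghomP //.
  by rewrite [LHS]mulmxA.
by exists (@GHom L submodule _ homg); rewrite /= -val_submodE in_submodK.
Qed.

Lemma incl_inj m (A B : 'M[k]_(m, \rank U)) :
  A *m incl = B *m incl -> A = B.
Proof. by rewrite /= -!val_submodE => /val_submod_inj. Qed.

End Submodules.

Lemma endo_module (P : module) (e : ghom P P) : mxmodule P (ghom_mx e).
Proof. by apply/mxmoduleP=> x Gx; rewrite -ghomP ?submxMl. Qed.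

Lemma fitting_projective (P : module) (e : ghom P P) :
  projective P -> \rank (e *m e) = \rank e ->
  projective (submodule (endo_module e)).
Proof.
move=> prP rk; set V := submodule _; set i : ghom V P := incl _.
have [c cE] := @corestrict _ _ (endo_module e) P e (submx_refl _).
rewrite -/V -/i in c cE.
have icE : (i *m c) *m i = i *m e by rewrite -mulmxA cE.
have uic : (i *m c : 'M_(rdegree V)) \in unitmx.
  rewrite -row_free_unit /row_free eqn_leq rank_leq_row /=.
  have eqi : (i :=: e)%MS by apply: val_submod1.
  suff: (\rank e <= \rank (i *m c))%N by [].
  by rewrite -[X in (X <= _)%N]rk -(eqmxMr e eqi) -icE mxrankM_maxl.
have hom_inv x : x \in G -> V x *m invmx (i *m c) = invmx (i *m c) *m V x.
  move=> Gx; rewrite -[LHS](mulKmx uic).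
  have E : V x *m (i *m c) = (i *m c) *m V x := ghomP (ghom_comp i c) Gx.
  by congr (_ *m _); rewrite mulmxA -E mulmxK.
move=> A B p f surp.
have [g gE] := prP A B p (ghom_comp c f) surp.
exists (ghom_comp (@GHom V V _ hom_inv) (ghom_comp i g)).
transitivity (invmx (i *m c) *m (i *m (g *m p))).
  by rewrite (mulmxA (ghom_mx i)) mulmxA.
by rewrite gE -[RHS](mulKmx uic) (mulmxA (ghom_mx i)).
Qed.

Lemma projective_cover_exists (M : module) :
  exists c : {P : module & ghom P M}, projective_cover (projT2 c).
Proof.
pose good d := `[< exists (P : module) (p : ghom P M),
  [/\ rdegree P = d, projective P & surjective p] >].
have ex_good : exists d, good d.
  have [P [p [prP surp]]] := projective_onto M.
  by exists (rdegree P); apply/asboolP; exists P, p.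
case: (ex_minnP ex_good) => d /asboolP[P [p [degP prP surp]]] mind.
exists (existT _ P p); split=> //= U modU surU.
pose fixes (r : nat) := `[< exists e : ghom P P,
  [/\ \rank e = r, (e <= U)%MS & e *m p = p] >].
have ex_fix : exists r, fixes r.
  have surip : surjective (ghom_comp (incl modU) p).
    rewrite /surjective /row_full /=.
    by rewrite (eqmxMr p (val_submod1 U)) -/(row_full _).
  have [s sE] := prP _ _ _ p surip.
  exists (\rank (ghom_comp s (incl modU))); apply/asboolP.
  exists (ghom_comp s (incl modU)); split; first by [].
    by apply: mulmx_sub; rewrite (val_submod1 U).
  by rewrite -[RHS]sE -(mulmxA (ghom_mx s)).
case: (ex_minnP ex_fix) => r /asboolP[e [rke eU ep]] minr.
have rk : \rank (e *m e) = \rank e.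
  apply/eqP; rewrite eqn_leq mxrankM_maxl rke; apply: minr; apply/asboolP.
  exists (ghom_comp e e); split=> //=; first exact: mulmx_sub.
  by rewrite -mulmxA !ep.
have prV := fitting_projective prP rk.
have surV : surjective (ghom_comp (incl (endo_module e)) p).
  rewrite /surjective /row_full /=.
  by rewrite (eqmxMr p (val_submod1 (ghom_mx e))) ep -/(row_full _).
have le_d : (d <= \rank e)%N.
  apply: mind; apply/asboolP.
  by exists _, (ghom_comp (incl (endo_module e)) p); split.
rewrite /row_full eqn_leq rank_leq_col /= [X in (X <= _)%N]degP.
exact: leq_trans le_d (mxrankS eU).
Qed.

Definition cover_data (M : module) := cid (projective_cover_exists M).
Definition cover (M : module) : module := projT1 (sval (cover_data M)).
Definition cover_map (M : module) : ghom (cover M) M :=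
  projT2 (sval (cover_data M)).

Lemma cover_mapP M : projective_cover (cover_map M).
Proof. exact: svalP (cover_data M). Qed.

Lemma ker_module M N (f : ghom M N) : mxmodule M (kermx f).
Proof.
apply/mxmoduleP=> x Gx; apply/sub_kermxP.
by rewrite -mulmxA ghomP // mulmxA mulmx_ker mul0mx.
Qed.

Definition syzygy (M : module) : module := submodule (ker_module (cover_map M)).
Definition syzygy_incl (M : module) : ghom (syzygy M) (cover M) :=
  incl (ker_module (cover_map M)).

(* [g] is induced by [f]: both are part of a map between the short exact
   sequences 0 -> syzygy -> cover -> module -> 0. *)
Definition induced_by M N (f : ghom M N) (g : ghom (syzygy M) (syzygy N)) :=
  exists h : ghom (cover M) (cover N),
    h *m cover_map N = cover_map M *m f /\
    g *m syzygy_incl N = syzygy_incl M *m h.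

Lemma syzygy_incl0 M : syzygy_incl M *m cover_map M = 0.
Proof. by apply/sub_kermxP; apply: val_submodP. Qed.

Lemma to_syzygy (L M : module) (f : ghom L (cover M)) :
  f *m cover_map M = 0 -> exists g : ghom L (syzygy M), g *m syzygy_incl M = f.
Proof. by move=> f0; apply: corestrict; apply/sub_kermxP. Qed.

Lemma induced_exists M N (f : ghom M N) : exists g, induced_by f g.
Proof.
have [prP _ _] := cover_mapP M; have [_ surN _] := cover_mapP N.
have [h hE] := prP _ _ _ (ghom_comp (cover_map M) f) surN.
have [|g gE] := @to_syzygy _ N (ghom_comp (syzygy_incl M) h).
  by rewrite /= -mulmxA hE mulmxA syzygy_incl0 mul0mx.
by exists g, h.
Qed.

Lemma induced_stable M N (f f' : ghom M N) g g' :
  stable_eq f f' -> induced_by f g -> induced_by f' g' -> stable_eq g g'.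
Proof.
case=> Q [prQ [a [b E]]] [h [hE gE]] [h' [hE' gE']].
have [_ surN _] := cover_mapP N; have [prM _ _] := cover_mapP M.
have [c cE] := prQ _ _ _ b surN.
pose ac := ghom_comp (cover_map M) (ghom_comp a c).
have [|d dE] := @to_syzygy _ N (ghom_sub (ghom_sub h h') ac).
  by rewrite /= !mulmxBl hE hE' -!mulmxA cE -mulmxBr E subrr.
exists (cover M); split=> //; exists (syzygy_incl M), d.
have E0 : syzygy_incl M *m (cover_map M *m (a *m c)) = 0.
  by rewrite mulmxA syzygy_incl0 mul0mx.
have {}dE : d *m syzygy_incl N =
    (ghom_mx h - ghom_mx h') - cover_map M *m (a *m c) := dE.
apply: (@incl_inj _ _ (ker_module (cover_map N))).
rewrite -/(syzygy_incl N) -(mulmxA (ghom_mx (syzygy_incl M))) dE.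
by rewrite mulmxBl gE gE' !mulmxBr E0 subr0.
Qed.

Lemma induced_id M : induced_by (ghom_id M) (ghom_id (syzygy M)).
Proof. by exists (ghom_id _); rewrite /= !mul1mx !mulmx1. Qed.

Lemma induced_comp L M N (f : ghom L M) (f' : ghom M N) g g' :
  induced_by f g -> induced_by f' g' ->
  induced_by (ghom_comp f f') (ghom_comp g g').
Proof.
move=> [h [hE gE]] [h' [hE' gE']]; exists (ghom_comp h h'); split.
  by rewrite /= -mulmxA hE' mulmxA hE mulmxA.
rewrite -[LHS]/((g *m g') *m syzygy_incl N) -(mulmxA (ghom_mx g)) gE'.
by rewrite (mulmxA (ghom_mx g)) gE -(mulmxA (ghom_mx (syzygy_incl L))).
Qed.

Definition syzygy_map M N (f : ghom M N) : ghom (syzygy M) (syzygy N) :=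
  sval (cid (induced_exists f)).

Lemma syzygy_mapP M N (f : ghom M N) : induced_by f (syzygy_map f).
Proof. exact: svalP (cid (induced_exists f)). Qed.

Definition Omega : functor stmod stmod :=
  @Functor stmod stmod syzygy syzygy_map
    (fun A B (f g : ghom A B) (e : stable_eq f g) =>
       induced_stable e (syzygy_mapP f) (syzygy_mapP g))
    (fun A : module => induced_stable (stable_refl (ghom_id A))
       (syzygy_mapP (ghom_id A)) (induced_id A))
    (fun (A B E : module) (f : ghom A B) (g : ghom B E) =>
       induced_stable (stable_refl (ghom_comp f g))
         (syzygy_mapP (ghom_comp f g))
         (induced_comp (syzygy_mapP f) (syzygy_mapP g))).

(* Since the map is required to be non-zero in the stable category, the modules
   in the support are not projective; non-projective indecomposable modules
   represent the indecomposable objects of the stable category. *)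
Definition nat_support (F : functor stmod stmod)
    (psi : nat_trans (id_functor stmod) F) (M : module) : Prop :=
  indecomposable M /\ ~ stable_eq (psi M) (ghom0 M (F M)).

End Modules.

Arguments stmod k {gT} G.
Arguments Omega k {gT} G.

(* Main.v *)
From HB Require Import structures.
Require Import Defs.
From mathcomp Require Import all_boot all_order all_algebra all_fingroup.
From mathcomp Require Import all_solvable all_character.
From mathcomp.classical Require Import boolp.
From mathcomp Require Import zify ring.
From Stdlib Require Import Relation_Operators.

Set Implicit Arguments.
Unset Strict Implicit.
Unset Printing Implicit Defensive.

Import GRing.Theory.
Local Open Scope ring_scope.

(* Let [S] be the Sylow subgroup, [z] its central involution and [s true],
   [s false] two generating involutions.  Over [<[z]>] every module is
   isomorphic to its syzygy modulo projectives; following the iterate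
   [N -> Omega^j N] of these maps by a connecting homomorphism for the transfer
   from [1] to [G] gives a natural map [psi j : N -> Omega^(j+1) N].  Trace
   duality shows that [g psi] is null exactly when [tr (g eta^j h) = 0] for all
   module maps [h].

   A map [g] between non-isomorphic indecomposable modules is orthogonal to all
   maps for the trace form, and hence is over [S] the sum of a map null on
   [<[s true]>] and a map null on [<[s false]>].  A composite with more than [j]
   factors of one of these two kinds is killed by [psi].  Maps that enter or
   leave the component factor through almost split maps arbitrarily often, so
   they are killed, and the projection of each module on its summands in the
   component commutes with [psi].  The restriction of [psi] to that part is
   natural.  It is non-zero on odd-dimensional modules because the Euler class
   of the action of [S] on a polygon splits [eta^j] by a map of trace 1.

   It remains to see that the non-projective modules in the component have
   odd dimension.  For each shifted cyclic subgroup of the four-groups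
   [<<s i, z>>] the number of non-free summands of the restriction is constant
   along odd modules, and at least two summands of the middle term of an almost
   split sequence are odd; so the even ones restrict to free modules, and are
   projective by the theorems of Dade and Chouinard.  Finally all the neighbours
   of a projective vertex have the same dimension. *)

(** * Relative traces *)

(** The obstacle is that [eta] is equivariant only for [<[z]>] and natural only modulo maps null
    there. The connecting homomorphism for [G] removes both defects: in characteristic 2 a transfer
    over a subgroup of even order is orthogonal to every module map, so the trace form does not see
    it. Questions on stable maps thus become questions on traces of matrices, where the maps in
    front of [eta] can be split up freely. Two kinds of factors arise because [S] is generated by
    two involutions and orthogonality is tested on generators. Among [2 j + 1] factors more than [j]
    are of one kind [i], and each of these lets one more power of [eta] be represented by a map
    equivariant for the four-group [A i]; one power beyond [j] yields orthogonality. The polygon is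
    one-dimensional, so its class has degree 2 and splits the even powers of [eta]; the connecting
    map adds one syzygy, whence the odd exponent. *)

Section HomAction.

Variables (k : fieldType) (gT : finGroupType) (G : {group gT}).
Local Notation module := (representation k G).
Local Notation Hom M N := 'M[k]_(rdegree M, rdegree N).
Implicit Types (M N L P : module) (K H : {group gT}) (x y : gT).

(* Locked, since rewriting with [mulmxA] would unfold it. *)
Definition act M N x (f : Hom M N) : Hom M N := locked (M x^-1%g *m f *m N x).

Lemma actE M N x (f : Hom M N) : act x f = M x^-1%g *m f *m N x.
Proof. by rewrite /act -lock. Qed.

Definition trf M N (K : {set gT}) (f : Hom M N) : Hom M N :=
  \sum_(x in K) act x f.

Definition equi M N (K : {set gT}) (f : Hom M N) : Prop :=
  {in K, forall x, act x f = f}.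

(* By Higman's criterion [null G] means factoring through a projective module;
   [trnull] is the dual condition for the trace form. *)
Definition trnull M N (K : {set gT}) (f : Hom M N) : Prop :=
  forall h : Hom N M, equi K h -> \tr (f *m h) = 0.

Definition null M N (K : {set gT}) (f : Hom M N) : Prop :=
  exists h, f = trf K h.

Definition higman (K : {set gT}) M := @null M M K 1%:M.

Lemma act_is_linear M N x : linear (@act M N x).
Proof. by move=> a f g; rewrite !actE mulmxDr mulmxDl -scalemxAr -scalemxAl. Qed.

HB.instance Definition _ M N x :=
  GRing.isSemilinear.Build k (Hom M N) (Hom M N) _ (@act M N x)
    (GRing.semilinear_linear (@act_is_linear M N x)).

Lemma trf_is_linear M N (K : {set gT}) : linear (@trf M N K).
Proof.
move=> a f g; rewrite /trf scaler_sumr -big_split /=; apply: eq_bigr => x _.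
exact: linearP.
Qed.

HB.instance Definition _ M N K :=
  GRing.isSemilinear.Build k (Hom M N) (Hom M N) _ (@trf M N K)
    (GRing.semilinear_linear (@trf_is_linear M N K)).

Lemma act1g M N (f : Hom M N) : act 1%g f = f.
Proof. by rewrite actE invg1 !repr_mx1 mulmx1 mul1mx. Qed.

Lemma actM M N x y (f : Hom M N) : x \in G -> y \in G ->
  act (x * y)%g f = act y (act x f).
Proof.
by move=> Gx Gy; rewrite !actE invMg !repr_mxM ?groupV // !mulmxA.
Qed.

Lemma actK M N x : x \in G -> cancel (@act M N x) (@act M N x^-1).
Proof. by move=> Gx f; rewrite -actM ?groupV // mulgV act1g. Qed.

Lemma actKV M N x : x \in G -> cancel (@act M N x^-1) (@act M N x).
Proof. by move=> Gx f; rewrite -actM ?groupV // mulVg act1g. Qed.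

Lemma act_mul M N L x (f : Hom M N) (g : Hom N L) : x \in G ->
  act x (f *m g) = act x f *m act x g.
Proof. by move=> Gx; rewrite !actE !mulmxA (repr_mxK _ Gx). Qed.

Lemma act_id M x : x \in G -> act x (1%:M : Hom M M) = 1%:M.
Proof. by move=> Gx; rewrite actE mulmx1 -repr_mxM ?groupV // mulVg repr_mx1. Qed.

Lemma repr_lK M m x (f : 'M_(rdegree M, m)) : x \in G ->
  M x^-1%g *m (M x *m f) = f.
Proof. by move=> Gx; rewrite mulmxA -repr_mxM ?groupV // mulVg repr_mx1 mul1mx. Qed.

Lemma repr_lKV M m x (f : 'M_(rdegree M, m)) : x \in G ->
  M x *m (M x^-1%g *m f) = f.
Proof. by move=> Gx; rewrite mulmxA -repr_mxM ?groupV // mulgV repr_mx1 mul1mx. Qed.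

Lemma tr_act M x (f : Hom M M) : x \in G -> \tr (act x f) = \tr f.
Proof. by move=> Gx; rewrite actE mxtrace_mulC repr_lKV. Qed.

Lemma tr_actl M N x (f : Hom M N) (h : Hom N M) : x \in G ->
  \tr (act x f *m h) = \tr (f *m act x^-1%g h).
Proof. by move=> Gx; rewrite -(tr_act _ (groupVr Gx)) act_mul ?groupV // actK. Qed.

Lemma actP M N x (f : Hom M N) : x \in G ->
  act x f = f <-> M x *m f = f *m N x.
Proof.
move=> Gx; rewrite actE; split=> [E | E]; last by rewrite -mulmxA -E repr_lK.
by rewrite -{1}E -mulmxA repr_lKV.
Qed.

Lemma ghom_equi M N (f : ghom M N) : equi G f.
Proof. by move=> x Gx; apply/actP => //; apply: ghomP. Qed.

Lemma equi_ghom M N (f : Hom M N) : equi G f -> exists g : ghom M N, ghom_mx g = f.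
Proof.
move=> fE; have H x : x \in G -> M x *m f = f *m N x.
  by move=> Gx; apply/actP; last exact: fE.
by exists (GHom H).
Qed.

Lemma equiM M N L (K : {set gT}) (f : Hom M N) (g : Hom N L) : K \subset G ->
  equi K f -> equi K g -> equi K (f *m g).
Proof.
by move=> sKG fE gE x Kx; rewrite act_mul ?(subsetP sKG) // fE ?gE.
Qed.

Lemma equi1 M (K : {set gT}) : K \subset G -> equi K (1%:M : Hom M M).
Proof. by move=> sKG x Kx; rewrite act_id ?(subsetP sKG). Qed.

Lemma equiD M N (K : {set gT}) (f g : Hom M N) :
  equi K f -> equi K g -> equi K (f + g).
Proof. by move=> fE gE x Kx; rewrite linearD /= fE ?gE. Qed.

Lemma equiB M N (K : {set gT}) (f g : Hom M N) :
  equi K f -> equi K g -> equi K (f - g).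
Proof. by move=> fE gE x Kx; rewrite linearB /= fE ?gE. Qed.

Lemma equi0 M N (K : {set gT}) : equi K (0 : Hom M N).
Proof. by move=> x Kx; rewrite linear0. Qed.

Lemma equiS M N (K H : {set gT}) (f : Hom M N) : K \subset H ->
  equi H f -> equi K f.
Proof. by move=> sKH fE x Kx; apply: fE; apply: (subsetP sKH). Qed.

Lemma equi_gen M N (A : {set gT}) (f : Hom M N) : A \subset G ->
  equi A f -> equi <<A>>%g f.
Proof.
move=> sAG fE.
have gF : group_set [set x in G | act x f == f].
  apply/group_setP; split=> [|x y]; first by rewrite inE group1 act1g eqxx.
  rewrite !inE => /andP[Gx /eqP fx] /andP[Gy /eqP fy].
  by rewrite groupM // actM // fx fy eqxx.
have sAF : <<A>>%g \subset Group gF.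
  rewrite gen_subG; apply/subsetP=> x Ax.
  by rewrite inE (subsetP sAG) // fE ?eqxx.
by move=> x /(subsetP sAF); rewrite inE => /andP[_ /eqP].
Qed.

Section Transfer.
Variable (K : {group gT}).
Hypothesis sKG : K \subset G.
Let KG x : x \in K -> x \in G. Proof. exact: subsetP. Qed.

Lemma trf_act M N x (f : Hom M N) : x \in K -> trf K (act x f) = trf K f.
Proof.
move=> Kx; rewrite /trf [RHS](reindex_inj (mulgI x)) /=.
by apply: eq_big => y; rewrite ?groupMl // => Ky; rewrite actM ?KG.
Qed.

Lemma trf_equi M N (f : Hom M N) : equi K (trf K f).
Proof.
move=> x Kx; rewrite /trf linear_sum /= [RHS](reindex_inj (mulIg x)) /=.
by apply: eq_big => y; rewrite ?groupMr // => Ky; rewrite actM ?KG.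
Qed.

Lemma trfMl M N L (f : Hom M N) (g : Hom N L) : equi K g ->
  trf K (f *m g) = trf K f *m g.
Proof.
move=> gE; rewrite /trf mulmx_suml; apply: eq_bigr => x Kx.
by rewrite act_mul ?KG // gE.
Qed.

Lemma trfMr M N L (f : Hom M N) (g : Hom N L) : equi K f ->
  trf K (f *m g) = f *m trf K g.
Proof.
move=> fE; rewrite /trf mulmx_sumr; apply: eq_bigr => x Kx.
by rewrite act_mul ?KG // fE.
Qed.

(** The trace form is invariant under the action, so transfers are self-adjoint; the duality between
    [null] and [trnull] rests on this. *)
Lemma tr_trf M N (f : Hom M N) (h : Hom N M) :
  \tr (trf K f *m h) = \tr (f *m trf K h).
Proof.
rewrite /trf mulmx_suml mulmx_sumr !linear_sum /= (reindex_inj invg_inj) /=.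
apply: eq_big => x; rewrite ?groupV // => Kx.
by rewrite tr_actl ?invgK // groupV KG.
Qed.

Lemma nullMl M N L (f : Hom M N) (g : Hom N L) :
  equi K g -> null K f -> null K (f *m g).
Proof. by move=> gE [h ->]; exists (h *m g); rewrite trfMl. Qed.

Lemma nullMr M N L (f : Hom M N) (g : Hom N L) :
  equi K f -> null K g -> null K (f *m g).
Proof. by move=> fE [h ->]; exists (f *m h); rewrite trfMr. Qed.

Lemma nullD M N (f g : Hom M N) : null K f -> null K g -> null K (f + g).
Proof. by move=> [h ->] [h' ->]; exists (h + h'); rewrite linearD. Qed.

Lemma nullN M N (f : Hom M N) : null K f -> null K (- f).
Proof. by move=> [h ->]; exists (- h); rewrite linearN. Qed.

Lemma nullB M N (f g : Hom M N) : null K f -> null K g -> null K (f - g).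
Proof. by move=> nf ng; apply: nullD => //; apply: nullN. Qed.

Lemma null0 M N : null K (0 : Hom M N).
Proof. by exists 0; rewrite linear0. Qed.

Lemma higman_null M N (f : Hom M N) : higman K M -> equi K f -> null K f.
Proof. by move=> hM fE; rewrite -[f]mul1mx; apply: nullMl. Qed.

Lemma higman_nullr M N (f : Hom M N) : higman K N -> equi K f -> null K f.
Proof. by move=> hN fE; rewrite -[f]mulmx1; apply: nullMr. Qed.

(** Every equivariant map out of a module satisfying Higman's criterion is itself a transfer, and
    [tr_trf] moves the transfer to [f]. *)
Lemma trf0_trnull M N (f : Hom M N) : higman K N -> trf K f = 0 -> trnull K f.
Proof.
move=> [r rE] f0 h hE; rewrite -[h]mul1mx rE -trfMl // -tr_trf f0 mul0mx.
by rewrite linear0.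
Qed.

Lemma trnullMr M N L (f : Hom M N) (g : Hom N L) : equi K g ->
  trnull K f -> trnull K (f *m g).
Proof. by move=> gE f0 h hE; rewrite -mulmxA f0 //; apply: equiM. Qed.

Lemma trnullMl M N L (f : Hom M N) (g : Hom N L) : equi K f ->
  trnull K g -> trnull K (f *m g).
Proof.
by move=> fE g0 h hE; rewrite mxtrace_mulC mulmxA mxtrace_mulC g0 //; apply: equiM.
Qed.

Lemma trnullD M N (f g : Hom M N) : trnull K f -> trnull K g -> trnull K (f + g).
Proof. by move=> f0 g0 h hE; rewrite mulmxDl linearD /= f0 ?g0 ?addr0. Qed.

Lemma trnull_sum M N (I : Type) (r : seq I) (Q : pred I) (F : I -> Hom M N) :
  (forall i, Q i -> trnull K (F i)) -> trnull K (\sum_(i <- r | Q i) F i).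
Proof.
move=> F0 h hE; rewrite mulmx_suml linear_sum /=.
by apply: big1 => i Qi; apply: F0.
Qed.

Lemma tr_null_trf0 M N (f : Hom M N) (w : Hom N M) :
  null K f -> trf K w = 0 -> \tr (f *m w) = 0.
Proof. by case=> r -> w0; rewrite tr_trf w0 mulmx0 linear0. Qed.

End Transfer.

Lemma trnullS M N (K H : {set gT}) (f : Hom M N) : K \subset H ->
  trnull K f -> trnull H f.
Proof. by move=> sKH f0 h hE; apply: f0; apply: equiS hE. Qed.

Lemma trf_lreps M N (K H : {group gT}) (f : Hom M N) :
    H \subset K -> K \subset G ->
  trf K f = trf H (\sum_(X in lcosets H K) act (repr X) f).
Proof.
move=> sHK sKG.
have KG x : x \in K -> x \in G by apply: (subsetP sKG).
rewrite /trf.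
rewrite [LHS](partition_big (fun x => (x *: H)%g) (mem (lcosets H K))) /=; last first.
  by move=> x Kx; apply/lcosetsP; exists x.
under [RHS]eq_bigr do rewrite linear_sum /=.
rewrite [RHS]exchange_big /=; apply: eq_bigr => X /lcosetsP[y Ky ->].
have [h Hh rE] : exists2 h, h \in H & repr (y *: H)%g = (y * h)%g.
  by have /lcosetP[h Hh ->] := mem_repr y (lcoset_refl H y); exists h.
rewrite rE (reindex_inj (mulgI (y * h)%g)) /=.
have Kyh : (y * h)%g \in K by rewrite groupM // (subsetP sHK).
apply: eq_big => [x | x Hx]; last first.
  have Kx: x \in K.
    by case/andP: Hx => H1 _; rewrite groupMl in H1.
  by rewrite actM ?KG.
rewrite -mulgA; apply/idP/idP => [/andP[_ /eqP E] | Hx].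
  have: (y * (h * x))%g \in (y *: H)%g by rewrite -E lcoset_refl.
  by rewrite mem_lcoset mulKg groupMl.
rewrite mulgA groupMl // (subsetP sHK) //=.
by rewrite -mulgA lcosetM lcoset_id // groupM.
Qed.

Lemma null_sub M N (K H : {group gT}) (f : Hom M N) :
  H \subset K -> K \subset G -> null K f -> null H f.
Proof. by move=> sHK sKG [h ->]; rewrite (trf_lreps _ sHK) //; eexists. Qed.

End HomAction.

(** * Double orthogonals for the trace form *)

Section Duality.

Variables (k : fieldType) (gT : finGroupType) (G : {group gT}).
Local Notation module := (representation k G).
Local Notation Hom M N := 'M[k]_(rdegree M, rdegree N).
Implicit Types (M N L P : module) (x y : gT).

Lemma mxtrace_mxvec m n (A : 'M[k]_(m, n)) (B : 'M_(n, m)) :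
  \tr (A *m B) = (mxvec A *m (mxvec B^T)^T) 0 0.
Proof.
rewrite mxE (reindex _ (curry_mxvec_bij _ _)) /=.
transitivity (\sum_i \sum_j A i j * B j i).
  by apply: eq_bigr => i _; rewrite mxE.
rewrite pair_bigA; apply: eq_bigr => -[i j] _ /=.
by rewrite mxE !mxvecE mxE.
Qed.

Lemma mxtrace_mul_delta m n (A : 'M[k]_(m, n)) a b :
  \tr (A *m delta_mx b a) = A a b.
Proof.
rewrite /mxtrace (bigD1 a) //= big1 => [|i ne_ia].
  rewrite addr0 mxE (bigD1 b) //= big1 => [|l ne_lb].
    by rewrite addr0 mxE !eqxx mulr1.
  by rewrite mxE (negPf ne_lb) mulr0.
by rewrite mxE big1 // => l _; rewrite mxE (negPf ne_ia) andbF mulr0.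
Qed.

(* The orthogonal, for the trace form, of the space spanned by the
   [act x h - h] is [equi A], so this is a double orthogonal. *)
Lemma trace_orthogonal M N (A : {set gT}) (f : Hom M N) : A \subset G ->
    (forall h : Hom N M, equi A h -> \tr (f *m h) = 0) ->
  exists h : gT -> Hom M N, f = \sum_(x in A) (act x (h x) - h x).
Proof.
move=> sAG f0.
pose D x := lin_mx (@act k gT G M N x) - 1%:M.
have DE x h : mxvec h *m D x = mxvec (act x h - h).
  by rewrite mulmxBr mulmx1 mul_vec_lin linearB.
have: (mxvec f <= \sum_(x in A) D x)%MS.
  rewrite submxE; apply/eqP/rowP=> j; rewrite [RHS]mxE.
  (* A column of the cokernel, read as a matrix [C], is a functional that vanishes on all the
     [act x h - h]. By adjunction [C] is then equivariant, so that the hypothesis on [f] applies to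
     it. *)
  set c := cokermx _ in j *.
  pose C : Hom N M := (vec_mx (col j c)^T)^T.
  have trC (h : Hom M N) : \tr (h *m C) = (mxvec h *m c) 0 j.
    rewrite mxtrace_mxvec trmxK vec_mxK trmxK !mxE.
    by apply: eq_bigr => l _; rewrite mxE.
  rewrite -trC; apply: f0 => x Ax; have Gx := subsetP sAG x Ax.
  have E (h : Hom M N) : \tr ((act x^-1%g h - h) *m C) = 0.
    have -> : act x^-1%g h - h = - (act x (act x^-1%g h) - act x^-1%g h).
      by rewrite actKV // opprB.
    rewrite mulNmx linearN /= trC -DE -mulmxA.
    have: (D x <= \sum_(y in A) D y)%MS by apply: (sumsmx_sup x).
    by rewrite submxE => /eqP ->; rewrite mulmx0 mxE oppr0.
  have E' (h : Hom M N) : \tr (h *m (act x C - C)) = 0.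
    rewrite mulmxBr linearB /= -{1}[x]invgK -tr_actl ?groupV //.
    by have:= E h; rewrite mulmxBl linearB.
  apply/eqP; rewrite -subr_eq0; apply/eqP/matrixP=> a b.
  have:= E' (delta_mx b a); rewrite mxtrace_mulC.
  by rewrite mxtrace_mul_delta => ->; rewrite mxE.
case/sub_sumsmxP=> u uE; exists (fun x => vec_mx (u x)).
apply: (can_inj mxvecK); rewrite uE linear_sum /=.
by apply: eq_bigr => x _; rewrite -DE vec_mxK.
Qed.

End Duality.

(** * Higman's criterion for projectivity *)

Section Higman.

Variables (k : fieldType) (gT : finGroupType) (G : {group gT}).
Local Notation module := (representation k G).
Local Notation Hom M N := 'M[k]_(rdegree M, rdegree N).
Implicit Types (M N L P : module) (x y : gT).

Lemma surjective_section M N (p : ghom M N) : surjective p ->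
  exists s : Hom N M, s *m p = 1%:M.
Proof.
move=> surp; exists (pinvmx p); rewrite -[pinvmx p]mul1mx mulmxKpV //.
by rewrite submx_full.
Qed.

Lemma higman_projective P : higman G P -> projective P.
Proof.
case=> r rE A B p f surp; have [s sp] := surjective_section surp.
have [g gE] := equi_ghom (@trf_equi _ _ _ _ (subxx G) _ _ (r *m f *m s)).
exists g; rewrite gE -trfMl //; last exact: ghom_equi.
rewrite -mulmxA sp mulmx1 trfMl //; last exact: ghom_equi.
by rewrite -rE mul1mx.
Qed.

(** The projection on the basis vector of the neutral element has as conjugates the projections on
    the other group elements, and these sum to the identity. *)
Lemma higman_regular : higman G (regular_module k G).
Proof.
pose e : 'I_(gcard G) := gring_index G 1.
pose d : Hom (regular_module k G) (regular_module k G) := delta_mx e e.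
exists d; apply/row_matrixP=> i; symmetry.
have rowE x : x \in G -> row i (act x d) =
    (x == enum_val i)%:R *: row i 1%:M.
  move=> Gx; rewrite actE !row_mul rowK.
  have Gi := enum_valP i.
  rewrite -rowE.
  have [-> | nex] := eqVneq x (enum_val i).
    rewrite mulgV scale1r row1 -/e.
    have -> : row e (delta_mx e e : 'M[k]_(gcard G)) = delta_mx 0 e.
      by apply/rowP=> j; rewrite !mxE !eqxx.
    by rewrite -rowE rowK gring_indexK ?group1 // mul1g gring_valK.
  rewrite scale0r.
  have -> : row (gring_index G (enum_val i * x^-1)) (delta_mx e e : 'M[k]_(gcard G)) = 0.
    apply/rowP=> j; rewrite !mxE; case: eqP => //= E; case/eqP: nex.
    have:= congr1 enum_val E; rewrite !gring_indexK ?group1 ?groupM ?groupV //.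
    by move/eqP; rewrite -eq_mulgV1 => /eqP ->.
  by rewrite mul0mx.
rewrite /trf linear_sum /= (bigD1 (enum_val i)) ?enum_valP //=.
rewrite rowE ?enum_valP // eqxx scale1r big1 ?addr0 // => x /andP[Gx nex].
by rewrite rowE // (negPf nex) scale0r.
Qed.

Lemma higman0 : higman G (grepr0 : module).
Proof. by exists 0; rewrite linear0; apply: flatmx0. Qed.

Lemma higmanD P Q : higman G P -> higman G Q -> higman G (dadd_grepr P Q).
Proof.
case=> r rE [r' rE'].
exists (block_mx r 0 0 r' : Hom (dadd_grepr P Q) (dadd_grepr P Q)).
have actE x : act x (block_mx r 0 0 r' : Hom (dadd_grepr P Q) (dadd_grepr P Q)) =
    block_mx (act x r) 0 0 (act x r').
  rewrite !actE /= !mulmx_block.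
  by rewrite !(mulmx0, mul0mx, addr0, add0r).
rewrite (scalar_mx_block (rdegree P) (rdegree Q) 1) rE rE' /trf.
under [RHS]eq_bigr do rewrite actE.
elim/big_rec3: _ => [|x A B C _ <-]; first by rewrite block_mx0.
by rewrite add_block_mx !addr0.
Qed.

Lemma higman_retract P Q (i : Hom P Q) (r : Hom Q P) :
  equi G i -> equi G r -> i *m r = 1%:M -> higman G Q -> higman G P.
Proof.
move=> iE rE ir [w wE]; exists (i *m w *m r).
by rewrite trfMl // trfMr // -wE mulmx1.
Qed.

Lemma higman_onto M : exists (P : module) (p : ghom P M),
  higman G P /\ surjective p.
Proof.
suff H m (W : 'M[k]_(m, rdegree M)) : exists (P : module) (p : ghom P M),
    higman G P /\ (W <= p)%MS.
  have [P [p [prP sub]]] := H _ 1%:M.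
  by exists P, p; split=> //; rewrite /surjective -sub1mx.
elim: m W => [|m IH] W.
  exists grepr0, (ghom0 _ _); split; first exact: higman0.
  by rewrite [W]flatmx0 sub0mx.
rewrite -[W](@vsubmxK _ 1 m).
have [P [p [hP sub]]] := IH (@dsubmx _ 1 m _ W).
pose q := regular_ghom (@usubmx _ 1 m _ W).
exists (dadd_grepr (regular_module k G) P), (col_ghom q p).
split; first exact: higmanD higman_regular hP.
rewrite /= (@col_mx_sub _ 1 m) -!(addsmxE q p); apply/andP; split; last first.
  exact: submx_trans sub (addsmxSr _ _).
apply: submx_trans (addsmxSl _ _).
rewrite -[X in (X <= _)%MS](_ : row (gring_index G 1) q = _) ?row_sub //.
by rewrite rowK gring_indexK ?group1 // repr_mx1 mulmx1.
Qed.

Lemma projectiveP P : projective P <-> higman G P.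
Proof.
split=> [prP | hP]; last exact: higman_projective.
have [Q [p [hQ surp]]] := higman_onto P.
have [s sp] := prP _ _ p (ghom_id P) surp.
exact: higman_retract (ghom_equi s) (ghom_equi p) sp hQ.
Qed.

(** A transfer factors through any surjection onto its target from a projective module: lift [h]
    linearly and transfer the lift. *)
Lemma stable_eqP M N (f g : ghom M N) :
  stable_eq f g <-> null G (ghom_mx f - ghom_mx g).
Proof.
split=> [[P [/projectiveP hP [a [b ->]]]] | [h hE]].
  by apply: nullMl; [exact: subxx | exact: ghom_equi | apply: higman_nullr (ghom_equi a)].
have [Q [p [hQ surp]]] := higman_onto N.
have [s sp] := surjective_section surp.
exists Q; split; first exact/projectiveP.
have [a aE] := equi_ghom (@trf_equi _ _ _ _ (subxx G) _ _ (h *m s)).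
exists a, p; rewrite aE hE -trfMl //; last exact: ghom_equi.
by rewrite -mulmxA sp mulmx1.
Qed.

End Higman.

(** * Connecting homomorphisms *)

(* [p : P -> N] is the projective cover, [i] the inclusion of its kernel;
   [s] and [c] are linear splittings. *)
Section Cover.

Variables (k : fieldType) (gT : finGroupType) (G : {group gT}).
Local Notation module := (representation k G).
Local Notation Hom M N := 'M[k]_(rdegree M, rdegree N).
Implicit Types (M N L P : module) (x y : gT).

Local Notation cover := Defs.cover.

Definition cov_mx N : Hom (cover N) N := cover_map N.
Definition syz_mx N : Hom (syzygy N) (cover N) := locked (ghom_mx (syzygy_incl N)).

Definition cov_sec N : Hom N (cover N) := locked (pinvmx (cov_mx N)).
Definition cov_ret N : Hom (cover N) (syzygy N) :=
  locked ((1%:M - cov_mx N *m cov_sec N) *m pinvmx (syz_mx N)).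

Local Notation p N := (cov_mx N).
Local Notation i N := (syz_mx N).
Local Notation s N := (cov_sec N).
Local Notation c N := (cov_ret N).

Lemma cover_higman N : higman G (cover N).
Proof. by have [/projectiveP] := cover_mapP N. Qed.

Lemma cov_secK N : s N *m p N = 1%:M.
Proof.
have [_ surp _] := cover_mapP N.
by rewrite /cov_sec -lock -[pinvmx _]mul1mx mulmxKpV // submx_full.
Qed.

Lemma syz_cover N : i N *m p N = 0. Proof. by rewrite /syz_mx -lock; apply: syzygy_incl0. Qed.

Lemma cov_retK N : c N *m i N = 1%:M - p N *m s N.
Proof.
rewrite /cov_ret -lock mulmxKpV //.
suff: (1%:M - p N *m s N <= kermx (p N))%MS.
  by move/submx_trans; apply; rewrite /syz_mx -lock /= val_submod1.
by apply/sub_kermxP; rewrite mulmxBl mul1mx -mulmxA cov_secK mulmx1 subrr.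
Qed.

Lemma syz_inj N m (A B : 'M_(m, rdegree (syzygy N))) : A *m i N = B *m i N -> A = B.
Proof. by rewrite /syz_mx -lock; apply: incl_inj. Qed.

Lemma cov_ret_id N : i N *m c N = 1%:M.
Proof.
apply: syz_inj.
by rewrite -mulmxA cov_retK mulmxBr mulmx1 mulmxA syz_cover mul0mx subr0 mul1mx.
Qed.

Lemma cov_retE N m (A : 'M_(m, rdegree (cover N))) :
  A *m p N = 0 -> A *m c N *m i N = A.
Proof.
by move=> A0; rewrite -mulmxA cov_retK mulmxBr mulmxA A0 mul0mx subr0 mulmx1.
Qed.

Lemma cover_equi N (K : {group gT}) : K \subset G -> equi K (p N).
Proof. by move=> sKG; apply: equiS (ghom_equi _). Qed.

Lemma syz_equi N (K : {group gT}) : K \subset G -> equi K (i N).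
Proof. by move=> sKG; rewrite /syz_mx -lock; apply: equiS (ghom_equi _). Qed.

Lemma cov_ret_equi M N (K : {set gT}) (f : Hom M (cover N)) : K \subset G ->
  equi K f -> f *m p N = 0 -> equi K (f *m c N).
Proof.
move=> sKG fE f0 x Kx; have Gx := subsetP sKG x Kx; apply: syz_inj.
transitivity (act x (f *m c N *m i N)); last by rewrite cov_retE ?fE.
by rewrite [RHS]act_mul // (syz_equi N (subxx G)).
Qed.

(* The connecting homomorphism of the cover sequence applied to [f], where
   [K] is a group such that [trf K f = 0]. *)
Definition conn M N (K : {set gT}) (f : Hom M N) : Hom M (syzygy N) :=
  locked (trf K (f *m s N) *m c N).

Lemma conn_def M N (K : {set gT}) (f : Hom M N) :
  conn K f = trf K (f *m s N) *m c N.
Proof. by rewrite /conn -lock. Qed.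

Lemma connE M N (K : {group gT}) (f : Hom M N) : K \subset G ->
  trf K f = 0 -> conn K f *m i N = trf K (f *m s N).
Proof.
move=> sKG f0; rewrite conn_def cov_retE // -trfMl //; last exact: cover_equi.
by rewrite -mulmxA cov_secK mulmx1.
Qed.

Lemma conn_equi M N (K : {group gT}) (f : Hom M N) : K \subset G ->
  trf K f = 0 -> equi K (conn K f).
Proof.
move=> sKG f0; rewrite conn_def; apply: cov_ret_equi => //; first exact: trf_equi.
rewrite -trfMl //; last exact: cover_equi.
by rewrite -mulmxA cov_secK mulmx1.
Qed.

(* By duality [trnull K f] makes [f] a combination of the [act x h - h], which
   lifts to a combination of the same kind, with zero transfer. *)
Lemma null_connP M N (K : {group gT}) (f : Hom M N) : K \subset G ->
  trf K f = 0 -> null K (conn K f) <-> trnull K f.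
Proof.
move=> sKG f0; split=> [[w wE] | tf].
  (* These two maps into the cover have the same transfer, so their difference is orthogonal to the
     equivariant maps; composing with the cover map leaves [f]. *)
  have d0 : trf K (f *m s N - w *m i N) = 0.
    by rewrite linearB /= (trfMl sKG _ (syz_equi N sKG)) -wE connE // subrr.
  have hP : higman K (cover N) by apply: null_sub (cover_higman N).
  have := trnullMr sKG (cover_equi N sKG) (trf0_trnull sKG hP d0).
  by rewrite mulmxBl -!mulmxA syz_cover mulmx0 subr0 cov_secK mulmx1.
have [h hE] := trace_orthogonal sKG tf.
pose d := f *m s N - \sum_(x in K) (act x (h x *m s N) - h x *m s N).
have d0 : d *m p N = 0.
  rewrite mulmxBl -mulmxA cov_secK mulmx1 mulmx_suml {1}hE -sumrB big1 // => x Kx.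
  have Gx := subsetP sKG x Kx.
  have E : act x (h x *m s N) *m p N = act x (h x).
    rewrite -[X in _ *m X](cover_equi N sKG Kx) -act_mul //.
    by rewrite -mulmxA cov_secK mulmx1.
  by rewrite mulmxBl E -mulmxA cov_secK mulmx1 subrr.
exists (d *m c N); apply: syz_inj; rewrite connE // -trfMl //; last exact: syz_equi.
rewrite cov_retE // linearB /= [trf K (\sum_(_ in _) _)]linear_sum /= big1 ?subr0 // => x Kx.
by rewrite linearB /= trf_act // subrr.
Qed.

(** Any linear lift to the cover computes the connecting map: two lifts differ by a map into the
    syzygy, whose transfer is the error term. *)
Lemma conn_lift M N (K : {group gT}) (f : Hom M N) (f' : Hom M (cover N)) :
    K \subset G -> trf K f = 0 -> f' *m p N = f ->
  exists w, conn K f = trf K f' *m c N + trf K w.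
Proof.
move=> sKG f0 fE; exists ((f *m s N - f') *m c N).
have d0 : (f *m s N - f') *m p N = 0.
  by rewrite mulmxBl -mulmxA cov_secK mulmx1 fE subrr.
have E : trf K f' *m p N = 0 by rewrite -(trfMl sKG _ (cover_equi N sKG)) fE.
apply: syz_inj; rewrite connE // mulmxDl -(trfMl sKG _ (syz_equi N sKG)).
by rewrite (cov_retE d0) linearB /= (cov_retE E) addrC subrK.
Qed.

End Cover.

(** * Characteristic 2 and the periodicity over a group of order 2 *)

Section CharTwo.

Variables (k : fieldType) (gT : finGroupType) (G : {group gT}).
Local Notation module := (representation k G).
Local Notation Hom M N := 'M[k]_(rdegree M, rdegree N).
Implicit Types (M N L P : module) (x y : gT) (K H : {group gT}).
Hypothesis char2 : 2%N \in [pchar k]%R.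

Lemma addmm2 m n (A : 'M[k]_(m, n)) : A + A = 0.
Proof.
apply/matrixP=> i j; rewrite !mxE.
by rewrite -mulr2n -mulr_natr (pcharf0 char2) mulr0.
Qed.

Lemma addr2_pchar (a : k) : a + a = 0.
Proof. by rewrite -mulr2n -mulr_natr (pcharf0 char2) mulr0. Qed.

Lemma oppm2 m n (A : 'M[k]_(m, n)) : - A = A.
Proof. by apply/eqP; rewrite -subr_eq0 -opprD addmm2 oppr0. Qed.

Lemma trf_fixed M N K (f : Hom M N) : equi K f -> ~~ odd #|K| -> trf K f = 0.
Proof.
move=> fE evK; rewrite /trf (eq_bigr (fun=> f)) // sumr_const.
rewrite -(odd_double_half #|K|) (negPf evK) add0n -muln2 mulrnA mulr2n.
exact: addmm2.
Qed.

Lemma trnull_trf M N K (f : Hom M N) : K \subset G -> ~~ odd #|K| ->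
  trnull K (trf K f).
Proof.
by move=> sKG evK h hE; rewrite tr_trf // trf_fixed // mulmx0 linear0.
Qed.

Lemma trf_cycle2 M N x (f : Hom M N) : #[x]%g = 2%N ->
  trf <[x]>%g f = f + act x f.
Proof.
move=> ox; rewrite /trf cycle2g // big_setU1 /= ?big_set1 ?act1g //.
by rewrite inE eq_sym -order_gt1 ox.
Qed.

Definition eqmod M N K (f g : Hom M N) := null K (f - g).

Lemma eqmod_refl M N K (f : Hom M N) : eqmod K f f.
Proof. by rewrite /eqmod subrr; apply: null0. Qed.

Lemma eqmod_sym M N K (f g : Hom M N) : eqmod K f g -> eqmod K g f.
Proof. by rewrite /eqmod -opprB => /nullN; rewrite opprK. Qed.

Lemma eqmod_trans M N K (g f h : Hom M N) :
  eqmod K f g -> eqmod K g h -> eqmod K f h.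
Proof. by move=> fg gh; rewrite /eqmod -(subrKA g); apply: nullD. Qed.

Lemma eqmodMl M N L K (f f' : Hom M N) (g : Hom N L) : K \subset G ->
  equi K g -> eqmod K f f' -> eqmod K (f *m g) (f' *m g).
Proof. by move=> sKG gE ff; rewrite /eqmod -mulmxBl; apply: nullMl. Qed.

Lemma eqmodMr M N L K (f : Hom M N) (g g' : Hom N L) : K \subset G ->
  equi K f -> eqmod K g g' -> eqmod K (f *m g) (f *m g').
Proof. by move=> sKG fE gg; rewrite /eqmod -mulmxBr; apply: nullMr. Qed.

Lemma eqmod_tr M K (f g : Hom M M) : K \subset G -> ~~ odd #|K| ->
  eqmod K f g -> \tr f = \tr g.
Proof.
move=> sKG evK [w E]; apply/eqP; rewrite -subr_eq0 -linearB /= E.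
rewrite -[trf K w]mulmx1 tr_trf // trf_fixed ?mulmx0 ?linear0 //.
exact: equi1.
Qed.

Lemma conn_mul L M N K (g : Hom L M) (f : Hom M N) : K \subset G ->
  equi K g -> conn K (g *m f) = g *m conn K f.
Proof. by move=> sKG gE; rewrite !conn_def -mulmxA trfMr // mulmxA. Qed.

(** The map of covers [h] takes a lift of [b] to a lift of [b *m f], and the choice of a lift costs
    only a transfer. *)
Lemma conn_natural L M N K (b : Hom L M) (f : ghom M N)
    (f1 : ghom (syzygy M) (syzygy N)) : K \subset G -> trf K b = 0 ->
  induced_by f f1 -> eqmod K (conn K b *m f1) (conn K (b *m f)).
Proof.
move=> sKG b0 [h [hE f1E]].
have sGG := subxx G.
have fE : equi K f by apply: equiS (ghom_equi f).
have bf0 : trf K (b *m f) = 0 by rewrite trfMl // b0 mul0mx.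
have [|w wE] := @conn_lift _ _ _ _ _ _ (b *m f) (b *m cov_sec M *m h) sKG bf0.
  by rewrite -!mulmxA [X in cov_sec _ *m X](_ : _ = cov_mx M *m f) // (mulmxA (cov_sec M)) cov_secK mul1mx.
apply: eqmod_sym; exists w; rewrite wE addrAC.
suff -> : trf K (b *m cov_sec M *m h) *m cov_ret N = conn K b *m f1.
  by rewrite subrr add0r.
have hK : equi K h by apply: equiS (ghom_equi h).
apply: syz_inj; rewrite cov_retE; last first.
  rewrite -trfMl //; last exact: cover_equi.
  by rewrite -!mulmxA [X in cov_sec _ *m X](_ : _ = cov_mx M *m f) // (mulmxA (cov_sec M)) cov_secK mul1mx.
rewrite trfMl // -connE // -!mulmxA; congr (_ *m _).
by rewrite /syz_mx -!lock f1E.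
Qed.

(** A transfer over a group of even order is orthogonal to equivariant maps, and [null_connP] turns
    this into nullity. It is the reason why [psi] is natural although [eta] is so only modulo maps
    null on [<[z]>]. *)
Lemma conn_eqmod M N K H (f g : Hom M N) : K \subset G -> H \subset K ->
    ~~ odd #|H| -> trf K f = 0 -> trf K g = 0 ->
  eqmod H f g -> eqmod K (conn K f) (conn K g).
Proof.
move=> sKG sHK evH f0 g0 [w wE].
rewrite /eqmod !conn_def -mulmxBl -linearB /= -mulmxBl -conn_def.
apply/null_connP => //; first by rewrite linearB /= f0 g0 subr0.
rewrite wE; apply: (trnullS sHK); apply: trnull_trf => //.
exact: subset_trans sHK sKG.
Qed.

Definition Om j M : module := fob (functor_pow (Omega k G) j) M.

Section Periodicity.

Variable z : gT.
Hypotheses (Gz : z \in G) (oz : #[z]%g = 2%N).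
Local Notation C := (<[z]>%g).

Let sCG : C \subset G. Proof. by rewrite cycle_subG. Qed.
Let evC : ~~ odd #|C|. Proof. by rewrite -orderE oz. Qed.

(* Over the group of order 2 generated by [z] each module is isomorphic to its
   syzygy up to projectives; [eta] is that isomorphism. *)
Definition eta M : Hom M (syzygy M) := conn C (1%:M : Hom M M).

Fixpoint etap j M : Hom M (Om j M) :=
  if j is j'.+1 then etap j' M *m eta (Om j' M) else 1%:M.

Lemma etapS j M : etap j.+1 M = etap j M *m eta (Om j M).
Proof. by []. Qed.

Lemma trf_C1 M : trf C (1%:M : Hom M M) = 0.
Proof. by apply: trf_fixed => //; apply: equi1. Qed.

Lemma eta_equi M : equi C (eta M).
Proof. by apply: conn_equi => //; apply: trf_C1. Qed.

Lemma etap_equi j M : equi C (etap j M).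
Proof.
elim: j => [|j IH] /=; first exact: equi1.
by apply: equiM => //; apply: eta_equi.
Qed.

Lemma mul_eta M N (f : Hom M N) : equi C f -> f *m eta N = conn C f.
Proof. by move=> fE; rewrite -{2}[f]mulmx1 conn_mul. Qed.

Definition fmapOm j M N (f : ghom M N) : ghom (Om j M) (Om j N) :=
  fmap (functor_pow (Omega k G) j) f.

Lemma etap_natural j M N (f : ghom M N) :
  eqmod C (etap j M *m fmapOm j f) (f *m etap j N).
Proof.
elim: j => [|j IH]; first by rewrite /= mul1mx mulmx1; apply: eqmod_refl.
have fE : equi C f by apply: equiS (ghom_equi f).
have jE : equi C (fmapOm j f) by apply: equiS (ghom_equi _).
apply: (@eqmod_trans _ _ _ (etap j M *m fmapOm j f *m eta (Om j N))); last first.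
  by rewrite etapS mulmxA; apply: (eqmodMl _ _ IH) => //; apply: eta_equi.
rewrite etapS -!mulmxA; apply: eqmodMr => //; first exact: etap_equi.
rewrite mul_eta //.
have := conn_natural sCG (trf_C1 (Om j M)) (syzygy_mapP (fmapOm j f)).
by rewrite mul1mx.
Qed.

(** In [trf_lreps] the transfer over the subgroup comes last. Passing to the other factor of the
    trace form makes it act on [f] first, where it gives twice [f]. *)
Lemma trf_equi_C M N K (f : Hom M N) : K \subset G -> C \subset K ->
  equi C f -> trf K f = 0.
Proof.
move=> sKG sCK fE; apply/matrixP=> a b; rewrite mxE -mxtrace_mul_delta.
rewrite (tr_trf sKG) (trf_lreps _ sCK) // -(tr_trf sCG) trf_fixed //.
by rewrite mul0mx linear0.
Qed.

End Periodicity.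

End CharTwo.

(** * The natural maps *)

Section Words.

Variables (k : fieldType) (gT : finGroupType) (G : {group gT}).
Local Notation module := (representation k G).
Local Notation Hom M N := 'M[k]_(rdegree M, rdegree N).
Implicit Types (M N L P : module) (x y : gT) (K H : {group gT}).
Hypothesis char2 : 2%N \in [pchar k]%R.

Variable z : gT.
Hypotheses (Gz : z \in G) (oz : #[z]%g = 2%N).
Local Notation C := (<[z]>%g).
Local Notation etap := (@etap k gT G z).

Let sCG : C \subset G. Proof. by rewrite cycle_subG. Qed.
Let evC : ~~ odd #|C|. Proof. by rewrite -orderE oz. Qed.

Definition psi j M : Hom M (Om j.+1 M) := conn G (etap j M).

Lemma trf_etap j M : trf G (etap j M) = 0.
Proof. by apply: (trf_equi_C char2 Gz oz) => //; apply: etap_equi. Qed.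

Lemma psi_equi j M : equi G (psi j M).
Proof. by apply: conn_equi => //; apply: trf_etap. Qed.

Lemma psi_natural j M N (f : ghom M N) :
  eqmod G (psi j M *m fmapOm j.+1 f) (f *m psi j N).
Proof.
have fE := ghom_equi f; have sGG := subxx G.
apply: (@eqmod_trans _ _ _ _ _ _ (conn G (etap j M *m fmapOm j f))).
  exact: conn_natural (trf_etap j M) (syzygy_mapP (fmapOm j f)).
rewrite /psi -conn_mul //; apply: (@conn_eqmod _ _ _ char2 _ _ _ C) => //.
- by rewrite trfMl ?trf_etap ?mul0mx //; apply: ghom_equi.
- by rewrite trfMr ?trf_etap ?mulmx0 //; apply: ghom_equi.
- exact: etap_natural.
Qed.

Lemma psi_nullP j M N (g : Hom M N) : equi G g ->
  null G (g *m psi j N) <-> trnull G (g *m etap j N).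
Proof.
move=> gE; rewrite /psi -conn_mul //; apply: null_connP => //.
by rewrite trfMr ?trf_etap ?mulmx0.
Qed.

(* A sufficient supply of factors that are null over the noncentral involution
   [s] makes the composite with a power of [eta] equivariant for the four-group
   generated by [s] and [z]. *)
Section FourGroup.

Variables (s : gT) (A : {group gT}).
Hypotheses (sAG : A \subset G) (sCA : C \subset A) (sBA : <[s]>%g \subset A).
Hypothesis os : #[s]%g = 2%N.
Hypothesis trfA : forall M N (f : Hom M N), trf A f = trf C (trf <[s]>%g f).

Local Notation B := (<[s]>%g).
Let sBG : B \subset G. Proof. exact: subset_trans sBA sAG. Qed.
Let evB : ~~ odd #|B|. Proof. by rewrite -orderE os. Qed.
Definition lift_eta j M N (c : Hom M N) : Prop :=
  exists2 d : Hom M (Om j N), equi A d & eqmod C (c *m etap j N) d.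

Lemma lift_eta0 M N (c : Hom M N) : equi A c -> lift_eta 0 c.
Proof. by move=> cE; exists c; rewrite ?mulmx1 //; apply: eqmod_refl. Qed.

Lemma lift_etaM j L M N (a : Hom L M) (c : Hom M N) :
  equi A a -> lift_eta j c -> lift_eta j (a *m c).
Proof.
move=> aE [d dE cd]; exists (a *m d); first exact: equiM.
by rewrite -mulmxA; apply: eqmodMr => //; apply: equiS aE.
Qed.

(** Write [u = trf B h]. Since [trf A] is [trf C] after [trf B], the map [conn A (h *m d)] is also
    computed over [C], from the lift [trf B (h *m d *m cov_sec _)] of [u *m d]; so it represents
    [u *m d] times [eta]. *)
Lemma lift_etaS j L M N (u : Hom L M) (c : Hom M N) :
    equi A u -> null B u -> lift_eta j c -> lift_eta j.+1 (u *m c).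
Proof.
move=> uE [h uh] [d dE cd].
have dC : equi C d by apply: equiS dE.
have uC : equi C u by apply: equiS uE.
have udh : u *m d = trf B (h *m d) by rewrite trfMl ?uh //; apply: equiS dE.
have hd0 : trf A (h *m d) = 0 by rewrite trfA -udh trf_fixed //; apply: equiM.
exists (conn A (h *m d)); first exact: conn_equi.
apply: (@eqmod_trans _ _ _ _ _ _ (u *m d *m eta z (Om j N))).
  rewrite etapS mulmxA; apply: eqmodMl => //; first exact: eta_equi.
  by rewrite -mulmxA; apply: eqmodMr.
rewrite mul_eta //; last exact: equiM.
have u0 : trf C (u *m d) = 0 by apply: trf_fixed => //; apply: equiM.
have [|w wE] := @conn_lift _ _ _ _ _ _ _ (trf B (h *m d *m cov_sec _)) sCG u0.
  by rewrite -(trfMl sBG _ (cover_equi _ sBG)) -(mulmxA (h *m d)) cov_secK mulmx1 udh.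
by exists w; rewrite wE conn_def trfA addrAC subrr add0r.
Qed.

(** Included in the cover, the [A]-map [d] becomes a transfer over [A]. Comparing it with the
    connecting map that computes [b *m eta], where [b] has one power less, shows that [b] is a
    transfer over [B] plus a map orthogonal to the [C]-maps. *)
Lemma lift_eta_trnull j M N (c : Hom M N) : equi C c ->
  lift_eta j.+1 c -> trnull A (c *m etap j N).
Proof.
move=> cE [d dE [w]]; rewrite etapS mulmxA.
have bE : equi C (c *m etap j N) by apply: equiM => //; apply: etap_equi.
move: (c *m _) bE => b bE; rewrite mul_eta // => /(canRL (subrK _)) bd.
have b0 : trf C b = 0 by apply: trf_fixed.
set N' := Om j N in b bE b0 w d dE bd *.
have [r dr] : null A (d *m syz_mx N').
  apply: higman_nullr => //; last by apply: equiM => //; apply: syz_equi.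
  exact: null_sub sAG _ (cover_higman N').
pose e := b *m cov_sec N' - trf B r - w *m syz_mx N'.
have e0 : trf C e = 0.
  rewrite !linearB /= -connE // bd -trfA -dr (trfMl sCG _ (syz_equi N' sCG)).
  by rewrite mulmxDl addrK subrr.
have te : trnull C e.
  apply: trf0_trnull e0 => //; exact: null_sub sCG _ (cover_higman N').
have := trnullMr sCG (cover_equi N' sCG) te.
rewrite !mulmxBl -!mulmxA syz_cover mulmx0 subr0 cov_secK mulmx1.
rewrite -trfMl //; last exact: cover_equi.
move=> {}te; rewrite -(subrK (trf B (r *m cov_mx N')) b).
apply: trnullD; first exact: trnullS te.
by apply: (trnullS sBA); apply: trnull_trf.
Qed.

End FourGroup.

Variables (S : {group gT}) (s : bool -> gT) (A : bool -> {group gT}).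
Hypothesis sSG : S \subset G.
Hypothesis defS : S :=: <<[set s true; s false]>>%g.
Hypothesis s_neq : s true != s false.
Hypothesis os : forall i, #[s i]%g = 2%N.
Hypotheses (sCA : forall i, C \subset A i) (sBA : forall i, <[s i]>%g \subset A i).
Hypothesis sAS : forall i, A i \subset S.
Hypothesis trfA : forall i M N (f : Hom M N),
  trf (A i) f = trf C (trf <[s i]>%g f).

Lemma mem_s i : s i \in S.
Proof. by rewrite -cycle_subG (subset_trans (sBA i)). Qed.
Hint Resolve mem_s : core.

Lemma equi_s M N (f : Hom M N) : (forall i, act (s i) f = f) -> equi S f.
Proof.
move=> fE; rewrite defS; apply: equi_gen => [|x].
  by apply/subsetP=> x /set2P[] ->; apply: (subsetP sSG).
by case/set2P=> ->.
Qed.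

(** Equivariance for [S] is tested on its two generators, so the double orthogonal involves only
    [act x h - h] for these [x]; in characteristic 2 this is a transfer over [<[x]>]. *)
Lemma trnull_split M N (u : Hom M N) : trnull S u ->
  exists h : bool -> Hom M N,
    u = trf <[s true]>%g (h true) + trf <[s false]>%g (h false).
Proof.
move=> u0; have sXG : [set s true; s false] \subset G.
  by apply/subsetP=> x /set2P[] ->; apply: (subsetP sSG).
have [|h hE] := trace_orthogonal sXG (f := u).
  move=> h hX; apply: u0; apply: equi_s => -[]; apply: hX; rewrite !inE eqxx ?orbT //.
exists (fun i => h (s i)); rewrite hE big_setU1 ?big_set1 ?inE //=.
by rewrite !trf_cycle2 // !oppm2 // ![act _ _ + _]addrC.
Qed.

(* If [u] is a map for the whole of [S], then so are both summands: the first
   one is fixed by [s true] by construction and by [s false] because the second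
   one is. *)
Lemma trnull_splitE M N (u : Hom M N) : trnull S u -> equi S u ->
  exists2 v : bool -> Hom M N, u = v true + v false &
    forall i, equi S (v i) /\ null <[s i]>%g (v i).
Proof.
move=> u0 uE; have [h hE] := trnull_split u0.
exists (fun i => trf <[s i]>%g (h i)) => // i; split; last by exists (h i).
have sB i' : <[s i']>%g \subset G by rewrite cycle_subG (subsetP sSG).
have fix_self i' : act (s i') (trf <[s i']>%g (h i')) = trf <[s i']>%g (h i').
  exact: (trf_equi (sB i') (h i') (cycle_id _)).
have fix_u i' : act (s i') u = u by apply: uE.
have fixN i' : act (s (~~ i')) (trf <[s i']>%g (h i')) = trf <[s i']>%g (h i').
  have E : trf <[s i']>%g (h i') = u - trf <[s (~~ i')]>%g (h (~~ i')).
    by rewrite hE; case: i'; rewrite /= ?addrK // addrAC subrr add0r.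
  by rewrite E linearB /= fix_u fix_self.
apply: equi_s => i'; have [->|] := eqVneq i' i; first exact: fix_self.
by move=> ne; rewrite (_ : i' = ~~ i) ?fixN //; case: i' i ne => [] [].
Qed.

(** The indices count the factors null on [<[s true]>] and those null on [<[s false]>]. The factors
    may run through different modules, and the last one is any [S]-map. *)
Inductive word : nat -> nat -> forall M N, Hom M N -> Prop :=
| word0 M N (c : Hom M N) : equi S c -> word 0 0 c
| word_cons (i : bool) a b M Y N (u : Hom M Y) (c : Hom Y N) :
    equi S u -> null <[s i]>%g u -> word a b c ->
    word (i + a) (~~ i + b) (u *m c).

Lemma word_equi a b M N (c : Hom M N) : word a b c -> equi S c.
Proof. by elim=> // *; apply: equiM. Qed.

Lemma wordMl a b L M N (d : Hom L M) (c : Hom M N) :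
  equi S d -> word a b c -> word a b (d *m c).
Proof.
move=> dE wc; elim: wc L d dE => {a b M N c} [M N c cE | i a b M Y N u c uE nu wc IH] L d dE.
  by apply: word0; apply: equiM.
rewrite mulmxA; apply: word_cons => //; first exact: equiM.
by apply: nullMr => //; rewrite ?cycle_subG ?(subsetP sSG) //; apply: equiS dE; rewrite cycle_subG.
Qed.

Lemma word_cat a b a' b' L M N (d : Hom L M) (c : Hom M N) :
  word a b d -> word a' b' c -> word (a + a') (b + b') (d *m c).
Proof.
move=> wd wc; elim: wd N c wc => {a b L M d} [L M d dE | i a b L Y M u d uE nu wd IH] N c wc.
  exact: wordMl.
by rewrite -mulmxA -!addnA; apply: word_cons => //; apply: IH.
Qed.

Lemma word_leq a b a' b' M N (c : Hom M N) :
  word a b c -> (a' <= a)%N -> (b' <= b)%N -> word a' b' c.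
Proof.
move=> wc; elim: wc a' b' => {a b M N c} [M N c cE | i a b M Y N u c uE nu wc IH] a' b'.
  by rewrite !leqn0 => /eqP -> /eqP ->; apply: word0.
case: i uE nu => uE nu; rewrite ?add1n ?add0n => lea leb.
  case: a' lea => [|a'] lea; first by apply: wordMl => //; apply: IH.
  by rewrite -add1n -[b']add0n; apply: (@word_cons true) => //; apply: IH.
case: b' leb => [|b'] leb; first by apply: wordMl => //; apply: IH.
by rewrite -(add1n b') -[a']add0n; apply: (@word_cons false) => //; apply: IH.
Qed.

(** Over [A i] a factor of kind [i] raises the power of [eta] by one, and a factor of the other
    kind, being equivariant, preserves it. *)
Lemma word_lift a b M N (c : Hom M N) : word a b c ->
  forall i, lift_eta (A i) (if i then a else b) c.
Proof.
elim=> {a b M N c} [M N c cE i | i a b M Y N u c uE nu wc IH i'].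
  by case: i; apply: lift_eta0; apply: equiS cE.
have cC : equi (A i') u by apply: equiS uE.
have [E|ne] := eqVneq i' i.
  subst i'; have := @lift_etaS (s i) (A i) _ _ _ _ (if i then a else b) _ _ _ u c.
  case: i uE nu IH cC => uE nu IH cC; rewrite /= ?add1n; apply => //; try exact: (IH true); try exact: (IH false); exact: subset_trans (sAS _) sSG.
suff: lift_eta (A i') (if i' then a else b) (u *m c).
  by case: i' i ne {IH cC nu} => [] [].
by apply: lift_etaM (IH i') => //; exact: subset_trans (sAS _) sSG.
Qed.

Lemma word_trnull a b j M N (c : Hom M N) : word a b c ->
  (j < a)%N || (j < b)%N -> trnull S (c *m etap j N).
Proof.
move=> wc ltj; have sCS : C \subset S by apply: subset_trans (sAS true).
have cC : equi C c by apply: equiS (word_equi wc).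
have [i li] : exists i, lift_eta (A i) j.+1 c.
  case/orP: ltj => lt_j.
    by exists true; apply: (word_lift (word_leq wc lt_j (leq0n _)) true).
  by exists false; apply: (word_lift (word_leq wc (leq0n _) lt_j) false).
apply: (trnullS (sAS i)); apply: (@lift_eta_trnull (s i)) => //.
exact: subset_trans (sAS _) sSG.
Qed.

Lemma null_trnull j L M N (f : Hom L M) (c : Hom M N) :
  equi S f -> null S f -> equi S c -> trnull S (f *m c *m etap j N).
Proof.
move=> fE nf cE h hE; rewrite -!mulmxA; apply: (tr_null_trf0 sSG nf).
have sCS : C \subset S by apply: subset_trans (sAS true).
apply: (trf_equi_C char2 Gz oz) => //.
have E K L' M' (g : Hom L' M') : equi S g -> equi C g by move=> gE; apply: equiS gE.
by apply: equiM; rewrite //; [apply: equiS cE | apply: equiM => //; [apply: etap_equi | apply: equiS hE]].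
Qed.

End Words.

(** * The Euler class *)

Section InvolutionSum.

(** A two-element orbit contributes the same value twice, that is zero; [enum_rank] selects one
    point of each. *)
Lemma sum_involution (k : fieldType) (T : finType) (A : {set T}) (i : T -> T)
    (F : T -> k) : 2%N \in [pchar k]%R ->
    {in A, forall x, i x \in A} -> {in A, involutive i} ->
    {in A, forall x, F (i x) = F x} ->
  \sum_(x in A) F x = \sum_(x in A | i x == x) F x.
Proof.
move=> char2 iA iK Fi; rewrite (bigID (fun x => i x == x)) /=.
rewrite [X in _ + X](_ : _ = 0) ?addr0 //.
rewrite (bigID (fun x => enum_rank x < enum_rank (i x))%N) /=.
rewrite [X in _ + X](reindex_onto i i) /=; last first.
  by move=> x /andP[/andP[Ax _] _]; apply: iK.
rewrite [X in _ + X](_ : _ = \sum_(x in A | (i x != x) && (enum_rank x < enum_rank (i x))%N) F x).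
  by under eq_bigl do rewrite -andbA; apply: addr2_pchar.
apply: eq_big => [x | x /andP[/andP[/andP[Aix nix] _] /eqP iix]]; last first.
  by rewrite Fi // -iix iA.
apply/idP/idP => [/andP[/andP[/andP[Aix nix] ltx] /eqP iix] | /and3P[Ax nix ltx]].
  have Ax : x \in A by rewrite -iix iA.
  rewrite Ax; rewrite iix in nix ltx; rewrite eq_sym nix /=.
  rewrite ltn_neqAle leqNgt ltx andbT.
  by apply: contra nix => /eqP E; apply/eqP/enum_rank_inj/val_inj.
by rewrite iA // iK // eq_sym nix eqxx /= andbT -leqNgt ltnW.
Qed.

End InvolutionSum.

Section EulerClass.

Variables (k : fieldType) (gT : finGroupType) (G : {group gT}).
Local Notation module := (representation k G).
Local Notation Hom M N := 'M[k]_(rdegree M, rdegree N).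
Implicit Types (M N L P : module) (x y : gT) (K H : {group gT}).
Hypothesis char2 : 2%N \in [pchar k]%R.

Variable z : gT.
Hypotheses (Gz : z \in G) (oz : #[z]%g = 2%N).
Local Notation C := (<[z]>%g).
Local Notation etap := (@etap k gT G z).

Let sCG : C \subset G. Proof. by rewrite cycle_subG. Qed.
Let evC : ~~ odd #|C|. Proof. by rewrite -orderE oz. Qed.

Variables (S : {group gT}) (s : bool -> gT) (A : bool -> {group gT}) (q : nat).
Hypothesis sSG : S \subset G.
Hypothesis sylS : odd #|G : S|%g.
Hypothesis defS : S :=: <<[set s true; s false]>>%g.
Hypothesis s_neq : s true != s false.
Hypothesis os : forall i, #[s i]%g = 2%N.
Hypotheses (sCA : forall i, C \subset A i) (sBA : forall i, <[s i]>%g \subset A i).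
Hypothesis sAS : forall i, A i \subset S.
Hypothesis genA : forall i, A i :=: <<[set s i; z]>>%g.
Hypothesis trfA : forall i M N (f : Hom M N),
  trf (A i) f = trf C (trf <[s i]>%g f).
Hypothesis trfS : forall M N (f : Hom M N),
  trf S f = \sum_(i < q.*2)
    act ((s false * s true) ^+ i)%g (f + act (s true) f).
Hypothesis rq : ((s false * s true) ^+ q = z)%g.
Hypothesis invS : forall x, x \in S -> #[x]%g = 2%N -> x != z ->
  exists i, exists2 g, g \in S & x = (s i ^ g)%g.
Hypothesis cSz : z \in 'C(S)%g.

Let Ss i : s i \in S. Proof. by rewrite -cycle_subG (subset_trans (sBA i)). Qed.
Let Gs i : s i \in G. Proof. exact: (subsetP sSG). Qed.
Let sCS : C \subset S. Proof. exact: subset_trans (sCA true) (sAS true). Qed.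
Let sAG i : A i \subset G. Proof. exact: subset_trans (sAS i) sSG. Qed.

(* The class of the action of the dihedral group on a polygon, whose vertices
   and edges are stabilised by conjugates of [s true] and [s false]. *)
Lemma euler_map N : exists Z : Hom (syzygy (syzygy N)) N,
  [/\ equi S Z, forall i, null <[s i]>%g Z &
      eqmod C (eta z N *m eta z (syzygy N) *m Z) 1%:M].
Proof.
set P0 := Defs.cover N; set K := syzygy N; set P1 := Defs.cover K.
pose d : Hom P1 P0 := cov_mx K *m syz_mx N.
have dE : equi S d by apply: equiM; rewrite ?cover_equi ?syz_equi //; [exact: cover_equi | exact: syz_equi].
have [r0 r0E] : higman S P0 by apply: null_sub (cover_higman N).
have h1 : higman S P1 by apply: null_sub (cover_higman K).
pose c0 : Hom P0 N := r0 *m cov_mx N.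
have c0E : trf S c0 = cov_mx N by rewrite trfMl ?cover_equi // -?r0E ?mul1mx //; apply: cover_equi.
clearbody c0.
have t0 : trf S (d *m c0) = 0 by rewrite trfMr // c0E -mulmxA syz_cover mulmx0.
have tn : trnull S (d *m c0).
  move=> h hE; case: h1 => r1 r1E; rewrite -[h]mulmx1 r1E -trfMr //.
  by rewrite -tr_trf // t0 mul0mx linear0.
have [c cE] := trnull_split char2 sSG defS s_neq os sBA sAS tn.
(* Up to boundaries [p] is invariant: [s false] fixes it and [s true] adds [d *m X0]. Hence [r ^+ n]
   adds [d] times the sum of the first [n] rotations of [X0], as in a walk along [n] edges of the
   polygon. *)
pose p := trf <[s false]>%g (c false).
have sBG i : <[s i]>%g \subset G by rewrite cycle_subG.
have selfE i M' N' (f : Hom M' N') : act (s i) (trf <[s i]>%g f) = trf <[s i]>%g f.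
  exact: (trf_equi (sBG i) f (cycle_id _)).
have pb : act (s false) p = p by apply: selfE.
pose X0 := trf <[s true]>%g c0.
have dX0 : d *m X0 = trf <[s true]>%g (d *m c0).
  rewrite /X0 (trfMr (sBG true)) // => x Bx; apply: dE.
  by apply: subsetP Bx; rewrite cycle_subG.
have pa : act (s true) p = p + d *m X0.
  have E : trf <[s true]>%g (trf <[s true]>%g (c true)) = 0.
    by apply: (trf_fixed char2 (trf_equi (sBG true) _)); rewrite -orderE os.
  rewrite dX0 cE linearD /= E -/p.
  by rewrite add0r trf_cycle2 // addrA addmm2 // add0r.
pose r := (s false * s true)%g.
have Gr : r \in G by rewrite groupM.
have pr n : act (r ^+ n)%g p = p + d *m (\sum_(i < n) act (r ^+ i)%g X0).
  elim: n => [|n IH]; first by rewrite big_ord0 mulmx0 addr0 act1g.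
  rewrite expgS actM ?groupX // [act r p]actM // pb pa linearD /= IH.
  rewrite -addrA; congr (_ + _); rewrite act_mul ?groupX //.
  have -> : act (r ^+ n)%g d = d by apply: dE; rewrite groupX ?groupM.
  by rewrite -mulmxDr big_ord_recr /=.
(* Half of the rotations, up to [r ^+ q = z]. Together with its translate by [z] this makes up the
   full transfer of [c0], which is the cover map. *)
pose H := \sum_(i < q) act (r ^+ i)%g X0.
have pz : act z p = p + d *m H by rewrite -rq pr.
have Hz : act z H = H + cov_mx N.
  have -> : cov_mx N = H + act z H; last by rewrite addrA addmm2 // add0r.
  rewrite -c0E trfS -addnn big_split_ord /= {1}/H; congr (_ + _).
    by apply: eq_bigr => i _; rewrite /X0 trf_cycle2.
  rewrite linear_sum /=; apply: eq_bigr => i _.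
  by rewrite addnC expgD actM ?groupX // rq /X0 trf_cycle2.
have iE M : equi S (syz_mx M : Hom (syzygy M) _) by apply: syz_equi.
have iEB j M : equi <[s j]>%g (syz_mx M : Hom (syzygy M) _) by exact: (syz_equi M (sBG j)).
have Zt : syz_mx K *m p = trf <[s true]>%g (syz_mx K *m c true).
  have -> : p = d *m c0 - trf <[s true]>%g (c true) by rewrite cE addrAC subrr add0r.
  rewrite (trfMr (sBG true)) //; first rewrite mulmxBr.
    by rewrite /d !mulmxA syz_cover !mul0mx add0r oppm2.
  exact: iEB.
have Zf : syz_mx K *m p = trf <[s false]>%g (syz_mx K *m c false).
  by rewrite (trfMr (sBG false)) //; apply: iEB.
exists (syz_mx K *m p); split.
- apply: (equi_s sSG defS sBA sAS) => -[].
    by rewrite Zt selfE.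
  by rewrite Zf selfE.
- case; first by exists (syz_mx K *m c true).
  by exists (syz_mx K *m c false).
have zz : (z * z = 1)%g by have := expg_order z; rewrite oz expgS expg1.
have actz M' N' (f : Hom M' N') : act z (act z f) = f by rewrite -actM // zz act1g.
pose f := eta z N *m cov_sec K.
have fd : f *m d = trf C (cov_sec N).
  by rewrite /f /d mulmxA -(mulmxA (eta z N)) cov_secK mulmx1 /eta connE ?mul1mx ?trf_C1.
have eE : eta z N *m eta z K *m syz_mx K = trf C f.
  rewrite -mulmxA /eta (connE sCG (trf_C1 char2 Gz oz K)) mul1mx -trfMr //.
  exact: eta_equi.
(* As [z] adds [d *m H] to [p] and [cov_mx N] to [H], the transfer of this sum over [C] differs from
   the composite exactly by [cov_sec N *m cov_mx N], the identity. *)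
exists (f *m p + cov_sec N *m H).
rewrite mulmxA eE !trf_cycle2 // mulmxDl.
have E1 : act z f *m p = act z (f *m p) + act z (f *m d *m H).
  by rewrite -linearD /= -mulmxA -mulmxDr -pz act_mul // actz.
have E2 : act z (cov_sec N) *m H = act z (cov_sec N *m H) + 1%:M.
  have -> : act z (cov_sec N) *m H = act z (cov_sec N *m (H + cov_mx N)).
    by rewrite -Hz act_mul // actz.
  by rewrite mulmxDr linearD /= cov_secK act_id.
rewrite E1 fd trf_cycle2 // mulmxDl E2.
rewrite !linearD /= actz act_id // oppm2 //.
rewrite -!addrA; congr (_ + _); rewrite [RHS]addrCA; congr (_ + _).
by rewrite addmm2 // addr0 addrC.
Qed.

Lemma euler_power N r : exists Z : Hom (Om r.*2 N) N,
  [/\ equi S Z, (0 < r)%N -> forall i, null <[s i]>%g Z &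
      eqmod C (etap r.*2 N *m Z) 1%:M].
Proof.
elim: r => [|r [Z [ZE nZ eZ]]].
  by exists 1%:M; split=> //; [apply: equi1 | rewrite mul1mx; apply: eqmod_refl].
have [Y [YE nY eY]] := euler_map (Om r.*2 N).
exists (Y *m Z); split=> [|_ i|]; first exact: equiM.
  apply: nullMl; [by rewrite cycle_subG | | exact: nY].
  by apply: equiS ZE; rewrite cycle_subG.
have ZC : equi C Z by apply: equiS ZE.
have -> : etap r.+1.*2 N =
  etap r.*2 N *m eta z (Om r.*2 N) *m eta z (syzygy (Om r.*2 N)) by [].
rewrite -!mulmxA (mulmxA (eta z _)) (mulmxA _ Y).
apply: eqmod_trans eZ; apply: eqmodMr => //; first exact: etap_equi.
rewrite -{2}[Z]mul1mx; exact: eqmodMl.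
Qed.

(* Maps in negative degree factor, over [A i], through a relative trace from
   [<[z]>], so that they restrict to zero on [<[z]>]. *)
Lemma equi_negative i j M N (g : Hom M (Om j.+1 N)) : equi (A i) g ->
  exists b : Hom M N, equi (A i) (trf <[s i]>%g b) /\
    eqmod C g (trf <[s i]>%g b *m etap j.+1 N).
Proof.
have sBG : <[s i]>%g \subset G by rewrite cycle_subG.
have base M' N' (f : Hom M' (syzygy N')) : equi (A i) f ->
    exists b : Hom M' N', equi (A i) (trf <[s i]>%g b) /\
      eqmod C f (trf <[s i]>%g b *m eta z N').
  move=> fE.
  (* Included in the cover, [f] is the transfer of some [r], and [b] is the image of [r] in [N'].
     Since [trf <[s i]>%g r] lifts [trf <[s i]>%g b], its transfer over [C] computes the connecting
     map and returns [f]. *)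
  have [r rE] : null (A i) (f *m syz_mx N').
    apply: higman_nullr => //; last by apply: equiM => //; apply: syz_equi.
    exact: null_sub (sAG i) _ (cover_higman N').
  pose b := r *m cov_mx N'.
  have b0 : trf (A i) b = 0.
    rewrite (trfMl (sAG i) _ (cover_equi N' (sAG i))) -rE.
    by rewrite -mulmxA syz_cover mulmx0.
  have tb0 : trf C (trf <[s i]>%g b) = 0 by rewrite -trfA.
  have tbC : equi C (trf <[s i]>%g b).
    move=> x; rewrite cycle2g // => /set2P[] ->; first exact: act1g.
    move/eqP: tb0; rewrite trf_cycle2 // addrC addr_eq0 oppm2 // => /eqP //.
  have tbA : equi (A i) (trf <[s i]>%g b).
    rewrite genA; apply: equi_gen => [|x /set2P[] ->].
    - by apply/subsetP=> x /set2P[] ->.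
    - exact: (trf_equi sBG b (cycle_id _)).
    - exact: (tbC z (cycle_id _)).
  exists b; split=> //; rewrite mul_eta //.
  have [|w wE] := @conn_lift _ _ _ _ _ _ b r (sAG i) b0; first by [].
  have [|w' wE'] := @conn_lift _ _ _ _ _ _ (trf <[s i]>%g b)
      (trf <[s i]>%g r) sCG tb0.
    by rewrite -(trfMl sBG _ (cover_equi N' sBG)).
  exists (- w'); rewrite wE' -trfA -rE -mulmxA cov_ret_id mulmx1.
  by rewrite opprD addrA subrr add0r linearN.
elim: j M N g => [|j IH] M N g gE; have [b [bE gb]] := base _ _ _ gE.
  by exists b; split=> //; rewrite etapS /= mul1mx.
have [c [cE bc]] := IH _ _ _ bE; exists c; split=> //.
apply: eqmod_trans gb _; rewrite etapS mulmxA; apply: eqmodMl => //.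
exact: eta_equi.
Qed.

(** Modulo maps null on [C], whose trace is zero, [g] is a transfer over [<[s true]>] followed by
    [etap], which [Z] cancels; the remaining transfer has trace zero. *)
Lemma tr_negative j N (Z : Hom (Om j.+1 N) N) (g : Hom N (Om j.+1 N)) :
    equi S Z -> eqmod C (etap j.+1 N *m Z) 1%:M -> equi S g ->
  \tr (g *m Z) = 0.
Proof.
move=> ZE eZ gE.
have gA : equi (A true) g by apply: equiS gE.
have ZC : equi C Z by apply: equiS ZE.
have [b [bE gb]] := equi_negative gA.
have bC : equi C (trf <[s true]>%g b) by apply: equiS bE.
rewrite (@eqmod_tr _ _ _ char2 _ _ _ (trf <[s true]>%g b) sCG evC); last first.
  apply: eqmod_trans (eqmodMl sCG ZC gb) _.
  rewrite -mulmxA -{2}[trf _ b]mulmx1; exact: eqmodMr.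
rewrite -[trf _ b]mulmx1 tr_trf ?cycle_subG // trf_fixed ?mulmx0 ?linear0 //.
  by apply: equi1; rewrite cycle_subG.
by rewrite -orderE os.
Qed.

(** Conjugating the linear section of a cover by an element that centralises [z] gives another lift
    of the identity, so [conn_lift] applies at each stage. *)
Lemma act_etap j N x : x \in 'C_G[z]%g ->
  eqmod C (act x (etap j N)) (etap j N).
Proof.
case/setIP=> Gx cxz.
have actC M N' (f : Hom M N') : equi C f -> equi C (act x f).
  move=> fE y; case/cycleP=> n ->; rewrite -actM ?groupX //.
  have -> : (x * z ^+ n = z ^+ n * x)%g.
    exact: commuteX (cent1P cxz).
  by rewrite actM ?groupX // fE ?mem_cycle.
elim: j => [|j IH]; first by rewrite act_id //; apply: eqmod_refl.
rewrite etapS act_mul //.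
apply: eqmod_trans (eqmodMl sCG (actC _ _ _ (eta_equi _ _ _ _)) IH) _ => //.
apply: eqmodMr => //; first exact: etap_equi.
set N' := Om j N; have z0 := trf_C1 char2 Gz oz N'.
have [|w wE] := @conn_lift _ _ _ _ _ _ 1%:M (act x (cov_sec N')) sCG z0.
  rewrite -[X in _ *m X](cover_equi N' (subxx G) Gx) -act_mul //.
  by rewrite cov_secK act_id.
exists (- w); rewrite {2}/eta wE linearN opprD addrA.
suff -> : act x (eta z N') = trf C (act x (cov_sec N')) *m cov_ret N' by rewrite subrr add0r.
have aC (f : Hom N' (Defs.cover N')) : act x (trf C f) = trf C (act x f).
  rewrite !trf_cycle2 // linearD /= -!actM //.
  by have /cent1P -> := cxz.
apply: syz_inj; rewrite cov_retE -?aC.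
  rewrite -[X in _ *m X](syz_equi N' (subxx G) Gx) -act_mul //.
  by rewrite connE // mul1mx.
rewrite -[X in _ *m X](cover_equi N' (subxx G) Gx) -act_mul //.
rewrite -(trfMl sCG _ (cover_equi N' sCG)) cov_secK trf_C1 //.
exact: linear0.
Qed.

Lemma equi_lcosets_sum M N (f : Hom M N) : equi S f ->
  equi G (\sum_(X in rcosets S G) act (repr X) f).
Proof.
move=> fE.
have reprE x : x \in G -> act (repr (S :* x)%g) f = act x f.
  move=> Gx; have [y Sy ->] : exists2 y, y \in S & repr (S :* x)%g = (y * x)%g.
    by have /rcosetP[y Sy ->] := mem_repr x (rcoset_refl S x); exists y.
  by rewrite (actM _ (subsetP sSG y Sy) Gx) fE.
move=> y Gy; rewrite linear_sum /=.
rewrite [RHS](reindex_onto (fun X => X :* y)%g (fun X => X :* y^-1)%g) /=; last first.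
  by move=> X _; rewrite -rcosetM mulVg rcoset1.
apply: eq_big => [X | X /rcosetsP[x Gx ->]]; last first.
  by rewrite -rcosetM !reprE ?groupM // actM.
rewrite -rcosetM mulgV rcoset1 eqxx andbT.
apply/rcosetsP/rcosetsP=> -[x Gx E]; first by exists (x * y)%g; rewrite ?groupM // E rcosetM.
by exists (x * y^-1)%g; rewrite ?groupM ?groupV // rcosetM -E -rcosetM mulgV rcoset1.
Qed.

(** The [S]-map of [euler_power] is summed over the cosets [S :* x]. In the trace, right
    multiplication by [z] pairs the cosets off, except those with [x z x^-1] in [S]. If this
    conjugate is not [z], it is conjugate in [S] to some [s i], where [Z] is null, and the term
    vanishes. Otherwise the term is the dimension, equal to 1 in [k], and these cosets are counted
    by the odd index of [S] in the centraliser of [z]. For [r = 0] the identity serves. *)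
Lemma euler_tr N r : odd (rdegree N) -> exists Z : Hom (Om r.*2 N) N,
  [/\ equi G Z, (0 < r)%N -> trnull G Z & \tr (etap r.*2 N *m Z) = 1].
Proof.
move=> oddN.
have dimN : (rdegree N)%:R = 1 :> k.
  by rewrite -(odd_double_half (rdegree N)) oddN natrD -muln2 natrM (pcharf0 char2) mulr0 addr0.
case: r => [|r].
  exists 1%:M; split=> //; first exact: equi1.
  by rewrite mul1mx mxtrace1.
have [Z [ZE nZ eZ]] := euler_power N r.+1.
have ZC : equi C Z by apply: equiS ZE.
have reprG x : x \in G -> repr (S :* x)%g \in G.
  move=> Gx; have /rcosetP[y Sy ->] := mem_repr x (rcoset_refl S x).
  by rewrite groupM // (subsetP sSG).
have zz1 : (z * z = 1)%g by have := expg_order z; rewrite oz expgS expg1.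
exists (\sum_(X in rcosets S G) act (repr X) Z); split=> [|_|].
- exact: equi_lcosets_sum.
- apply: trnull_sum => X /rcosetsP[x Gx ->] h hE.
  rewrite tr_actl ?reprG // hE ?groupV ?reprG // mxtrace_mulC.
  by apply: (@tr_negative r.*2.+1) => //; apply: equiS hE.
move: (r.+1.*2) Z ZE {nZ}(nZ isT) eZ ZC => j Z ZE nZ eZ ZC.
rewrite mulmx_sumr linear_sum /=.
pose F (X : {set gT}) := \tr (etap j N *m act (repr X) Z).
have FE x : x \in G -> F (S :* x)%g = \tr (Z *m act x^-1%g (etap j N)).
  move=> Gx; have [y Sy E] : exists2 y, y \in S & repr (S :* x)%g = (y * x)%g.
    by have /rcosetP[y Sy ->] := mem_repr x (rcoset_refl S x); exists y.
  by rewrite /F E (actM _ (subsetP sSG y Sy) Gx) ZE // mxtrace_mulC tr_actl.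
rewrite -[LHS]/(\sum_(X in rcosets S G) F X).
rewrite (@sum_involution _ _ _ (fun X => X :* z)%g) //; first last.
- move=> X /rcosetsP[x Gx ->]; rewrite -rcosetM !FE ?groupM // invMg.
  by rewrite actM ?groupV // etap_equi // groupV cycle_id.
- by move=> X _; rewrite -rcosetM zz1 rcoset1.
- move=> X /rcosetsP[x Gx ->]; apply/rcosetsP; exists (x * z)%g; rewrite ?groupM //.
  by rewrite rcosetM.
pose c := #|'C_G[z] : S|%g.
have sSCz : S \subset 'C_G[z]%g.
  by rewrite subsetI sSG /= sub_cent1.
have oddc : odd c.
  by apply: dvdn_odd sylS; rewrite -(Lagrange_index (subsetIl G 'C[z]%g) sSCz) dvdn_mull.
rewrite (bigID (mem (rcosets S 'C_G[z]%g))) /= [X in _ + X]big1 ?addr0; last first.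
  move=> X /andP[/andP[/rcosetsP[x Gx ->] /eqP fixX]]; rewrite FE // => ncx.
  pose z' := (x * z * x^-1)%g.
  have Sz' : z' \in S.
    by rewrite -mem_rcoset -fixX -rcosetM rcoset_refl.
  have zE : z' = (z ^ x^-1)%g by rewrite conjgE invgK mulgA.
  have oz' : #[z']%g = 2%N by rewrite zE orderJ.
  have nez' : z' != z.
    apply: contraNneq ncx => E; apply/rcosetsP; exists x => //.
    rewrite inE Gx; apply/cent1P; rewrite /commute -{2}E /z'.
    by rewrite mulgKV.
  have [i [g Sg zg]] := invS Sz' oz' nez'.
  have Gg := subsetP sSG g Sg.
  have n' : null <[z']>%g Z.
    have [w wE] := nZ i; exists (act g w).
    rewrite trf_cycle2 // -actM ?zg //; last first.
      by rewrite groupJ.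
    rewrite -[LHS](ZE g Sg) wE trf_cycle2 // linearD /= -actM //.
    by rewrite -conjgC.
  have Gz' : z' \in G by apply: (subsetP sSG).
  apply: (tr_null_trf0 _ n'); first by rewrite cycle_subG.
  rewrite trf_cycle2 // -actM ?groupV //.
  have -> : (x^-1 * z' = z * x^-1)%g by rewrite /z' !mulgA mulVg mul1g.
  rewrite (actM _ Gz (groupVr Gx)) (etap_equi char2 Gz oz _ _ (cycle_id z)).
  exact: addmm2.
rewrite (eq_big (mem (rcosets S 'C_G[z]%g)) (fun=> 1 : k)); first last.
- move=> X /andP[_ /rcosetsP[x cx ->]]; have /setIP[Gx _] := cx.
  rewrite FE //.
  have eE : eqmod C (act x^-1%g (etap j N) *m Z) 1%:M.
    apply: eqmod_trans eZ; apply: eqmodMl => //.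
    by apply: act_etap; rewrite groupV.
  rewrite mxtrace_mulC (eqmod_tr char2 sCG evC eE) mxtrace1.
  exact: dimN.
- move=> X; apply: andb_idl => /rcosetsP[x cx ->]; have /setIP[Gx /cent1P xz] := cx.
  apply/andP; split; first by apply/rcosetsP; exists x.
  rewrite -rcosetM xz rcosetM rcoset_id //.
  by rewrite -cycle_subG.
rewrite sumr_const -/(#|'C_G[z] : S|%g) -/c.
by rewrite -(odd_double_half c) oddc natrD -muln2 natrM (pcharf0 char2) mulr0 addr0.
Qed.

End EulerClass.

(** * Summands and almost split maps *)

Lemma expr_mulmxC (k : fieldType) m n (a : 'M[k]_(n, m)) (b : 'M_(m, n)) l :
  (b *m a) ^+ l.+1 = b *m (a *m b) ^+ l *m a.
Proof.
elim: l => [|l IHl]; first by rewrite expr1 expr0 mulmx1.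
by rewrite exprSr IHl exprSr -!mulmxE !mulmxA.
Qed.

(** A rank factorisation [f = a *m b] replaces [f] by [b *m a], which is nilpotent with the same
    trace and of smaller size. *)
Lemma mxtrace_nilpotent (k : fieldType) n (f : 'M[k]_n) m : f ^+ m = 0 -> \tr f = 0.
Proof.
move: {2}n.+1 (ltnSn n) => N; elim: N n m f => // N IH n m f ltnN fm.
pose a := col_base f; pose b := row_base f; have ab : a *m b = f := mulmx_base f.
have [full | nfull] := eqVneq (\rank f) n.
  case: n => [|n] in f ltnN fm a b ab full *; first by rewrite flatmx0 linear0.
  have uf : f \in unitmx by rewrite -row_free_unit /row_free full eqxx.
  by have := unitrX m uf; rewrite fm unitr0.
rewrite -ab mxtrace_mulC; apply: (IH _ m.+1).
  by apply: (@leq_trans n) => //; rewrite ltn_neqAle nfull rank_leq_row.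
by rewrite expr_mulmxC ab fm mulmx0 mul0mx.
Qed.

(** * Endomorphisms of indecomposable modules and their traces *)

Section Indecomposable.

Variables (k : closedFieldType) (gT : finGroupType) (G : {group gT}).
Local Notation module := (representation k G).
Local Notation Hom M N := 'M[k]_(rdegree M, rdegree N).
Implicit Types (M N L P Y Z : module).
Hypothesis char2 : 2%N \in [pchar k]%R.
Let sGG := subxx G.

Lemma equiX M (f : Hom M M) n : equi G f -> equi G (f ^+ n : Hom M M).
Proof.
by move=> fE; elim: n => [|n IH]; [apply: equi1 | rewrite exprS; apply: equiM].
Qed.

Lemma equi_mxmodule M (f : Hom M M) : equi G f -> mxmodule M f.
Proof. by move=> /equi_ghom[g <-]; apply: endo_module. Qed.

Lemma equi_kermx M (f : Hom M M) : equi G f -> mxmodule M (kermx f).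
Proof. by move=> /equi_ghom[g <-]; apply: ker_module. Qed.

Lemma fitting M (f : Hom M M) : indecomposable M -> equi G f ->
  f \in unitmx \/ exists n, f ^+ n = 0.
Proof.
move=> [M_gt0 indM] fE.
(* The exponent zero is excluded because a unit [f ^+ i] has to yield a unit [f]. *)
pose R r := `[< exists i, (0 < i)%N /\ \rank (f ^+ i) = r >].
have exR : exists r, R r by exists (\rank (f ^+ 1)); apply/asboolP; exists 1%N.
case: (ex_minnP exR) => r /asboolP[i [i_gt0 ri]] minr.
have r2 : \rank (f ^+ i *m f ^+ i) = \rank (f ^+ i).
  apply/eqP; rewrite eqn_leq mxrankM_maxl ri; apply: minr; apply/asboolP.
  by exists (i + i)%N; rewrite addn_gt0 i_gt0 exprD.
have fiE : equi G (f ^+ i : Hom M M) by apply: equiX.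
have tI : (f ^+ i :&: kermx (f ^+ i))%MS = 0.
  apply/eqP; rewrite -mxrank_eq0.
  by have /eqP := mxrank_mul_ker (f ^+ i) (f ^+ i); rewrite r2 -{2}[\rank _]addn0 eqn_add2l.
have full : (f ^+ i + kermx (f ^+ i) :=: 1%:M)%MS.
  apply/eqmxP; rewrite submx1 /= sub1mx /row_full mxrank_disjoint_sum //.
  by rewrite mxrank_ker subnKC ?rank_leq_row.
have [f0 | k0] := indM _ _ (equi_mxmodule fiE) (equi_kermx fiE) full tI.
  by right; exists i.
left; have: f ^+ i \in unitmx by rewrite -row_free_unit -kermx_eq0 k0 eqxx.
by case: i {ri r2 fiE tI full k0} i_gt0 => // i _; rewrite exprS unitmx_mul => /andP[].
Qed.

Lemma indec_tr M (f : Hom M M) : indecomposable M -> equi G f ->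
  f \notin unitmx -> \tr f = 0.
Proof.
move=> indM fE nf; have [uf | [n fn]] := fitting indM fE; last exact: mxtrace_nilpotent fn.
by rewrite uf in nf.
Qed.

Lemma equi_invmx M (f : Hom M M) : equi G f -> equi G (invmx f).
Proof.
move=> fE; have [uf x Gx | nf] := boolP (f \in unitmx); last by rewrite invmx_out.
apply: (can_inj (mulmxK uf)); rewrite mulVmx // -{2}(fE x Gx) -act_mul //.
by rewrite mulVmx // act_id.
Qed.

Lemma indec_unit_add M (f g : Hom M M) : indecomposable M -> equi G f -> equi G g ->
  f + g = 1%:M -> f \in unitmx \/ g \in unitmx.
Proof.
move=> indM fE gE fg; have [|[n fn]] := fitting indM fE; first by left.
right; rewrite -row_free_unit -kermx_eq0; apply/eqP.
set K := kermx g; have Kg : K *m g = 0 by apply: mulmx_ker.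
have Kf : K *m f = K by rewrite -[RHS]mulmx1 -fg mulmxDr Kg addr0.
have E l : K *m f ^+ l = K.
  by elim: l => [|l IH]; rewrite ?mulmx1 // exprS mulmxA Kf.
by rewrite -(E n) fn mulmx0.
Qed.

Lemma indec_unit_add2 M (f g : Hom M M) : indecomposable M -> equi G f -> equi G g ->
  f + g \in unitmx -> f \in unitmx \/ g \in unitmx.
Proof.
move=> indM fE gE u; set h := invmx (f + g).
have hE : equi G h by apply: equi_invmx; apply: equiD.
have E : f *m h + g *m h = 1%:M by rewrite -mulmxDl mulmxV.
have uh : h \in unitmx by rewrite unitmx_inv.
have [] := indec_unit_add indM _ _ E; try (by apply: equiM); rewrite unitmx_mul uh andbT; by [left | right].
Qed.

Lemma natr_odd n : odd n -> n%:R = 1 :> k.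
Proof.
by move=> on; rewrite -(odd_double_half n) on natrD -muln2 natrM (pcharf0 char2) mulr0 addr0.
Qed.

Lemma natr_even n : ~~ odd n -> n%:R = 0 :> k.
Proof.
by move=> /negPf en; rewrite -(odd_double_half n) en add0n -muln2 natrM (pcharf0 char2) mulr0.
Qed.

(** Over an algebraically closed field an endomorphism of an indecomposable module is a scalar plus
    a non-unit. The non-unit has trace zero, and the scalar is multiplied by the even dimension. *)
Lemma indec_even_trnull M : indecomposable M -> ~~ odd (rdegree M) ->
  trnull G (1%:M : Hom M M).
Proof.
move=> indM evM h hE; rewrite mul1mx.
have [M_gt0 _] := indM.
have [a] : exists a, root (char_poly h) a.
  by apply/closed_rootP; rewrite size_char_poly; case: (rdegree M) M_gt0.
rewrite -eigenvalue_root_char => /eigenvalueP[v va nz_v].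
have haE : equi G (h - a%:M : Hom M M).
  apply: equiB => // x Gx; rewrite -scalemx1 linearZ /= act_id //.
have nu : h - a%:M \notin unitmx.
  apply: contra nz_v => u; rewrite -[v](mulmxK u) mulmxBr va mul_mx_scalar.
  by rewrite subrr mul0mx.
have /eqP := indec_tr indM haE nu; rewrite linearB /= mxtrace_scalar subr_eq0 => /eqP ->.
by rewrite -mulr_natr natr_even ?mulr0.
Qed.

Definition splits_epi Z N (b : Hom Z N) := exists2 h : Hom N Z, equi G h & h *m b = 1%:M.

Lemma nonsplit_epi_trnull Z N (b : Hom Z N) : indecomposable N -> equi G b ->
  ~ splits_epi b -> trnull G b.
Proof.
move=> indN bE nb h hE; rewrite mxtrace_mulC; apply: indec_tr => //; first exact: equiM.
apply/negP=> u; apply: nb; exists (invmx (h *m b) *m h).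
  by apply: equiM => //; apply: equi_invmx; apply: equiM.
by rewrite -mulmxA mulVmx.
Qed.

Lemma splits_epi_trnull Z N (b : Hom Z N) : odd (rdegree N) ->
  trnull G b -> ~ splits_epi b.
Proof.
move=> oN tb [h hE hb]; have := tb h hE; rewrite mxtrace_mulC hb mxtrace1.
by rewrite natr_odd // => /eqP; rewrite oner_eq0.
Qed.

Lemma indec_retract_iso M Y (f : Hom M Y) (g : Hom Y M) :
    indecomposable M -> indecomposable Y -> equi G f -> equi G g ->
  f *m g \in unitmx -> isomorphic M Y.
Proof.
move=> indM indY fE gE u; pose g' := g *m invmx (f *m g).
have g'E : equi G g' by apply: equiM => //; apply: equi_invmx; apply: equiM.
have fg : f *m g' = 1%:M by rewrite mulmxA mulmxV.
have idem : (g' *m f) *m (g' *m f) = g' *m f by rewrite mulmxA -(mulmxA g') fg mulmx1.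
have [ug | [n gn]] := fitting indY (equiM sGG g'E fE).
  have gf : g' *m f = 1%:M by rewrite -[LHS](mulKmx ug) idem mulVmx.
  apply: MxReprSim (f) _ _ _.
  - by apply/eqP; rewrite eqn_leq (mulmx1_min fg) (mulmx1_min gf).
  - by apply/row_freeP; exists g'.
  - by move=> x Gx; apply/actP; last exact: fE.
have E l : (g' *m f) ^+ l.+1 = g' *m f.
  by elim: l => // l IH; rewrite exprS IH -mulmxE idem.
have gf0 : g' *m f = 0.
  case: n gn => [|n gn]; last by rewrite -(E n).
  by move=> g0; rewrite -[LHS]mulmx1 -[1%:M]/((g' *m f) ^+ 0) g0 mulmx0.
have M_gt0 : (0 < rdegree M)%N by case: indM.
have : (1%:M : Hom M M) = 0.
  transitivity (f *m (g' *m f) *m g'); last by rewrite gf0 mulmx0 mul0mx.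
  by rewrite mulmxA fg mul1mx fg.
move/(congr1 (fun A : 'M_(rdegree M) => \rank A)); by rewrite mxrank1 mxrank0 => E0; rewrite E0 in M_gt0.
Qed.

End Indecomposable.

(** * Direct sum decompositions *)

Section Summands.

Variables (k : closedFieldType) (gT : finGroupType) (G : {group gT}).
Local Notation module := (representation k G).
Local Notation Hom M N := 'M[k]_(rdegree M, rdegree N).
Implicit Types (M N L P Y Z U V : module).

Variant biprod M Y Z : Prop :=
  BiProd (a : Hom M Y) (b : Hom Y M) (a' : Hom M Z) (b' : Hom Z M) of
    [/\ equi G a, equi G b, equi G a' & equi G b'] &
    [/\ b *m a = 1%:M, b' *m a' = 1%:M, b *m a' = 0, b' *m a = 0 &
        a *m b + a' *m b' = 1%:M].

Lemma biprod_mx M Y Z (a : Hom M Y) (b : Hom Y M) (a' : Hom M Z) (b' : Hom Z M) :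
    [/\ b *m a = 1%:M, b' *m a' = 1%:M, b *m a' = 0, b' *m a = 0 &
        a *m b + a' *m b' = 1%:M] ->
  row_mx a a' *m col_mx b b' = 1%:M /\ col_mx b b' *m row_mx a a' = 1%:M.
Proof.
case=> ba ba' b0 b0' E; rewrite mul_row_col E mul_col_row ba ba' b0 b0'.
by rewrite -scalar_mx_block.
Qed.

Lemma biprod_dim M Y Z : biprod M Y Z -> rdegree M = (rdegree Y + rdegree Z)%N.
Proof.
case=> a b a' b' _ /biprod_mx[E E'].
by apply/eqP; rewrite eqn_leq (mulmx1_min E) (mulmx1_min E').
Qed.

Lemma equi_row M Y Z (f : Hom M Y) (g : Hom M Z) : equi G f -> equi G g ->
  equi G (row_mx f g : Hom M (dadd_grepr Y Z)).
Proof.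
by move=> /equi_ghom[f' <-] /equi_ghom[g' <-]; apply: (ghom_equi (row_ghom f' g')).
Qed.

Lemma equi_col M Y Z (f : Hom Y M) (g : Hom Z M) : equi G f -> equi G g ->
  equi G (col_mx f g : Hom (dadd_grepr Y Z) M).
Proof.
by move=> /equi_ghom[f' <-] /equi_ghom[g' <-]; apply: (ghom_equi (col_ghom f' g')).
Qed.

Lemma equi_lsub M Y Z (f : Hom M (dadd_grepr Y Z)) : equi G f ->
  equi G (lsubmx f : Hom M Y) /\ equi G (rsubmx f : Hom M Z).
Proof.
move=> fE; suff H x : x \in G -> M x *m lsubmx f = lsubmx f *m Y x /\
    M x *m rsubmx f = rsubmx f *m Z x.
  by split=> x Gx; apply/actP => //; have [] := H x Gx.
move=> Gx; have /actP := fE x Gx => /(_ Gx) /=.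
rewrite -{1 2}[f]hsubmxK mul_mx_row mul_row_block !mulmx0 addr0 add0r.
exact: eq_row_mx.
Qed.

Lemma equi_usub M Y Z (f : Hom (dadd_grepr Y Z) M) : equi G f ->
  equi G (usubmx f : Hom Y M) /\ equi G (dsubmx f : Hom Z M).
Proof.
move=> fE; suff H x : x \in G -> Y x *m usubmx f = usubmx f *m M x /\
    Z x *m dsubmx f = dsubmx f *m M x.
  by split=> x Gx; apply/actP => //; have [] := H x Gx.
move=> Gx; have /actP := fE x Gx => /(_ Gx) /=.
rewrite -{1 2}[f]vsubmxK mul_block_col mul_col_mx !mul0mx addr0 add0r.
exact: eq_col_mx.
Qed.

Lemma isomorphicP M N : isomorphic M N -> exists f : Hom M N, exists g : Hom N M,
  [/\ equi G f, equi G g, f *m g = 1%:M & g *m f = 1%:M].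
Proof.
case/mx_rsim_def=> B [B' BB E].
have BB' : B *m B' = 1%:M by have := E 1%g (group1 G); rewrite !repr_mx1 mulmx1.
exists B, B'; split=> // x Gx; apply/actP => //.
  by rewrite E // -mulmxA BB mulmx1.
by rewrite E // !mulmxA BB mul1mx.
Qed.

Lemma iso_isomorphic M N (f : Hom M N) (g : Hom N M) :
  equi G f -> f *m g = 1%:M -> g *m f = 1%:M -> isomorphic M N.
Proof.
move=> fE fg gf; apply: MxReprSim (f) _ _ _.
- by apply/eqP; rewrite eqn_leq (mulmx1_min fg) (mulmx1_min gf).
- by apply/row_freeP; exists g.
- by move=> x Gx; apply/actP; last exact: fE.
Qed.

Lemma isomorphic_biprod M Y Z : isomorphic M (dadd_grepr Y Z) -> biprod M Y Z.
Proof.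
case/isomorphicP=> f [g [fE gE fg gf]].
have [aE a'E] := equi_lsub fE; have [bE b'E] := equi_usub gE.
exists (lsubmx f) (usubmx g) (rsubmx f) (dsubmx g); split=> //; last first.
  by rewrite -mul_row_col hsubmxK vsubmxK.
all: move: gf; rewrite -{1}[g]vsubmxK -{1}[f]hsubmxK mul_col_row scalar_mx_block.
all: by move/eq_block_mx => [].
Qed.

Lemma biprod_assoc M U V Y U' : biprod M U V -> biprod U Y U' ->
  biprod M Y (dadd_grepr U' V).
Proof.
move=> [a b a' b' [aE bE a'E b'E] [ba ba' b0 b0' E]].
move=> [c d c' d' [cE dE c'E d'E] [dc dc' d0 d0' F]].
exists (a *m c) (d *m b) (row_mx (a *m c') a') (col_mx (d' *m b) b').
  by split; [| |apply: equi_row |apply: equi_col]; try exact: equiM.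
have baK m (f : 'M_(rdegree U, m)) : b *m (a *m f) = f by rewrite mulmxA ba mul1mx.
have b'aK m (f : 'M_(rdegree U, m)) : b' *m (a *m f) = 0 by rewrite mulmxA b0' mul0mx.
split.
- by rewrite -mulmxA baK.
- by rewrite mul_col_row -!mulmxA !baK b0 mulmx0 !b'aK ba' dc' -scalar_mx_block.
- by rewrite mul_mx_row -!mulmxA baK b0 mulmx0 d0 row_mx0.
- by rewrite mul_col_mx -!mulmxA baK b'aK d0' col_mx0.
rewrite mul_row_col -!mulmxA addrA -mulmxDr (mulmxA c) (mulmxA c').
by rewrite -mulmxDl F mul1mx E.
Qed.

Lemma retract_biprod M Y (i : Hom Y M) (r : Hom M Y) :
  equi G i -> equi G r -> i *m r = 1%:M -> exists Z, biprod M Y Z.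
Proof.
move=> iE rE ir; pose e : Hom M M := 1%:M - r *m i.
have eE : equi G e by apply: equiB; [apply: equi1 | apply: equiM].
have ee : e *m e = e.
  rewrite /e mulmxBr mulmx1 mulmxBl mul1mx mulmxA -(mulmxA r i r) ir mulmx1.
  by rewrite subrr subr0.
have ie : i *m e = 0 by rewrite /e mulmxBr mulmx1 mulmxA ir mul1mx subrr.
have er : e *m r = 0 by rewrite /e mulmxBl mul1mx -mulmxA ir mulmx1 subrr.
have [eg egE] := equi_ghom eE.
pose Z := submodule (endo_module eg).
pose b' : Hom Z M := ghom_mx (incl (endo_module eg)).
have [c cE] := @corestrict _ _ _ _ _ (endo_module eg) M eg (submx_refl _).
pose a' : Hom M Z := ghom_mx c.
have ab : a' *m b' = e by rewrite -egE.
have b'e : b' *m e = b'.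
  have: (b' <= eg)%MS by rewrite /b' /= val_submod1.
  by rewrite egE => /submxP[d ->]; rewrite -mulmxA ee.
have ba : b' *m a' = 1%:M.
  by apply: (@incl_inj _ _ _ _ _ (endo_module eg)); rewrite -mulmxA [_ *m incl _]ab b'e mul1mx.
have b'r : b' *m r = 0 by rewrite -b'e -mulmxA er mulmx0.
exists Z; exists r i a' b'; first by split=> //; exact: ghom_equi.
split=> //; last by rewrite ab addrC subrK.
by apply: (@incl_inj _ _ _ _ _ (endo_module eg)); rewrite -mulmxA [_ *m incl _]ab ie mul0mx.
Qed.

Lemma indecomposable_or_split M : (0 < rdegree M)%N -> ~ indecomposable M ->
  exists U V, [/\ biprod M U V, (0 < rdegree U)%N & (0 < rdegree V)%N].
Proof.
move=> M_gt0 nM.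
have [[U [V [mU mV dUV tUV [nU nV]]]] | nex] := pselect (exists U V : 'M_(rdegree M),
    [/\ mxmodule M U, mxmodule M V, (U + V :=: 1%:M)%MS, (U :&: V)%MS = 0 &
        U != 0 /\ V != 0]).
  exists (submodule mU), (submodule mV); split; rewrite /= ?lt0n ?mxrank_eq0 //.
  apply: isomorphic_biprod; apply: mx_rsim_trans (mx_rsim_sym _) _.
    exact: (rsim_submod1 (mxmodule1 M)).
  apply: (mx_rsim_dadd (rU := submodule mU) (rV := submodule mV) _ dUV) => /=.
  - exact/mxdirect_addsP.
  - exact: mx_rsim_refl.
  - exact: mx_rsim_refl.
case: nM; split=> // U V mU mV dUV tUV.
have [->|nU] := eqVneq U 0; first by left.
have [->|nV] := eqVneq V 0; first by right.
by case: nex; exists U, V.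
Qed.

Lemma indecomposable_summand M : (0 < rdegree M)%N ->
  exists Y Z, indecomposable Y /\ biprod M Y Z.
Proof.
move: {2}(rdegree M).+1 (ltnSn (rdegree M)) => n.
elim: n M => // n IH M ltMn M_gt0.
have [indM | nM] := pselect (indecomposable M).
  exists M, grepr0; split=> //; exists 1%:M 1%:M 0 0.
    by split; [apply: equi1 | apply: equi1 | apply: equi0 | apply: equi0].
  by rewrite !mul1mx !mul0mx addr0; split=> //; rewrite [RHS]flatmx0.
have [U [V [dM U_gt0 V_gt0]]] := indecomposable_or_split M_gt0 nM.
have [|Y [U' [indY dU]]] := IH U _ U_gt0.
  by move: ltMn; rewrite ltnS (biprod_dim dM); apply: leq_trans; rewrite -{1}[rdegree U]addn0 ltn_add2l.
by exists Y, (dadd_grepr U' V); split=> //; apply: biprod_assoc dM dU.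
Qed.

Inductive decomposes : module -> seq module -> Prop :=
| decomposes0 M : rdegree M = 0%N -> decomposes M [::]
| decomposesS M Y Z l : indecomposable Y -> biprod M Y Z -> decomposes Z l ->
    decomposes M (Y :: l).

Lemma decomposition M : exists l, decomposes M l.
Proof.
move: {2}(rdegree M).+1 (ltnSn (rdegree M)) => n.
elim: n M => // n IH M ltMn.
have [M0 | M_gt0] := posnP (rdegree M); first by exists [::]; apply: decomposes0.
have [Y [Z [indY dM]]] := indecomposable_summand M_gt0.
have [|l dZ] := IH Z; last by exists (Y :: l); apply: decomposesS dM dZ.
have [Y_gt0 _] := indY; move: ltMn; rewrite ltnS (biprod_dim dM).
by apply: leq_trans; rewrite -{1}[rdegree Z]add0n ltn_add2r.
Qed.

(* Replaces the identity of [E] by the sum of the idempotents [a *m b] of its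
   summands. *)
Lemma decomposes_id E l : decomposes E l -> forall M N (f : Hom M E) (g : Hom E N)
    (Q : Hom M N -> Prop), Q 0 ->
    (forall u v, Q u -> Q v -> Q (u + v)) ->
    (forall Y (a : Hom E Y) (b : Hom Y E), List.In Y l -> indecomposable Y ->
       equi G a -> equi G b -> b *m a = 1%:M -> Q (f *m a *m (b *m g))) ->
  Q (f *m g).
Proof.
elim=> {E l} [E E0 | E Y Z l indY [a b a' b' [aE bE a'E b'E] [ba ba' b0 b0' E1]] dZ IH] M N f g Q Q0 QD QY.
  suff -> : f *m g = 0 by [].
  have : f = 0 by move: (f); rewrite E0 => h; apply/matrixP=> ? [].
  by move=> ->; rewrite mul0mx.
rewrite -[f]mulmx1 -E1 mulmxDr mulmxDl; apply: (QD).
  by rewrite mulmxA -[f *m a *m b *m g]mulmxA; apply: (QY) => //; left.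
rewrite mulmxA -[f *m a' *m b' *m g]mulmxA.
apply: (IH M N (f *m a') (b' *m g) Q Q0 QD).
move=> Y' c d lY indY' cE dE dc.
have := QY Y' (a' *m c) (d *m b'); rewrite !mulmxA; apply=> //; try exact: equiM.
  by right.
by rewrite -!mulmxA (mulmxA b') ba' mul1mx.
Qed.

End Summands.

(** * Almost split sequences that end in an odd-dimensional module *)

Section AlmostSplit.

Variables (k : closedFieldType) (gT : finGroupType) (G : {group gT}).
Local Notation module := (representation k G).
Local Notation Hom M N := 'M[k]_(rdegree M, rdegree N).
Local Notation cover := Defs.cover.
Implicit Types (M N L P Y Z U V E : module).
Hypothesis char2 : 2%N \in [pchar k]%R.
Hypothesis evG : ~~ odd #|G|.
Let sGG := subxx G.

Lemma tr_trf0 M (w : Hom M M) : \tr (trf G w) = 0.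
Proof.
rewrite -[trf G w]mulmx1 tr_trf // trf_fixed ?mulmx0 ?linear0 //.
exact: equi1.
Qed.

Lemma higman_tr M (f : Hom M M) : higman G M -> equi G f -> \tr f = 0.
Proof. by move=> hM fE; have [w ->] := higman_null sGG hM fE; apply: tr_trf0. Qed.

Lemma higman_even M : higman G M -> ~~ odd (rdegree M).
Proof.
move=> hM; apply/negP=> oM; have := higman_tr hM (equi1 M sGG).
by rewrite mxtrace1 natr_odd // => /eqP; rewrite oner_eq0.
Qed.

Lemma equi_cancelr M N L (r : Hom M N) (j : Hom N L) (l : Hom L N) :
  equi G j -> j *m l = 1%:M -> equi G (r *m j) -> equi G r.
Proof.
move=> jE jl rj x Gx; rewrite -[LHS]mulmx1 -jl mulmxA.
have -> : act x r *m j = r *m j by rewrite -{1}(jE x Gx) -act_mul // rj.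
by rewrite -mulmxA jl mulmx1.
Qed.

Lemma equi_cancell M N L (e : Hom M N) (s : Hom N M) (v : Hom N L) :
  equi G e -> s *m e = 1%:M -> equi G (e *m v) -> equi G v.
Proof.
move=> eE se ev x Gx; rewrite -[LHS]mul1mx -se -mulmxA.
have -> : e *m act x v = e *m v by rewrite -{1}(eE x Gx) -act_mul // ev.
by rewrite mulmxA se mul1mx.
Qed.

(** The almost vanishing map, which represents the trace in Tate duality. For [N] indecomposable of
    odd dimension the module maps into [N] that it kills stably are those that are not split
    epimorphisms, so its pullback is almost split. *)
Definition alpha N : Hom N (syzygy N) := conn G (1%:M : Hom N N).

Lemma trf_G1 N : trf G (1%:M : Hom N N) = 0.
Proof. by apply: trf_fixed => //; apply: equi1. Qed.

Lemma alpha_equi N : equi G (alpha N).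
Proof. by apply: conn_equi => //; apply: trf_G1. Qed.

Lemma null_alphaP M N (f : Hom M N) : equi G f ->
  null G (f *m alpha N) <-> trnull G f.
Proof.
move=> fE; rewrite -conn_mul // mulmx1; apply: null_connP => //.
by rewrite -[f]mulmx1 trfMr // trf_G1 mulmx0.
Qed.

Lemma rdegree_syzygy N :
  (rdegree (syzygy N) + rdegree N)%N = rdegree (cover N).
Proof.
have E1 : row_mx (cov_ret N) (cov_mx N) *m col_mx (syz_mx N) (cov_sec N) = 1%:M.
  by rewrite mul_row_col cov_retK subrK.
apply/eqP; rewrite eqn_leq (mulmx1_min E1) andbT.
have sc : cov_sec N *m cov_ret N = 0.
  apply: syz_inj; rewrite mul0mx -mulmxA cov_retK mulmxBr mulmx1 mulmxA cov_secK.
  by rewrite mul1mx subrr.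
apply: (@mulmx1_min _ _ _ (col_mx (syz_mx N) (cov_sec N)) (row_mx (cov_ret N) (cov_mx N))).
by rewrite mul_col_row cov_ret_id cov_secK sc syz_cover -scalar_mx_block.
Qed.

(** [f] extends to an endomorphism [h] of the cover, because the inclusion of the syzygy splits
    linearly and the identity of the cover is a transfer; [h] induces [f'] on [N]. The trace of [h]
    vanishes and is the sum of the traces of [f] and [f']. *)
Lemma syz_descend N (f : ghom (syzygy N) (syzygy N)) : exists f' : ghom N N,
  induced_by f' f /\ \tr f' = \tr f.
Proof.
have [r rE] := cover_higman N.
set p := cov_mx N; set i := syz_mx N; set s := cov_sec N; set c := cov_ret N.
have pE : equi G p by apply: cover_equi.
have iE : equi G i by apply: syz_equi.
have fE := ghom_equi f.
pose h := trf G (c *m f *m i *m r).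
have hE : equi G h by apply: trf_equi.
have ih : i *m h = f *m i.
  rewrite /h -trfMr // !mulmxA cov_ret_id mul1mx -mulmxA trfMr // trfMr //.
  by rewrite -rE mulmx1.
have hp : h *m p = p *m (s *m h *m p).
  have ps : p *m s = 1%:M - c *m i by rewrite cov_retK opprB addrCA subrr addr0.
  rewrite !mulmxA ps mulmxBl mul1mx mulmxBl -(mulmxA c) ih -!mulmxA syz_cover.
  by rewrite !mulmx0 subr0.
have f'E : equi G (s *m h *m p).
  by apply: (equi_cancell pE (cov_secK N)); rewrite -hp; exact: (equiM sGG hE pE).
have [f' f'e] := equi_ghom f'E; have [hg hgE] := equi_ghom hE.
exists f'; split.
  exists hg; rewrite hgE f'e; split; first exact: hp.
  by have := ih; rewrite /i /syz_mx -!lock => ->.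
have h0 : \tr h = 0 by apply: higman_tr => //; apply: cover_higman.
have : \tr (h *m (c *m i + p *m s)) = 0 by rewrite cov_retK subrK mulmx1.
have -> : h *m (c *m i + p *m s) = (h *m c) *m i + (h *m p) *m s.
  by rewrite mulmxDr !mulmxA.
rewrite linearD /= [\tr (_ *m i)]mxtrace_mulC mulmxA ih -(mulmxA _ i) cov_ret_id mulmx1.
rewrite [\tr (_ *m s)]mxtrace_mulC mulmxA -f'e => /eqP.
by rewrite addr_eq0 => /eqP ->; apply/eqP; rewrite -addr_eq0 addr2_pchar.
Qed.

(* The pullback of the cover of [syzygy N] along [alpha N]; [e] maps it onto
   [N] with kernel the second syzygy. *)
Lemma alpha_pullback N : exists E (e : Hom E N) (t : Hom E (cover (syzygy N))),
  [/\ equi G e, equi G t, e *m alpha N + t *m cov_mx (syzygy N) = 0,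
      forall m (x y : 'M_(m, rdegree E)), x *m e = y *m e -> x *m t = y *m t -> x = y &
      forall m (u : 'M_(m, rdegree N)) (v : 'M_(m, rdegree (cover (syzygy N)))),
        u *m alpha N + v *m cov_mx (syzygy N) = 0 ->
        exists w, w *m e = u /\ w *m t = v].
Proof.
have [a aE] := equi_ghom (@alpha_equi N).
pose K := col_ghom a (cover_map (syzygy N)).
pose E := submodule (ker_module K); pose i := incl (ker_module K).
have iE : (ghom_mx i :=: kermx K)%MS by apply: val_submod1.
pose j : Hom E (dadd_grepr N (cover (syzygy N))) := i.
have [eE tE] := equi_lsub (ghom_equi i : equi G j).
have jK : row_mx (lsubmx j) (rsubmx j) = j by rewrite hsubmxK.
exists E, (lsubmx j), (rsubmx j); split=> //.
- rewrite -aE -mul_row_col jK; apply/sub_kermxP.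
  by rewrite -[j]/(ghom_mx i) iE.
- move=> m x y xy xy'; apply: (@incl_inj _ _ _ _ _ (ker_module K)).
  by rewrite -[_ *m _]/(x *m j) -[RHS]/(y *m j) -jK !mul_mx_row xy xy'.
move=> m u v uv; have: (row_mx u v <= kermx K)%MS.
  by apply/sub_kermxP; rewrite mul_row_col aE.
rewrite -iE => /submxP[w wE]; exists w.
have: w *m j = row_mx u v := esym wE.
by rewrite -{1}jK mul_mx_row => /eq_row_mx.
Qed.

Definition right_almost_split E N (e : Hom E N) : Prop :=
  [/\ equi G e, ~ splits_epi e &
      forall M (u : Hom M N), equi G u -> trnull G u ->
        exists2 u' : Hom M E, equi G u' & u' *m e = u].

(* [e] is a retract of the pullback of the lemma above, so that the complement
   of its source lies in the kernel. *)
Lemma alpha_split N : indecomposable N -> odd (rdegree N) ->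
  exists E (e : Hom E N) (j : Hom (syzygy (syzygy N)) E),
  [/\ right_almost_split e, row_free j /\ equi G j, j *m e = 0 /\ row_full e,
      rdegree E = (rdegree N + rdegree (syzygy (syzygy N)))%N &
      forall f : Hom E E, equi G f -> f *m e = 0 -> \tr f = 0].
Proof.
move=> indN oN; have [E [e [t [eE tE et inj lift]]]] := alpha_pullback N.
set K := syzygy N in t tE et inj lift *; set Q := cover K in t tE et inj lift *.
have equi_inj M (x : Hom M E) : equi G (x *m e) -> equi G (x *m t) -> equi G x.
  move=> xe xt y Gy; apply: inj.
    by rewrite -{1}(eE y Gy) -act_mul // xe.
  by rewrite -{1}(tE y Gy) -act_mul // xt.
have iE : equi G (syz_mx K) by apply: syz_equi.
have [j [je jt]] : exists j : Hom (syzygy K) E, j *m e = 0 /\ j *m t = syz_mx K.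
  by apply: lift; rewrite mul0mx add0r syz_cover.
have jE : equi G j by apply: equi_inj; rewrite ?je ?jt //; apply: equi0.
have kerE m (x : 'M_(m, rdegree E)) : x *m e = 0 -> x = x *m t *m cov_ret K *m j.
  move=> xe; apply: inj; first by rewrite -mulmxA je mulmx0.
  rewrite -[RHS]mulmxA jt cov_retE //; apply/eqP.
  have : x *m (e *m alpha N + t *m cov_mx K) = 0 by rewrite et mulmx0.
  by rewrite mulmxDr !mulmxA xe mul0mx add0r => ->.
have [s [se st]] : exists s : Hom N E, s *m e = 1%:M /\ s *m t = - (alpha N *m cov_sec K).
  by apply: lift; rewrite mul1mx mulNmx -mulmxA cov_secK mulmx1 subrr.
have es0 : (1%:M - e *m s) *m e = 0.
  by rewrite mulmxBl mul1mx -mulmxA se mulmx1 subrr.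
have jfree : j *m (t *m cov_ret K) = 1%:M by rewrite mulmxA jt cov_ret_id.
have ealpha : null G (e *m alpha N).
  have -> : e *m alpha N = - (t *m cov_mx K).
    by apply/eqP; rewrite -addr_eq0 et.
  apply: nullN; apply: nullMl => //; first exact: cover_equi.
  by apply: higman_nullr => //; apply: cover_higman.
have te : trnull G e by apply/(null_alphaP eE).
exists E, e, j; split.
- split=> //; first exact: splits_epi_trnull te.
  move=> M u uE /(null_alphaP uE)[w wE].
  pose v := - trf G (w *m cov_sec K).
  have vE : equi G v by rewrite /v -linearN; apply: trf_equi.
  have [|x [xe xt]] := lift _ u v.
    rewrite mulNmx wE -trfMl //; last exact: cover_equi.
    by rewrite -mulmxA cov_secK mulmx1 subrr.
  by exists x => //; apply: equi_inj; rewrite ?xe ?xt.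
- by split=> //; apply/row_freeP; exists (t *m cov_ret K).
- by split=> //; apply/row_fullP; exists s.
- apply/eqP; rewrite eqn_leq; apply/andP; split; last first.
    have E2 : col_mx s j *m row_mx e (t *m cov_ret K) = block_mx 1%:M (s *m t *m cov_ret K) 0 1%:M.
      by rewrite mul_col_row se je jfree mulmxA.
    have : row_free (col_mx s j).
      apply/row_freeP; exists (row_mx e (t *m cov_ret K) *m block_mx 1%:M (- (s *m t *m cov_ret K)) 0 1%:M).
      rewrite mulmxA E2 mulmx_block !mulmx0 !mul0mx !mulmx1 !mul1mx !addr0 ?add0r addNr.
      by rewrite -scalar_mx_block.
    by move/eqP <-; apply: rank_leq_col.
  have E1 : row_mx e ((1%:M - e *m s) *m t *m cov_ret K) *m col_mx s j = 1%:M.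
    by rewrite mul_row_col -(kerE _ _ es0) addrC subrK.
  exact: mulmx1_min E1.
move=> f fE fe.
(* A map killed by [e] is [r *m j], with the trace of [w = j *m r] and, after two descents, of [w2]
   on [N]. Stably [w2 *m alpha N] is [alpha N *m w1]; up to sign the map [v] below lifts the latter
   to the cover, so it is null, and [null_alphaP] tested on the identity gives trace zero. *)
pose r := f *m t *m cov_ret K.
have fr : f = r *m j by apply: kerE.
have rE : equi G r.
  by apply: (equi_cancelr jE jfree); rewrite -fr.
clearbody r; pose w := j *m r.
have [wg wgE] := equi_ghom (equiM sGG jE rE).
have [w1 [[h [hp hi]] tr1]] := syz_descend wg.
have [w2 [ind2 tr2]] := syz_descend w1.
have -> : \tr f = \tr w2 by rewrite fr mxtrace_mulC -wgE tr2 tr1.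
have nat2 := conn_natural sGG (trf_G1 N) ind2.
have hi' : syz_mx K *m h = w *m syz_mx K.
  by rewrite /syz_mx -!lock -hi wgE.
have hE := ghom_equi h.
pose th := t *m h - r *m syz_mx K.
have thE : equi G th by apply: equiB; apply: equiM.
have jth : j *m th = 0.
  by rewrite mulmxBr !mulmxA jt hi' subrr.
have hp' : h *m cov_mx K = cov_mx K *m w1 := hp.
have thp : th *m cov_mx K = - (e *m alpha N *m w1).
  rewrite mulmxBl -(mulmxA r) syz_cover mulmx0 subr0 -(mulmxA t) hp' mulmxA.
  rewrite -mulNmx; congr (_ *m _); apply/eqP.
  by rewrite -addr_eq0 addrC et.
clearbody th; pose v := s *m th.
have ev : e *m v = th.
  apply/eqP; rewrite eq_sym -subr_eq0 /v mulmxA -{1}[th]mul1mx -mulmxBl.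
  by rewrite (kerE _ _ es0) -(mulmxA _ j) jth mulmx0.
have vE : equi G v.
  by apply: (equi_cancell eE se); rewrite ev.
have vp : v *m cov_mx K = - (alpha N *m w1).
  by rewrite -mulmxA thp mulmxN !mulmxA se mul1mx.
have nv : null G (v *m cov_mx K).
  apply: nullMl => //; first exact: cover_equi.
  by apply: higman_nullr => //; apply: cover_higman.
have naw : null G (alpha N *m w1) by rewrite -[_ *m w1]opprK -vp; apply: nullN.
have : null G (w2 *m alpha N).
  rewrite -conn_mul ?mulmx1 //; last exact: ghom_equi.
  have := nullB naw nat2; rewrite -/(alpha N) opprB addrCA subrr addr0.
  by rewrite mul1mx.
move/(null_alphaP (ghom_equi w2))/(_ 1%:M (equi1 N sGG)).
by rewrite mulmx1.
Qed.

End AlmostSplit.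

(** * Irreducible maps and minimal almost split maps *)

Section Irreducible.

Variables (k : closedFieldType) (gT : finGroupType) (G : {group gT}).
Local Notation module := (representation k G).
Local Notation Hom M N := 'M[k]_(rdegree M, rdegree N).
Implicit Types (M N L P Y Z U V E : module).
Hypothesis char2 : 2%N \in [pchar k]%R.
Hypothesis evG : ~~ odd #|G|.
Let sGG := subxx G.

Lemma split_epiP M N (f : ghom M N) : split_epi f <-> splits_epi (ghom_mx f).
Proof.
split=> [[g gf] | [h /equi_ghom[g <-] gf]]; last by exists g.
by exists g => //; apply: ghom_equi.
Qed.

Lemma decomposes_biprod E l Y : decomposes E l -> List.In Y l ->
  indecomposable Y /\ exists Z, biprod E Y Z.
Proof.
elim=> {E l} [//|E Y' Z l indY dE dZ IH] [<- | /IH[indY0 [V dV]]]; first by split=> //; exists Z.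
split=> //; have [a b a' b' [aE bE a'E b'E] [ba ba' b0 b0' E1]] := dE.
have [c d c' d' [cE dE' c'E d'E] [dc _ _ _ _]] := dV.
apply: (@retract_biprod _ _ _ _ _ (d *m b') (a' *m c)); try exact: equiM.
by rewrite -mulmxA (mulmxA b') ba' mul1mx.
Qed.

Definition right_minimal E N (e : Hom E N) : Prop :=
  forall f : Hom E E, equi G f -> f *m e = e -> f \in unitmx.

(** A right almost split map with source of least dimension is minimal: if [f *m e = e], the
    restriction of [e] to the image of [f] is another one, so [f] has full rank. *)
Lemma minimal_almost_split N : indecomposable N -> odd (rdegree N) ->
  exists E (e : Hom E N),
  [/\ right_almost_split e, right_minimal e, ~~ odd (rdegree E) &
      exists E0 (e0 : Hom E0 N) (j : Hom (syzygy (syzygy N)) E0) Z,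
      [/\ biprod E0 E Z, equi G e0 /\ equi G j, row_free j /\ row_full e0,
          j *m e0 = 0 &
          rdegree E0 = (rdegree N + rdegree (syzygy (syzygy N)))%N]].
Proof.
move=> indN oN.
have [E0 [e0 [j [[e0E ne0 lift0] [jfree jE] [je efull] dimE0 trE0]]]] :=
  alpha_split char2 evG indN oN.
pose good d := `[< exists E (e : Hom E N), rdegree E = d /\ right_almost_split e >].
have ex_good : exists d, good d.
  by exists (rdegree E0); apply/asboolP; exists E0, e0; split=> //; split.
case: (ex_minnP ex_good) => d /asboolP[E [e [dE [eE ne lift]]]] mind.
have minE : right_minimal e.
  move=> f fE fe; have [g gf] := equi_ghom fE.
  pose V := submodule (endo_module g).
  have [c cg] := @corestrict _ _ _ _ _ (endo_module g) E g (submx_refl _).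
  pose i : Hom V E := incl (endo_module g).
  have iE : equi G i by apply: ghom_equi.
  have ci : c *m i = f by rewrite -gf.
  rewrite -row_free_unit /row_free eqn_leq rank_leq_row /=.
  have -> : \rank f = rdegree V by rewrite -gf.
  rewrite {1}dE; apply: mind; apply/asboolP; exists V, (i *m e); split=> //.
  split=> [|[h hE hie]|M u uE tu]; first exact: equiM.
    by apply: ne; exists (h *m i); [apply: equiM | rewrite -mulmxA].
  have [u' u'E u'e] := lift M u uE tu; exists (u' *m c).
    by apply: equiM => //; apply: ghom_equi.
  by rewrite -mulmxA (mulmxA (ghom_mx c)) ci fe.
have [c' c'E c'e] := lift0 _ e eE (nonsplit_epi_trnull indN eE ne).
have [c cE ce] := lift _ e0 e0E (nonsplit_epi_trnull indN e0E ne0).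
have ccE : equi G (c' *m c) by apply: equiM.
have cce : c' *m c *m e = e by rewrite -mulmxA ce c'e.
have ucc := minE _ ccE cce.
have icE : equi G (invmx (c' *m c)) by apply: equi_invmx.
have ice : invmx (c' *m c) *m e = e by rewrite -{1}cce mulKmx.
pose r := c *m invmx (c' *m c).
have rE : equi G r by apply: equiM.
have ir : c' *m r = 1%:M by rewrite mulmxA mulmxV.
have [Z bp] := retract_biprod c'E rE ir.
exists E, e; split=> //.
  (* The complement of [E] in [E0] is killed by [e0], so the trace clause of [alpha_split] makes its
     dimension even; that of [E0] is even because projective modules have even dimension. *)
  have E1 : (1%:M - r *m c') *m e0 = 0.
    by rewrite mulmxBl mul1mx -mulmxA c'e -mulmxA ice ce subrr.
  have := trE0 _ (equiB (equi1 E0 sGG) (equiM sGG rE c'E)) E1.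
  rewrite linearB /= mxtrace_mulC ir !mxtrace1 dimE0 => /eqP.
  rewrite subr_eq0 => /eqP dE1; apply/negP=> oE.
  have evC M : ~~ odd (rdegree (Defs.cover M)).
    by apply: (higman_even char2 evG); apply: cover_higman.
  have ev0 : ~~ odd (rdegree N + rdegree (syzygy (syzygy N))).
    have := evC N; have := evC (syzygy N); rewrite -!rdegree_syzygy !oddD.
    by case: (odd _); case: (odd _); case: (odd _).
  have := natr_odd char2 oE; rewrite -dE1 natr_even // => /esym/eqP.
  by rewrite oner_eq0.
by exists E0, e0, j, Z; split.
Qed.

Lemma almost_split_irreducible E N (e : Hom E N) Y (b : Hom Y E) Z :
    indecomposable N -> right_almost_split e -> right_minimal e ->
    indecomposable Y ->
    forall (a : Hom E Y) (a' : Hom E Z) (b' : Hom Z E),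
    [/\ equi G a, equi G b, equi G a' & equi G b'] ->
    [/\ b *m a = 1%:M, b' *m a' = 1%:M, b *m a' = 0, b' *m a = 0 &
        a *m b + a' *m b' = 1%:M] ->
  exists2 f : ghom Y N, ghom_mx f = b *m e & irreducible_map f.
Proof.
move=> indN [eE ne lift] mine indY a a' b' [aE bE a'E b'E] [ba ba' b0 b0' E1].
have beE : equi G (b *m e) by apply: equiM.
have [f fE] := equi_ghom beE; exists f => //.
have nf : ~ splits_epi (ghom_mx f).
  case=> h hE; rewrite fE mulmxA => hf; apply: ne; exists (h *m b) => //.
  exact: equiM.
have nfm : ~ split_mono f.
  case=> g fg; have gE := ghom_equi g; have fE' := ghom_equi f.
  have idem : (g *m f) *m (g *m f) = g *m f by rewrite mulmxA -(mulmxA (ghom_mx g)) fg mulmx1.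
  have [ug | [n gn]] := fitting indN (equiM sGG gE fE').
    apply: nf; exists (ghom_mx g) => //.
    by rewrite -[LHS](mulKmx ug) idem mulVmx.
  have gf0 : g *m f = 0.
    case: n gn => [|n].
      by move=> g0; rewrite -[LHS]mulmx1 -[1%:M]/((g *m f) ^+ 0) g0 mulmx0.
    suff -> : (g *m f) ^+ n.+1 = g *m f by [].
    by elim: n => // n IH; rewrite exprS IH -mulmxE idem.
  have Y1 : (1%:M : Hom Y Y) = 0.
    transitivity (f *m (g *m f) *m g); last by rewrite gf0 mulmx0 mul0mx.
    by rewrite mulmxA fg mul1mx fg.
  have [Y_gt0 _] := indY.
  by move/(congr1 (fun A : 'M_(rdegree Y) => \rank A)): Y1; rewrite mxrank1 mxrank0 => E0; rewrite E0 in Y_gt0.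
split=> //; first by move/split_epiP.
move=> X g h fgh; have [/split_epiP | nh] := pselect (splits_epi (ghom_mx h)).
  by right.
left; have gE := ghom_equi g; have hE := ghom_equi h.
have [h' h'E h'e] := lift _ _ hE (nonsplit_epi_trnull indN hE nh).
(* In the identity of [E] the part through [Y] is replaced by the factorisation through [X]. The
   result still fixes [e], so minimality makes it a unit, and this splits [g]. *)
pose phi := a *m g *m h' + a' *m b'.
have phiE : equi G phi by apply: equiD; [apply: equiM => //; apply: equiM | apply: equiM].
have phie : phi *m e = e.
  rewrite mulmxDl -mulmxA h'e -(mulmxA a) -fgh fE -[RHS]mul1mx -E1 mulmxDl.
  by rewrite !mulmxA.
have uphi := mine _ phiE phie.
have bphi : b *m phi = g *m h' by rewrite mulmxDr !mulmxA ba mul1mx b0 mul0mx addr0.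
have wE : equi G (h' *m invmx phi *m a) by apply: equiM => //; apply: equiM => //; apply: equi_invmx.
have [w wE'] := equi_ghom wE; exists w.
by rewrite wE' !mulmxA -bphi mulmxK.
Qed.

(* [E] is the source of a minimal right almost split map; the extension [E0],
   which may have further summands, is kept to bound its size. *)
Lemma right_neighbours N : indecomposable N -> odd (rdegree N) ->
  exists E (e : Hom E N) l,
  [/\ right_almost_split e, decomposes E l /\ ~~ odd (rdegree E),
      forall Y, List.In Y l -> indecomposable Y /\
         exists f : ghom Y N, irreducible_map f,
      forall M (f : ghom M N), indecomposable M -> irreducible_map f ->
        exists2 Y, List.In Y l & isomorphic M Y &
      exists E0 (e0 : Hom E0 N) (j : Hom (syzygy (syzygy N)) E0) Z,
      [/\ biprod E0 E Z, equi G e0 /\ equi G j, row_free j /\ row_full e0,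
          j *m e0 = 0 &
          rdegree E0 = (rdegree N + rdegree (syzygy (syzygy N)))%N]].
Proof.
move=> indN oN; have [E [e [ase mine evE E0P]]] := minimal_almost_split indN oN.
have [l dE] := decomposition E; exists E, e, l; split=> //.
  move=> Y lY; have [indY [Z [a b a' b' eqs H]]] := decomposes_biprod dE lY.
  split=> //; have [f _ irf] := almost_split_irreducible indN ase mine indY eqs H.
  by exists f.
move=> M f indM [nm nep irf]; have [eE ne lift] := ase.
have fE := ghom_equi f.
have nf : ~ splits_epi (ghom_mx f) by move/split_epiP.
have [u uE ue] := lift _ _ fE (nonsplit_epi_trnull indN fE nf).
have [ug ugE] := equi_ghom uE; have [eg egE] := equi_ghom eE.
have [|[w uw]|/split_epiP] := irf E ug eg; first by rewrite ugE egE.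
  have wE := ghom_equi w; rewrite ugE in uw.
  pose Q (h : Hom M M) := equi G h /\ (h \in unitmx -> exists2 Y, List.In Y l & isomorphic M Y).
  suff: Q (u *m w) by case=> _; apply; rewrite uw unitmx1.
  apply: (decomposes_id dE (Q := Q)) => //.
  - split; first exact: equi0.
    have [M_gt0 _] := indM; rewrite -row_free_unit /row_free mxrank0.
    by move=> /eqP E0; rewrite -E0 in M_gt0.
  - move=> h1 h2 [h1E H1] [h2E H2]; split; first exact: equiD.
    by case/(indec_unit_add2 indM h1E h2E); [apply: H1 | apply: H2].
  move=> Y a b lY indY aE bE ba; split; first by apply: equiM => //; apply: equiM.
  move=> un; exists Y => //; apply: (indec_retract_iso indM indY _ _ un); exact: equiM.
by rewrite egE.
Qed.

End Irreducible.

(** * Restriction to four-groups *)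

(** With [a = v *m h] and [b = v *m X *m h], the left side is the transfer of [h] over the
    four-group applied to a vector with [v *m W = c *: (v *m X)]; the factorisation puts it in the
    image of the shifted element. The two sides differ by twice a matrix. *)
Lemma four_group_norm (k : fieldType) m n (a b : 'M[k]_(m, n)) (X W : 'M_n) (c : k) :
    2%N \in [pchar k]%R -> X *m X = 0 -> W *m W = 0 -> X *m W = W *m X ->
  a + (a + b) *m (1%:M + X) +
  ((a + c *: b) *m (1%:M + W) +
   (a + (1 + c) *: b) *m ((1%:M + X) *m (1%:M + W))) =
  (a *m X + b + (1 + c) *: (b *m X)) *m (W + c *: X).
Proof.
move=> char2 XX WW XW.
have E u : u *m ((1%:M + X) *m (1%:M + W)) = u + u *m X + u *m W + u *m X *m W :> 'M_(m, n).
  by rewrite mulmxA !mulmxDr !mulmx1 mulmxDl addrA.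
have xx u : u *m X *m X = 0 :> 'M_(m, n) by rewrite -mulmxA XX mulmx0.
rewrite E !(mulmxDl, mulmxDr) !mulmx1 -!scalemxAl -!scalemxAr -?scalemxAl !xx !scaler0.
move: (a *m X *m W) (b *m X *m W) (a *m X) (a *m W) (b *m X) (b *m W) => aXW bXW aX aW bX bW.
apply/matrixP=> i j; rewrite !mxE.
move: (a i j) (b i j) (aX i j) (aW i j) (bX i j) (bW i j) (aXW i j) (bXW i j).
move=> p q pX pW qX qW pXW qXW.
apply/eqP; rewrite -subr_eq0; apply/eqP.
set d := (X in X = 0).
have -> : d = (p + p + pX + pW + (1 + c) * q + qX + c * qW) +
              (p + p + pX + pW + (1 + c) * q + qX + c * qW) by rewrite /d; ring.
exact: addr2_pchar.
Qed.

Lemma four_group_norm1 (k : fieldType) m n (a b : 'M[k]_(m, n)) (X W : 'M_n) :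
    2%N \in [pchar k]%R -> X *m W = W *m X ->
  a + a *m (1%:M + X) + (b *m (1%:M + W) + b *m ((1%:M + X) *m (1%:M + W))) =
  (a + b + b *m W) *m X.
Proof.
move=> char2 XW.
rewrite !(mulmxDl, mulmxDr, mul1mx, mulmx1) XW -[b *m W *m X]mulmxA.
move: (a *m X) (b *m W) (b *m X) (b *m (W *m X)) => aX bW bX bWX.
apply/matrixP=> i j; rewrite !mxE.
move: (a i j) (b i j) (aX i j) (bX i j) (bW i j) (bWX i j) => p q pX qX qW qWX.
apply/eqP; rewrite -subr_eq0; apply/eqP.
set d := (X in X = 0).
have -> : d = (p + q + qW) + (p + q + qW) by rewrite /d; ring.
exact: addr2_pchar.
Qed.

Section ShiftedCyclic.

Variables (k : closedFieldType) (gT : finGroupType) (G : {group gT}).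
Local Notation module := (representation k G).
Local Notation Hom M N := 'M[k]_(rdegree M, rdegree N).
Implicit Types (M N L P Y Z U V E : module).
Hypothesis char2 : 2%N \in [pchar k]%R.
Let sGG := subxx G.

Variables s z : gT.
Hypotheses (Gs : s \in G) (Gz : z \in G).
Hypotheses (os : (s * s = 1)%g) (oz : (z * z = 1)%g) (csz : (s * z = z * s)%g).

(* The shifted cyclic subgroups of the four-group: [1 + shift (Some c)] and
   [1 + shift None] are the units [z + c (s - 1)] and [s] of its group
   algebra; [defect] is the number of non-free summands. *)
Definition shift (o : option k) M : Hom M M :=
  if o is Some c then (M z - 1%:M) + c *: (M s - 1%:M) else M s - 1%:M.

Definition defect o M := (rdegree M - (\rank (shift o M)).*2)%N.

Lemma sub_sq M x : x \in G -> (x * x = 1)%g ->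
  (M x - 1%:M : Hom M M) *m (M x - 1%:M) = 0.
Proof.
move=> Gx xx; rewrite mulmxBl mulmxBr mulmx1 mul1mx -repr_mxM // xx repr_mx1.
by rewrite opprB (addmm2 char2).
Qed.

Lemma sub_comm M : (M s - 1%:M : Hom M M) *m (M z - 1%:M) = (M z - 1%:M) *m (M s - 1%:M).
Proof.
rewrite !(mulmxBl, mulmxBr, mulmx1, mul1mx) -!repr_mxM // csz !opprB.
by rewrite addrACA [RHS]addrACA; congr (_ + _); apply: addrC.
Qed.

Lemma shift_sq o M : shift o M *m shift o M = 0.
Proof.
case: o => [c|]; last exact: sub_sq.
have [XX WW] := (sub_sq M Gs os, sub_sq M Gz oz); have := sub_comm M.
rewrite /=; move: (M s - _) (M z - _) XX WW => X W XX WW XW.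
rewrite mulmxDl !mulmxDr -!scalemxAl -!scalemxAr XX WW !scaler0 addr0 add0r.
by rewrite XW (addmm2 char2).
Qed.

Lemma shift_natural o M N (f : Hom M N) : equi G f ->
  shift o M *m f = f *m shift o N.
Proof.
move=> fE; have E x : x \in G -> (M x - 1%:M) *m f = f *m (N x - 1%:M).
  by move=> Gx; rewrite mulmxBl mulmxBr mul1mx mulmx1; congr (_ - _); apply/actP => //; apply: fE.
case: o => [c|] /=; last exact: E.
by rewrite mulmxDl mulmxDr -scalemxAl -scalemxAr !E.
Qed.

Lemma rank_shift o M : ((\rank (shift o M)).*2 <= rdegree M)%N.
Proof.
have := mxrank_mul_ker (shift o M) (shift o M); rewrite shift_sq mxrank0 add0n => E.
have := mxrankS (capmxSr (shift o M) (kermx (shift o M))); rewrite E mxrank_ker.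
by have := rank_leq_row (shift o M); lia.
Qed.

Lemma defectK o M : (defect o M + (\rank (shift o M)).*2 = rdegree M)%N.
Proof. by rewrite subnK ?rank_shift. Qed.

Lemma odd_defect o M : odd (defect o M) = odd (rdegree M).
Proof. by rewrite -(defectK o M) oddD odd_double addbF. Qed.

Lemma defect_biprod o M Y Z : biprod M Y Z -> defect o M = (defect o Y + defect o Z)%N.
Proof.
move=> bp; have dM := biprod_dim bp; case: bp => a b a' b' [aE bE a'E b'E] eqs.
have [E1 E2] := biprod_mx eqs.
have: col_mx b b' *m shift o M *m row_mx a a' = block_mx (shift o Y) 0 0 (shift o Z).
  case: eqs => ba ba' b0 b0' _.
  rewrite mul_col_mx mul_col_row -!mulmxA !shift_natural //.
  by rewrite !mulmxA ba ba' b0 b0' !mul1mx !mul0mx.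
move/(congr1 mxrank); rewrite rank_diag_block_mx => E.
have rM : \rank (shift o M) = (\rank (shift o Y) + \rank (shift o Z))%N.
  rewrite -E; apply/eqP; rewrite eqn_leq; apply/andP; split; last first.
    by apply: leq_trans (mxrankM_maxl _ _) _; apply: mxrankM_maxr.
  rewrite -[X in (\rank X <= _)%N](_ : row_mx a a' *m (col_mx b b' *m shift o M *m row_mx a a') *m col_mx b b' = _).
    by apply: leq_trans (mxrankM_maxl _ _) _; apply: mxrankM_maxr.
  by rewrite !mulmxA E1 mul1mx -mulmxA E1 mulmx1.
rewrite /defect rM dM doubleD; have := rank_shift o Y; have := rank_shift o Z; lia.
Qed.

Lemma defect_iso o M N : isomorphic M N -> defect o M = defect o N.
Proof.
case/isomorphicP=> f [g [fE gE fg gf]].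
have dMN : rdegree M = rdegree N by apply/eqP; rewrite eqn_leq (mulmx1_min fg) (mulmx1_min gf).
suff rMN : \rank (shift o M) = \rank (shift o N) by rewrite /defect rMN dMN.
apply/eqP; rewrite eqn_leq; apply/andP; split.
  rewrite -[shift o M]mulmx1 -fg mulmxA shift_natural // -mulmxA.
  by apply: leq_trans (mxrankM_maxr _ _) (mxrankM_maxl _ _).
rewrite -[shift o N]mulmx1 -gf mulmxA shift_natural // -mulmxA.
by apply: leq_trans (mxrankM_maxr _ _) (mxrankM_maxl _ _).
Qed.

Lemma defect_extension o M E N (j : Hom M E) (e : Hom E N) :
    equi G j -> equi G e -> row_free j -> row_full e -> j *m e = 0 ->
    rdegree E = (rdegree N + rdegree M)%N ->
  (defect o E <= defect o N + defect o M)%N.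
Proof.
move=> jE eE fj fe je dE; rewrite /defect.
have := mxrank_mul_ker (shift o E) e; rewrite shift_natural //.
have -> : \rank (e *m shift o N) = \rank (shift o N).
  apply/eqP; rewrite eqn_leq mxrankM_maxr /=; have /row_fullP[w we] := fe.
  by rewrite -{1}[shift o N]mul1mx -we -mulmxA mxrankM_maxr.
have: (\rank (shift o M) <= \rank (shift o E :&: kermx e))%N.
  rewrite -(mxrankMfree (shift o M) fj); apply: mxrankS.
  rewrite sub_capmx shift_natural // submxMl; apply/sub_kermxP.
  by rewrite -mulmxA shift_natural // mulmxA je mul0mx.
have := rank_shift o M; have := rank_shift o N; lia.
Qed.

Variable A : {group gT}.
Hypothesis sumA : forall (V : nmodType) (F : gT -> V),
  \sum_(x in A) F x = F 1%g + F s + (F z + F (s * z)%g).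
Hypothesis sAG : A \subset G.

(** A projective module of a four-group is free over the shifted cyclic subgroups. If the shift
    kills [v], the translates of [v] involve only [v] and one more vector, and applying
    [1 = trf A h] to [v] gives the left side of a norm identity above. *)
Lemma higman_exact o P m (v : 'M_(m, rdegree P)) : higman A P ->
  v *m shift o P = 0 -> (v <= shift o P)%MS.
Proof.
case=> h hE.
have Si : (s^-1 = s)%g by apply/eqP; rewrite eq_invg_mul os.
have Zi : (z^-1 = z)%g by apply/eqP; rewrite eq_invg_mul oz.
have SZi : ((s * z)^-1 = s * z)%g by rewrite invMg Si Zi csz.
set X := P s - 1%:M; set W := P z - 1%:M.
have PS : P s = 1%:M + X by rewrite /X addrCA subrr addr0.
have PZ : P z = 1%:M + W by rewrite /W addrCA subrr addr0.
have PSZ : P (s * z)%g = (1%:M + X) *m (1%:M + W) by rewrite repr_mxM // PS PZ.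
have XX : X *m X = 0 by apply: sub_sq.
have WW : W *m W = 0 by apply: sub_sq.
have XW : X *m W = W *m X by apply: sub_comm.
have h1 : 1%:M = h + (1%:M + X) *m h *m (1%:M + X) + ((1%:M + W) *m h *m (1%:M + W) +
    (1%:M + X) *m (1%:M + W) *m h *m ((1%:M + X) *m (1%:M + W))).
  by rewrite [LHS]hE /trf sumA !actE invg1 Si Zi SZi repr_mx1 mul1mx mulmx1 PSZ PS PZ.
have vE : v = v *m h + v *m (1%:M + X) *m h *m (1%:M + X) + (v *m (1%:M + W) *m h *m (1%:M + W) +
    v *m ((1%:M + X) *m (1%:M + W)) *m h *m ((1%:M + X) *m (1%:M + W))).
  have D (a b c d : 'M_(rdegree P)) : v *m (a + b + (c + d)) = v *m a + v *m b + (v *m c + v *m d).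
    by rewrite !mulmxDr.
  by rewrite -[LHS]mulmx1 [X in _ *m X = _]h1 D !mulmxA.
case: o => [c|] /= v0; rewrite -/X -/W in v0 *.
  pose a := v *m h; pose b := v *m X *m h.
  have vW : v *m W = c *: (v *m X).
    apply/eqP; rewrite -(oppm2 char2 (c *: _)) -addr_eq0.
    by rewrite scalemxAr -mulmxDr v0.
  have vXW : v *m X *m W = 0 by rewrite -mulmxA XW mulmxA vW -scalemxAl -mulmxA XX mulmx0 scaler0.
  apply/submxP; exists (a *m X + b + (1 + c) *: (b *m X)).
  have -> : v = a + (a + b) *m (1%:M + X) + ((a + c *: b) *m (1%:M + W) +
      (a + (1 + c) *: b) *m ((1%:M + X) *m (1%:M + W))).
    have v1 : v *m (1%:M + X) = v + v *m X by rewrite mulmxDr mulmx1.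
    have v2 : v *m (1%:M + W) = v + c *: (v *m X) by rewrite mulmxDr mulmx1 vW.
    have v3 : v *m ((1%:M + X) *m (1%:M + W)) = v + (1 + c) *: (v *m X).
      rewrite mulmxA v1 mulmxDr mulmx1 mulmxDl vW vXW addr0 -addrA scalerDl.
      by rewrite scale1r.
    rewrite {1}vE v1 v2 v3 !mulmxDl -!scalemxAl -/a -/b.
    by [].
  exact: four_group_norm.
pose a := v *m h; pose b := v *m (1%:M + W) *m h.
apply/submxP; exists (a + b + b *m W).
have v1 : v *m (1%:M + X) = v by rewrite mulmxDr mulmx1 v0 addr0.
have v2 : v *m ((1%:M + X) *m (1%:M + W)) = v *m (1%:M + W) by rewrite mulmxA v1.
rewrite {1}vE v1 v2 -/a -/b; clearbody a b.
exact: four_group_norm1.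
Qed.

Lemma higman_defect o P : higman A P -> defect o P = 0%N.
Proof.
move=> hP; have := mxrank_mul_ker (shift o P) (shift o P); rewrite shift_sq mxrank0 add0n.
have ek : (kermx (shift o P) <= shift o P)%MS.
  by apply: higman_exact => //; apply: mulmx_ker.
have ke : (shift o P <= kermx (shift o P))%MS by apply/sub_kermxP; apply: shift_sq.
have := mxrankS ek; have := mxrankS ke; rewrite mxrank_ker /defect.
have := rank_shift o P; lia.
Qed.

(** On the cover the shift has equal kernel and image, and the image of the syzygy is the kernel of
    the cover map. The rank counts for the two maps therefore contain the same intersection, which
    cancels. *)
Lemma defect_syzygy o N : defect o (syzygy N) = defect o N.
Proof.
have hP : higman A (Defs.cover N) by apply: null_sub (cover_higman N).
have dP := higman_defect o hP; have := rank_shift o (Defs.cover N).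
have iE := syz_equi N sGG; have pE := cover_equi N sGG.
have dE := rdegree_syzygy N.
have fi : row_free (syz_mx N) by apply/row_freeP; exists (cov_ret N); apply: cov_ret_id.
have fp : row_full (cov_mx N) by apply/row_fullP; exists (cov_sec N); apply: cov_secK.
have r1 := mxrank_mul_ker (shift o (Defs.cover N)) (cov_mx N).
have r2 : \rank (shift o (Defs.cover N) *m cov_mx N) = \rank (shift o N).
  rewrite shift_natural //; apply/eqP; rewrite eqn_leq mxrankM_maxr /=.
  have /row_fullP[w we] := fp.
  by rewrite -{1}[shift o N]mul1mx -we -mulmxA mxrankM_maxr.
have r3 := mxrank_mul_ker (syz_mx N) (shift o (Defs.cover N)).
have r4 : \rank (syz_mx N *m shift o (Defs.cover N)) = \rank (shift o (syzygy N)).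
  by rewrite -shift_natural // mxrankMfree.
have r5 : \rank (syz_mx N) = rdegree (syzygy N) by apply/eqP.
have r6 : \rank (syz_mx N :&: kermx (shift o (Defs.cover N))) =
          \rank (shift o (Defs.cover N) :&: kermx (cov_mx N)).
  have k1 : (kermx (shift o (Defs.cover N)) :=: shift o (Defs.cover N))%MS.
    apply/eqmxP/andP; split; first by apply: higman_exact => //; apply: mulmx_ker.
    by apply/sub_kermxP; apply: shift_sq.
  have k2 : (kermx (cov_mx N) :=: syz_mx N)%MS.
    apply/eqmxP/andP; split; last by apply/sub_kermxP; apply: syz_cover.
    apply/submxP; exists (kermx (cov_mx N) *m cov_ret N).
    by rewrite cov_retE ?mulmx_ker.
  by rewrite capmxC (cap_eqmx k1 (eqmx_sym k2)).
have := rank_shift o N; have := rank_shift o (syzygy N).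
move: dP dE r1 r3; rewrite /defect r2 r4 r5 r6.
move: (\rank (_ :&: _)%MS) (\rank (shift o N)) (\rank (shift o (syzygy N))) (\rank _).
move: (rdegree _) (rdegree _) (rdegree _); clear; lia.
Qed.

End ShiftedCyclic.

(* A rank-variety criterion for a pair of commuting square-zero matrices: if
   every combination [W + c X] and [X] itself is exact then so is the pair. *)
Lemma commuting_exact (k : closedFieldType) n (X W : 'M[k]_n) :
    X *m X = 0 -> W *m W = 0 -> X *m W = W *m X -> (kermx X <= X)%MS ->
    (forall c, kermx (W + c *: X)%R <= (W + c *: X)%R)%MS ->
  forall v : 'rV_n, v *m X = 0 -> v *m W = 0 -> (v <= X *m W)%MS.
Proof.
case: n X W => [|n] X W XX WW XW exX exW v vX vW; first by rewrite [v]thinmx0 sub0mx.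
pose r := pinvmx X.
have rX u : u *m X = 0 -> u *m r *m X = u :> 'rV_n.+1.
  by move=> uX; rewrite mulmxKpV // (submx_trans _ exX) //; apply/sub_kermxP.
move: r rX => r rX; pose D := r *m W.
(* On the common kernel [D] is division by [X] followed by [W]. If [u *m (D - c%:M)] is
   [t *m (X *m W)], the corrected quotient [u *m r - t *m X] is killed by [W - c X], hence lies in
   its image, and multiplying by [X] puts [u] in the image of [X *m W]. The roots of the
   characteristic polynomial of [D] supply the constants [c]. *)
have descend c (u : 'rV_n.+1) : u *m X = 0 -> u *m W = 0 ->
    (u *m (D - c%:M)%R <= X *m W)%MS -> (u <= X *m W)%MS.
  move=> uX uW /submxP[t tE].
  have key : (u *m r - t *m X) *m (W + (- c) *: X) = 0.
    rewrite mulmxBl !mulmxDr -!scalemxAr rX // -[t *m X *m X]mulmxA XX mulmx0 scaler0 addr0.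
    rewrite -[t *m X *m W]mulmxA -tE mulmxBr /D (mulmxA u r) mul_mx_scalar scaleNr.
    by rewrite subrr.
  have /submxP[t' t'E] : ((u *m r - t *m X)%R <= (W + (- c) *: X)%R)%MS.
    by apply: submx_trans (exW (- c)); apply/sub_kermxP.
  apply/submxP; exists t'; rewrite -[LHS]rX //.
  have -> : u *m r = t' *m (W + (- c) *: X) + t *m X by rewrite -t'E subrK.
  rewrite mulmxDl -[t *m X *m X]mulmxA XX mulmx0 addr0 -mulmxA mulmxDl -scalemxAl.
  by rewrite XX scaler0 addr0 XW.
have good c (u : 'rV_n.+1) : u *m X = 0 -> u *m W = 0 ->
    u *m (D - c%:M) *m X = 0 /\ u *m (D - c%:M) *m W = 0.
  move=> uX uW; rewrite !mulmxBr mul_mx_scalar !mulmxBl -!scalemxAl uX uW scaler0 !subr0.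
  by rewrite /D (mulmxA u r) -!(mulmxA (u *m r)) -XW WW mulmx0 mulmxA rX.
have all_roots (l : seq k) (u : 'rV_n.+1) : u *m X = 0 -> u *m W = 0 ->
    (u *m horner_mx D (\prod_(c <- l) ('X - c%:P)) <= X *m W)%MS -> (u <= X *m W)%MS.
  elim: l u => [|c l IH] u uX uW.
    by rewrite big_nil rmorph1 mulmx1.
  rewrite big_cons rmorphM /= rmorphB /= horner_mx_X horner_mx_C.
  rewrite -[_ * _]/(_ *m _) mulmxA => H.
  have [H1 H2] := good c u uX uW.
  by apply: (descend c u) => //; apply: IH.
have [l lE] := closed_field_poly_normal (char_poly D).
apply: (all_roots l) => //.
have := Cayley_Hamilton D; rewrite lE (monicP (char_poly_monic D)) scale1r => ->.
by rewrite mulmx0 sub0mx.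
Qed.

(** * Fixed vectors, norms and projectivity *)

Section FixedPoints.

Variables (k : fieldType) (gT : finGroupType) (G : {group gT}).
Local Notation module := (representation k G).
Local Notation Hom M N := 'M[k]_(rdegree M, rdegree N).
Implicit Types (M N L P : module).
Hypothesis char2 : 2%N \in [pchar k]%R.

(** [T] is the identity on fixed vectors, so its kernel is a submodule without non-zero fixed
    vectors, which is zero for a 2-group in characteristic 2. Dividing by the unit [T] makes the
    identity a transfer. *)
Lemma higman_fixed (K : {group gT}) M : K \subset G -> (2.-group K)%g ->
    (forall v : 'rV_(rdegree M), (forall x, x \in K -> v *m M x = v) ->
       (v <= (\sum_(x in K) M x)%R)%MS) ->
  higman K M.
Proof.
move=> sKG pK fixK; set N := \sum_(x in K) _ in fixK.
pose T := trf K (pinvmx N : Hom M M).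
have TE : equi K T by apply: trf_equi.
have Tfix v : (forall x, x \in K -> v *m M x = v) -> v *m T = v :> 'rV_(rdegree M).
  move=> vK; rewrite -{2}[v](mulmxKpV (fixK v vK)) /T /trf /N !mulmx_sumr.
  apply: eq_bigr => x Kx; rewrite actE !mulmxA vK ?groupV //.
pose rK := subg_repr M sKG.
have modT : mxmodule rK (kermx T).
  apply/mxmoduleP=> x Kx; apply/sub_kermxP.
  have Gx := subsetP sKG x Kx.
  by rewrite -mulmxA ((actP T Gx).1 (TE x Kx)) mulmxA mulmx_ker mul0mx.
have uT : T \in unitmx.
  rewrite -row_free_unit -kermx_eq0 -mxrank_eq0; apply: contraT; rewrite -lt0n => rT.
  have /eqP[] := rfix_pgroup_pchar char2 (submod_repr modT) rT pK (subxx K).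
  apply/row_matrixP=> i; rewrite row0; apply: (@val_submod_inj _ _ (kermx T)); rewrite linear0.
  set v := row i _; rewrite -[LHS]Tfix.
    by apply/sub_kermxP; apply: val_submodP.
  move=> x Kx; rewrite -[LHS](val_submodJ modT) //; congr (val_submod _).
  rewrite /v -row_mul; congr (row i _).
  by have /rfix_mxP/(_ x Kx) := submx_refl (rfix_mx (submod_repr modT) K).
exists (pinvmx N *m invmx T).
rewrite (trfMl sKG) -/T ?mulmxV // => x Kx; have Gx := subsetP sKG x Kx.
apply/actP=> //; apply: (canLR (mulmxK uT)); rewrite -mulmxA.
by rewrite ((actP T Gx).1 (TE x Kx)) mulmxA mulVmx // mul1mx.
Qed.

Lemma higman_sum_fixed (K : {group gT}) M m (v : 'M_(m, rdegree M)) : higman K M ->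
  (forall x, x \in K -> v *m M x = v) -> exists u, v = u *m \sum_(x in K) M x.
Proof.
case=> h hE vK; exists (v *m h); rewrite -[LHS]mulmx1 hE /trf !mulmx_sumr.
by apply: eq_bigr => x Kx; rewrite actE !mulmxA vK ?groupV.
Qed.

(** Vanishing of Tate cohomology in degree -1, as [higman_sum_fixed] is in degree 0. Subtracting the
    zero norm of [w] from [w *m trf K h] leaves a combination of the [M x - 1]; the [x] for which
    this reduces to [B] form a subgroup. *)
Lemma higman_sum_null (K : {group gT}) (B : {set gT}) M m (w : 'M_(m, rdegree M)) :
    K \subset G -> B \subset K -> K :=: <<B>>%g -> higman K M ->
    w *m (\sum_(x in K) M x^-1%g) = 0 ->
  exists e : gT -> 'M_(m, rdegree M), w = \sum_(x in B) e x *m (M x - 1%:M).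
Proof.
move=> sKG sBK genK [h hE] w0.
have gen x : x \in K -> exists e : gT -> 'M_(rdegree M), M x - 1%:M = \sum_(y in B) e y *m (M y - 1%:M).
  pose Q := [set x in K | `[< exists e : gT -> 'M_(rdegree M), M x - 1%:M = \sum_(y in B) e y *m (M y - 1%:M) >]].
  suff gQ : group_set Q.
    suff sKQ : K \subset Group gQ by move/(subsetP sKQ); rewrite inE => /andP[_ /asboolP].
    rewrite [K : {set _}]genK gen_subG; apply/subsetP=> y0 By0.
    rewrite inE (subsetP sBK) //=; apply/asboolP.
    exists (fun y => (y == y0)%:R%:M); rewrite (bigD1 y0) //= eqxx mul1mx big1 ?addr0 // => y /andP[_ /negPf->].
    by rewrite raddf0 mul0mx.
  apply/group_setP; split=> [|y1 y2].
    rewrite inE group1; apply/asboolP; exists (fun=> 0); rewrite repr_mx1 subrr big1 // => *.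
    by rewrite mul0mx.
  rewrite !inE => /andP[Ky1 /asboolP[e eE]] /andP[Ky2 /asboolP[f fE]].
  rewrite groupM //; apply/asboolP; exists (fun z => M y1 *m f z + e z).
  under eq_bigr do rewrite mulmxDl -mulmxA.
  rewrite big_split /= -mulmx_sumr -fE -eE repr_mxM ?(subsetP sKG) // mulmxBr mulmx1.
  by rewrite addrA subrK.
have wE : w = \sum_(x in K) w *m M x^-1%g *m h *m (M x - 1%:M).
  rewrite -[LHS]mulmx1 [X in _ *m X]hE /trf mulmx_sumr.
  transitivity (\sum_(x in K) w *m M x^-1%g *m h *m (M x - 1%:M) + w *m (\sum_(x in K) M x^-1%g) *m h).
    rewrite mulmx_sumr mulmx_suml -big_split; apply: eq_bigr => x _ /=.
    by rewrite mulmxBr mulmx1 subrK actE !mulmxA.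
  by rewrite w0 mul0mx addr0.
have {gen} /choice[e eE] : forall x, exists e : gT -> 'M_(rdegree M), x \in K -> M x - 1%:M = \sum_(y in B) e y *m (M y - 1%:M).
  move=> x; have [/gen[e eE]|] := boolP (x \in K); first by exists e.
  by exists (fun=> 0).
exists (fun y => \sum_(x in K) w *m M x^-1%g *m h *m e x y).
rewrite {1}wE; under eq_bigr => x Kx do rewrite (eE x Kx) mulmx_sumr.
rewrite exchange_big; apply: eq_bigr => y By; rewrite mulmx_suml.
by apply: eq_bigr => x _; rewrite mulmxA.
Qed.

End FixedPoints.

Section DihedralSums.

Variables (gT : finGroupType) (V : nmodType).
Implicit Types (a b c x y : gT) (F : gT -> V).

Lemma sum_index2 (K H : {group gT}) x F : H \subset K -> x \in K -> x \notin H ->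
    (K \subset H :|: x *: H)%g ->
  \sum_(y in K) F y = \sum_(y in H) (F y + F (x * y)%g).
Proof.
move=> sHK Kx H'x KE; have {}KE : K :=: (H :|: x *: H)%g.
  apply/eqP; rewrite eqEsubset KE subUset sHK /=.
  by apply/subsetP=> _ /lcosetP[y Hy ->]; apply: groupM => //; apply: (subsetP sHK).
have dis : [disjoint H & (x *: H)%g].
  rewrite disjoint_sym; apply/pred0P=> y /=; apply/negP=> /andP[/lcosetP[u Hu ->]].
  by rewrite groupMr // (negPf H'x).
rewrite KE (eq_bigl [in [predU H & x *: H]%g]) => [|y]; last by rewrite !inE.
rewrite bigU // big_split /=; congr (_ + _).
rewrite (reindex_inj (mulgI x)); apply: eq_bigl => y.
by rewrite mem_lcoset mulKg.
Qed.

Lemma dihedral_sum a b F : (a * a = 1)%g -> (b * b = 1)%g -> a \notin <[a * b]>%g ->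
  \sum_(y in <<[set a; b]>>%g) F y = \sum_(y in <[a * b]>%g) (F y + F (a * y)%g).
Proof.
move=> aa bb H'a; have [Ka Kb] : a \in <<[set a; b]>>%g /\ b \in <<[set a; b]>>%g.
  by split; apply: mem_gen; rewrite !inE eqxx ?orbT.
apply: sum_index2 => //; first by rewrite cycle_subG groupM.
have Va : (a^-1 = a)%g by apply/eqP; rewrite eq_invg_mul aa.
have Vb : (b^-1 = b)%g by apply/eqP; rewrite eq_invg_mul bb.
have na : <[a]>%g \subset 'N(<[a * b]>)%g.
  rewrite cycle_subG; apply/normP; rewrite -cycleJ conjgE Va !mulgA aa mul1g.
  by rewrite -(cycleV (a * b)) invMg Va Vb.
have oa : #[a]%g = 2%N.
  apply: nt_prime_order; [by [] | by rewrite expgS expg1 |].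
  by apply: contraNneq H'a => ->; apply: group1.
have sK : <<[set a; b]>>%g \subset (<[a]> * <[a * b]>)%g.
  rewrite -norm_joinEl // gen_subG; apply/subsetP=> x /set2P[] ->.
    by apply: (subsetP (joing_subl _ _)); apply: cycle_id.
  rewrite -{1}[b]mul1g -aa -mulgA groupM //.
    by apply: (subsetP (joing_subl _ _)); apply: cycle_id.
  by apply: (subsetP (joing_subr _ _)); apply: cycle_id.
apply: subset_trans sK _; apply/subsetP=> _ /mulsgP[u v ua vc ->].
move: ua; rewrite cycle2g // !inE mem_lcoset => /orP[] /eqP->.
  by rewrite mul1g vc.
by rewrite mulKg vc orbT.
Qed.

Lemma cycle_sum c F : c \notin <[c ^+ 2]>%g ->
  \sum_(y in <[c]>%g) F y = \sum_(y in <[c ^+ 2]>%g) (F y + F (c * y)%g).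
Proof.
move=> H'c; apply: sum_index2 => //; first exact: cycleX.
  exact: cycle_id.
apply/subsetP=> _ /cycleP[i ->]; rewrite -[i]odd_double_half inE mem_lcoset.
rewrite -mul2n expgD; case: (odd i); rewrite ?expg0 ?mul1g expgM ?mem_cycle // expg1.
by rewrite mulKg mem_cycle orbT.
Qed.

End DihedralSums.

(** * Chouinard's theorem for dihedral groups *)

Section Chouinard.

Variables (k : fieldType) (gT : finGroupType) (G : {group gT}).
Local Notation module := (representation k G).
Implicit Types (M N L P : module).
Hypothesis char2 : 2%N \in [pchar k]%R.

(* If [N1], [N2], [N] are the norms of the two subgroups of index 2 and of the
   whole group, then [m = beta *m N2] fixed forces [beta *m (M b - 1)] into the
   kernel of [N1]; solving for it gives [m = g *m N]. *)
Lemma higman_dihedral (a b : gT) M : a \in G -> b \in G ->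
    (a * a = 1)%g -> (b * b = 1)%g -> a \notin <[a * b]>%g ->
    (a * b)%g \notin <[(a * b) ^+ 2]>%g -> ~~ odd #[(a * b) ^+ 2]%g ->
    (2.-group <<[set a; b]>>)%g ->
    higman <<[set a; (b * a * b)%g]>>%g M -> higman <<[set b; a * b * a]>>%g M ->
  higman <<[set a; b]>>%g M.
Proof.
move=> Ga Gb aa bb H'a H'c evc pK h1 h2; set c := (a * b)%g in H'a H'c evc.
have Va : (a^-1 = a)%g by apply/eqP; rewrite eq_invg_mul aa.
have Vb : (b^-1 = b)%g by apply/eqP; rewrite eq_invg_mul bb.
have sKG : <<[set a; b]>>%g \subset G by rewrite gen_subG; apply/subsetP=> x /set2P[] ->.
have [Ka Kb] : a \in <<[set a; b]>>%g /\ b \in <<[set a; b]>>%g.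
  by split; apply: mem_gen; rewrite !inE eqxx ?orbT.
have sH1K : <<[set a; b * a * b]>>%g \subset <<[set a; b]>>%g.
  by rewrite gen_subG; apply/subsetP=> x /set2P[] ->; rewrite ?groupM.
have sH2K : <<[set b; a * b * a]>>%g \subset <<[set a; b]>>%g.
  by rewrite gen_subG; apply/subsetP=> x /set2P[] ->; rewrite ?groupM.
have MM x y : x \in <<[set a; b]>>%g -> y \in <<[set a; b]>>%g -> M (x * y)%g = M x *m M y.
  by move=> Kx Ky; rewrite repr_mxM ?(subsetP sKG).
have cK : <[c ^+ 2]>%g \subset <<[set a; b]>>%g by rewrite cycle_subG groupX ?groupM.
have ccE : (a * (b * a * b) = c ^+ 2)%g by rewrite expgS expg1 /c !mulgA.
have ccV : (b * (a * b * a) = (c ^+ 2)^-1)%g by rewrite -ccE !invMg Va Vb !mulgA.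
pose A := M a; pose B := M b; pose R := \sum_(y in <[c ^+ 2]>%g) M y.
have AA : A *m A = 1%:M by rewrite -MM // aa repr_mx1.
have BB : B *m B = 1%:M by rewrite -MM // bb repr_mx1.
have N1E : \sum_(x in <<[set a; b * a * b]>>%g) M x^-1%g = R *m (1%:M + A).
  rewrite dihedral_sum ?ccE //; last 2 first.
  - by rewrite !mulgA -(mulgA _ b b) bb mulg1 -(mulgA _ a a) aa mulg1.
  - by apply: contra H'a; apply: subsetP; apply: cycleX.
  have RV : \sum_(y in <[c ^+ 2]>%g) M y^-1%g = R.
    by rewrite (reindex_inj invg_inj); apply: eq_big => y; rewrite ?groupV ?invgK.
  rewrite mulmxDr mulmx1 big_split /= RV; congr (_ + _).
  rewrite -RV mulmx_suml; apply: eq_bigr => y cy.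
  by rewrite invMg Va MM // groupV (subsetP cK).
have N2E : \sum_(x in <<[set b; a * b * a]>>%g) M x = (1%:M + B) *m R.
  rewrite dihedral_sum ?ccV ?cycleV //; last 2 first.
  - by rewrite !mulgA -(mulgA _ a a) aa mulg1 -(mulgA _ b b) bb mulg1.
  - apply: contra H'a => /(subsetP (cycleX _ _)) cb.
    by rewrite -[a]mulg1 -bb mulgA groupM ?cycle_id.
  rewrite mulmxDl mul1mx big_split /= /R mulmx_sumr; congr (_ + _).
  by apply: eq_bigr => u cu; rewrite MM // (subsetP cK).
have NE : \sum_(x in <<[set a; b]>>%g) M x = (1%:M + A) *m ((1%:M + B) *m R).
  have AC : A *m M c = B by rewrite /c MM // mulmxA AA mul1mx.
  have -> : (1%:M + A) *m ((1%:M + B) *m R) = (1%:M + A + (M c + B)) *m R.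
    by rewrite mulmxA; congr (_ *m R); rewrite mulmxDr mulmx1 mulmxDl mul1mx (addrC (M c)) /c MM.
  rewrite dihedral_sum // -/c cycle_sum // /R mulmx_sumr.
  apply: eq_bigr => u cu; have Ku := subsetP cK _ cu.
  have Kc : c \in <<[set a; b]>>%g by rewrite groupM.
  by rewrite (MM a (c * u)%g) ?groupM // (MM a u) // (MM c u) // -AC !mulmxDl mul1mx !mulmxA.
apply: higman_fixed => // v vK.
have [beta vE] : exists u, v = u *m \sum_(x in <<[set b; a * b * a]>>%g) M x.
  by apply: (higman_sum_fixed h2) => x /(subsetP sH2K); apply: vK.
rewrite N2E mulmxA in vE.
have [e eE] : exists e : gT -> 'rV_(rdegree M), beta *m (1%:M + B) =
    \sum_(x in [set a; (b * a * b)%g]) e x *m (M x - 1%:M).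
  apply: (higman_sum_null _ _ _ h1) => //; first exact: subset_trans sH1K sKG.
    exact: subset_gen.
  by rewrite N1E mulmxA -vE mulmxDr mulmx1 vK // (addmm2 char2).
(* [f] absorbs one factor [b] of [b a b], and [gam] is chosen so that [gam *m (1%:M + B)] falls in
   the image of [A - 1]. It is then fixed by [a] and [b], so the sum [R] over a group of even order
   kills it, and [f *m (A - 1%:M)] can replace [beta]. *)
pose f := e (b * a * b)%g *m B; pose e0 := e a; pose gam := beta - f *m (A - 1%:M).
have wE : beta *m (1%:M + B) = e0 *m (A - 1%:M) + f *m (A - 1%:M) *m B.
  have : beta *m (1%:M + B) = e0 *m (A - 1%:M) + e (b * a * b)%g *m (M (b * a * b)%g - 1%:M).
    rewrite eE big_setU1 ?big_set1 // inE; apply/eqP=> E.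
    by move: evc; rewrite -ccE -E aa order1.
  move=> ->; rewrite /f -!mulmxA; congr (_ + _ *m _).
  by rewrite mulmxBl mul1mx mulmxBr BB (MM (b * a)%g) ?groupM // (MM b a) // -mulmxA.
have gB : gam *m (1%:M + B) = (e0 - f) *m (A - 1%:M).
  by rewrite mulmxBl wE (mulmxDr (f *m (A - 1%:M))) mulmx1 mulmxBl opprD addrACA subrr addr0.
have gK : gam *m (1%:M + B) *m R = 0.
  have gA x : x \in <<[set a; b]>>%g -> gam *m (1%:M + B) *m M x = gam *m (1%:M + B).
    suff sKw : <<[set a; b]>>%g \subset rstab M (gam *m (1%:M + B)).
      by move/(subsetP sKw); rewrite inE => /andP[_ /eqP].
    rewrite gen_subG; apply/subsetP=> y0 /set2P[] ->; rewrite inE ?Ga ?Gb /=.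
      have AE : (A - 1%:M) *m A = A - 1%:M.
        by rewrite mulmxBl AA mul1mx -[LHS](oppm2 char2) opprB.
      by rewrite gB -mulmxA AE.
    have BE : (1%:M + B) *m B = 1%:M + B by rewrite mulmxDl BB mul1mx addrC.
    by rewrite -mulmxA BE.
  rewrite /R mulmx_sumr (eq_bigr (fun=> gam *m (1%:M + B))).
    rewrite sumr_const -orderE -(odd_double_half #[_]%g) (negPf evc) add0n -mul2n mulrnA mulr2n.
    by rewrite (addmm2 char2) mul0rn.
  by move=> y cy; apply: gA; apply: (subsetP cK).
apply/submxP; exists f; rewrite NE vE.
have -> : beta = gam + f *m (A - 1%:M) by rewrite /gam subrK.
have -> : A - 1%:M = 1%:M + A by rewrite (oppm2 char2) addrC.
rewrite mulmxDl mulmxDl gK add0r (mulmxA f) (mulmxA (f *m _)).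
by [].
Qed.

End Chouinard.

Section Restriction.

Variables (k : fieldType) (gT : finGroupType) (G : {group gT}).
Local Notation module := (representation k G).
Local Notation Hom M N := 'M[k]_(rdegree M, rdegree N).
Implicit Types (M N L P : module).
Hypothesis char2 : 2%N \in [pchar k]%R.

Lemma trf_rreps M N (K H : {group gT}) (f : Hom M N) :
    H \subset K -> K \subset G ->
  trf K f = \sum_(X in rcosets H K) act (repr X) (trf H f).
Proof.
move=> sHK sKG; rewrite {1}/trf.
rewrite (partition_big (fun x => (H :* x)%g) (mem (rcosets H K))) /=; last first.
  by move=> x Kx; apply/rcosetsP; exists x.
apply: eq_bigr => X /rcosetsP[y Ky ->].
have [h Hh rE] : exists2 h, h \in H & repr (H :* y)%g = (h * y)%g.
  by have /rcosetP[h Hh ->] := mem_repr y (rcoset_refl H y); exists h.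
have Kr : repr (H :* y)%g \in K by rewrite rE groupM // (subsetP sHK).
have rE' : (H :* repr (H :* y) = H :* y)%g.
  by rewrite rE rcosetM (rcoset_id Hh).
rewrite /trf linear_sum /= (reindex_inj (mulIg (repr (H :* y)%g))) /=.
apply: eq_big => [x | x /andP[Kx _]]; last first.
  by rewrite groupMr // in Kx; rewrite actM // (subsetP sKG).
apply/andP/idP => [[_ /eqP/rcoset_eqP]|Hx].
  by rewrite mem_rcoset rE mulgA mulgK groupMr.
by rewrite groupMr // (subsetP sHK) // rcosetM (rcoset_id Hx) rE'.
Qed.

Lemma higman_odd_index (S : {group gT}) M : S \subset G -> odd #|G : S|%g ->
  higman S M -> higman G M.
Proof.
move=> sSG odS [h hE]; exists h; rewrite (trf_rreps _ sSG) // -hE.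
rewrite (eq_bigr (fun=> 1%:M)) => [|X /rcosetsP[x Gx ->]]; last first.
  apply: act_id; have /rcosetP[y Sy ->] := mem_repr x (rcoset_refl S x).
  by rewrite groupM // (subsetP sSG).
rewrite sumr_const -[#|_|]/(#|G : S|%g) -(odd_double_half #|G : S|%g) odS mulrS -mul2n mulrnA mulr2n.
by rewrite (addmm2 char2) mul0rn addr0.
Qed.

Lemma higman_conj (K : {group gT}) x M : K \subset G -> x \in G ->
  higman K M -> higman (K :^ x)%g M.
Proof.
move=> sKG Gx [h hE]; exists (act x h); rewrite -(act_id M Gx) hE /trf linear_sum /=.
rewrite [RHS](reindex_inj (conjg_inj x)) /=; apply: eq_big => y; first by rewrite memJ_conjg.
move=> Ky; have Gy := subsetP sKG y Ky.
by rewrite -!actM ?groupJ // -conjgC.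
Qed.

End Restriction.

Section FourGroupCriterion.

Variables (k : fieldType) (gT : finGroupType) (G S : {group gT}).
Local Notation module := (representation k G).
Implicit Types (M N L P : module).
Hypothesis char2 : 2%N \in [pchar k]%R.

Variables (s : bool -> gT) (z : gT) (e : nat).
Hypotheses (sSG : S \subset G) (pS : (2.-group S)%g).
Hypothesis defS : S :=: <<[set s true; s false]>>%g.
Hypothesis os : forall i, #[s i]%g = 2%N.
Hypothesis oz : #[z]%g = 2%N.
Hypothesis rq : ((s false * s true) ^+ (2 ^ e) = z)%g.
Hypothesis cSz : z \in 'C(S)%g.
Hypothesis invS : forall x, x \in S -> #[x]%g = 2%N -> x != z ->
  exists i, exists2 g, g \in S & x = (s i ^ g)%g.

(** Induction along the dihedral subgroups generated by [a] and [b]: the pairs [a], [bab] and [b],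
    [aba] have the rotation [(ab)^2] up to inversion. At the bottom [ab = z], and the four-group is
    conjugate in [S] to one generated by some [s i] and the central [z]. *)
Lemma higman_four_groups M :
  (forall i, higman <<[set s i; z]>>%g M) -> higman S M.
Proof.
move=> hA; have inv (x : gT) : #[x]%g = 2%N -> (x * x = 1)%g.
  by move=> ox; have := expg_order x; rewrite ox expgS expg1.
have Vz : (z^-1 = z)%g by apply/eqP; rewrite eq_invg_mul inv.
have Ss i : s i \in S by rewrite [S : {set _}]defS; apply: mem_gen; rewrite !inE; case: i; rewrite eqxx ?orbT.
have Sz : z \in S by rewrite -rq groupX // groupM.
have zn1 : z != 1%g by rewrite -order_eq1 oz.
suff H n a b : a \in S -> b \in S -> #[a]%g = 2%N -> #[b]%g = 2%N ->
    ((a * b) ^+ (2 ^ n) = z)%g -> higman <<[set a; b]>>%g M.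
  rewrite defS setUC; apply: (H e) => //; rewrite [S : {set _}]defS;
    by apply: mem_gen; rewrite !inE eqxx ?orbT.
elim: n a b => [|n IH] a b Sa Sb oa ob.
  rewrite expn0 expg1 => abz; have [aa bb] := (inv a oa, inv b ob).
  have az : a != z by apply: contra_eq_neq ob => az; rewrite -(mulKg a b) abz az mulVg order1.
  have [i [g Sg aE]] := invS Sa oa az.
  have zg : (z ^ g = z)%g by apply/conjg_fixP/commgP; apply: (centP cSz).
  have sAG : <<[set s i; z]>>%g \subset G.
    by rewrite gen_subG; apply/subsetP=> x /set2P[] ->; apply: (subsetP sSG).
  have : higman (<<[set s i; z]>> :^ g)%g M by apply: higman_conj (hA i); rewrite ?(subsetP sSG).
  rewrite -genJ conjUg !conjg_set1 -aE zg; apply: null_sub.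
    rewrite gen_subG; apply/subsetP=> x /set2P[] ->.
      by apply: mem_gen; rewrite !inE eqxx.
    rewrite -[b]mul1g -aa -mulgA abz groupM //; apply: mem_gen; rewrite !inE eqxx ?orbT //.
  by rewrite gen_subG; apply/subsetP=> x /set2P[] ->; apply: (subsetP sSG).
set c := (a * b)%g => cz; have [aa bb] := (inv a oa, inv b ob).
have Va : (a^-1 = a)%g by apply/eqP; rewrite eq_invg_mul aa.
have Vb : (b^-1 = b)%g by apply/eqP; rewrite eq_invg_mul bb.
have ccE : (a * (b * a * b) = c ^+ 2)%g by rewrite expgS expg1 /c !mulgA.
have ccV : (b * (a * b * a) = (c ^+ 2)^-1)%g by rewrite -ccE !invMg Va Vb !mulgA.
have ccz : ((c ^+ 2) ^+ (2 ^ n) = z)%g by rewrite -expgM -expnS.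
have evcc : ~~ odd #[c ^+ 2]%g.
  have := orderXdvd (c ^+ 2)%g (2 ^ n); rewrite ccz oz dvdn2.
  by [].
have evc : ~~ odd #[c]%g.
  by rewrite -dvdn2; apply: dvdn_trans (orderXdvd c 2); rewrite dvdn2.
apply: higman_dihedral => //; try by [apply: (subsetP sSG)|rewrite -/c].
- apply/negP=> /cycleP[i ai].
  have ac : (c ^ a = c)%g by apply/conjg_fixP/commgP; rewrite ai; apply: commuteX.
  have cc1 : (c ^+ 2 = 1)%g.
    rewrite expgS expg1 -{1}ac /c conjgE Va.
    by rewrite !mulgA aa mul1g -(mulgA _ a a) aa mulg1 bb.
  by case/eqP: zn1; rewrite -ccz cc1 expg1n.
- apply/negP=> /order_dvdG; rewrite -orderE => /(dvdn_leq (order_gt0 _)).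
  rewrite orderXdiv ?dvdn2 // leqNgt ltn_Pdiv //.
- apply: pgroupS pS; rewrite gen_subG; apply/subsetP=> x /set2P[] -> //.
- apply: IH => //; rewrite ?groupM //; last by rewrite ccE.
  by rewrite -(orderJ a b) conjgE Vb mulgA in oa.
- apply: IH => //; rewrite ?groupM //; last by rewrite ccV expgVn ccz.
  by rewrite -(orderJ b a) conjgE Va mulgA in ob.
Qed.

End FourGroupCriterion.

(** * Dade's lemma for four-groups *)

Section RankCriterion.

Variables (k : closedFieldType) (gT : finGroupType) (G : {group gT}).
Local Notation module := (representation k G).
Local Notation Hom M N := 'M[k]_(rdegree M, rdegree N).
Implicit Types (M N L P : module).
Hypothesis char2 : 2%N \in [pchar k]%R.

Variables (s z : gT) (A : {group gT}).
Hypotheses (Gs : s \in G) (Gz : z \in G).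
Hypotheses (os : (s * s = 1)%g) (oz : (z * z = 1)%g) (csz : (s * z = z * s)%g).
Hypothesis sumA : forall (V : nmodType) (F : gT -> V),
  \sum_(x in A) F x = F 1%g + F s + (F z + F (s * z)%g).
Hypothesis pA : (2.-group A)%g.
Hypothesis sAG : A \subset G.
Hypotheses (As : s \in A) (Az : z \in A).

(** In characteristic 2 the sum of the four group elements is [(s - 1) (z - 1)]. Zero defects make
    all shifts exact, so by [commuting_exact] every fixed vector is a norm. *)
Lemma defect0_higman M : (forall o, defect s z o M = 0%N) -> higman A M.
Proof.
move=> d0; have ker o : (kermx (shift s z o M) <= shift s z o M)%MS.
  have := mxrank_ker (shift s z o M).
  have -> : (rdegree M - \rank (shift s z o M))%N = \rank (shift s z o M).
    have := d0 o; have := rank_shift char2 Gs Gz os oz csz o M; rewrite /defect -addnn; lia.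
  move=> rk; have sub : (shift s z o M <= kermx (shift s z o M))%MS.
    by apply/sub_kermxP; apply: shift_sq.
  by have := mxrank_leqif_sup sub; rewrite rk => -[_ <-].
apply: higman_fixed => // v vA; rewrite sumA.
pose X : Hom M M := M s - 1%:M; pose W : Hom M M := M z - 1%:M.
have -> : M 1%g + M s + (M z + M (s * z)%g) = X *m W.
  rewrite repr_mx1 repr_mxM // /X /W mulmxBl mul1mx mulmxBr mulmx1.
  rewrite !(oppm2 char2); move: (M s) (M z) (M s *m M z) => a b ab.
  by rewrite (addrC 1%:M) (addrC b ab) addrACA (addrC a) (addrC 1%:M).
apply: commuting_exact.
- exact: sub_sq.
- exact: sub_sq.
- exact: sub_comm.
- exact: (ker None).
- by move=> c; apply: (ker (Some c)).
- by rewrite mulmxBr mulmx1 vA // subrr.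
- by rewrite mulmxBr mulmx1 vA // subrr.
Qed.

End RankCriterion.

(** * Duality and projective vertices *)

Section Dual.

Variables (k : closedFieldType) (gT : finGroupType) (G : {group gT}).
Local Notation module := (representation k G).
Local Notation Hom M N := 'M[k]_(rdegree M, rdegree N).
Implicit Types (M N L P Y Z U V : module).

Lemma dual_repr M : mx_repr G (fun x => (M x^-1%g)^T).
Proof.
split=> [|x y Gx Gy]; first by rewrite invg1 repr_mx1 trmx1.
by rewrite invMg repr_mxM ?groupV // trmx_mul.
Qed.

Definition dual M : module := Representation (MxRepresentation (dual_repr M)).

Lemma dualE M x : dual M x = (M x^-1%g)^T. Proof. by []. Qed.

(** One variant for each position of a dual, since [dual (dual M)] and [M] are isomorphic but not
    convertible. *)
Lemma act_dual M N x (f : Hom M N) : act x (f^T : Hom (dual N) (dual M)) = (act x f)^T.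
Proof. by rewrite !actE !dualE !trmx_mul invgK mulmxA. Qed.

Lemma act_duall M N x (f : Hom (dual M) N) :
  act x (f^T : Hom (dual N) M) = (act x f)^T.
Proof. by rewrite !actE !dualE !trmx_mul invgK trmxK mulmxA. Qed.

Lemma act_dualr M N x (f : Hom M (dual N)) :
  act x (f^T : Hom N (dual M)) = (act x f)^T.
Proof. by rewrite !actE !dualE !trmx_mul trmxK mulmxA. Qed.

Lemma act_dual2 M N x (f : Hom (dual M) (dual N)) :
  act x (f^T : Hom N M) = (act x f)^T.
Proof. by rewrite !actE !dualE !trmx_mul !trmxK invgK mulmxA. Qed.

Lemma equi_dual M N (f : Hom M N) : equi G f -> equi G (f^T : Hom (dual N) (dual M)).
Proof. by move=> fE x Gx; rewrite act_dual fE. Qed.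

Lemma equi_duall M N (f : Hom (dual M) N) : equi G f -> equi G (f^T : Hom (dual N) M).
Proof. by move=> fE x Gx; rewrite act_duall fE. Qed.

Lemma equi_dualr M N (f : Hom M (dual N)) : equi G f -> equi G (f^T : Hom N (dual M)).
Proof. by move=> fE x Gx; rewrite act_dualr fE. Qed.

Lemma equi_dual2 M N (f : Hom (dual M) (dual N)) : equi G f -> equi G (f^T : Hom N M).
Proof. by move=> fE x Gx; rewrite act_dual2 fE. Qed.

Lemma trnull_dual M N (f : Hom M N) : trnull G f -> trnull G (f^T : Hom (dual N) (dual M)).
Proof.
move=> f0 h hE; rewrite -[h]trmxK -trmx_mul mxtrace_tr mxtrace_mulC.
by apply: f0; apply: equi_dual2.
Qed.

Lemma trnull_dualr M N (f : Hom M (dual N)) : trnull G f -> trnull G (f^T : Hom N (dual M)).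
Proof.
move=> f0 h hE; rewrite -[h]trmxK -trmx_mul mxtrace_tr mxtrace_mulC.
by apply: f0; apply: equi_duall.
Qed.

Lemma higman_dual M : higman G M -> higman G (dual M).
Proof.
case=> h hE; exists (h^T); rewrite /trf -[LHS]trmx1 hE /trf linear_sum /=.
by apply: eq_bigr => x _; rewrite act_dual.
Qed.

Lemma biprod_dual M Y Z : biprod M Y Z -> biprod (dual M) (dual Y) (dual Z).
Proof.
case=> a b a' b' [aE bE a'E b'E] [ba ba' b0 b0' E].
exists (b^T : Hom (dual M) (dual Y)) (a^T : Hom (dual Y) (dual M))
  (b'^T : Hom (dual M) (dual Z)) (a'^T : Hom (dual Z) (dual M)).
  by split; apply: equi_dual.
by split; rewrite -?trmx_mul ?ba ?ba' ?b0 ?b0' ?trmx1 ?trmx0 // -linearD /= E trmx1.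
Qed.

Lemma biprod_dual2 M Y Z : biprod (dual M) Y Z -> biprod M (dual Y) (dual Z).
Proof.
case=> a b a' b' [aE bE a'E b'E] [ba ba' b0 b0' E].
exists (b^T : Hom M (dual Y)) (a^T : Hom (dual Y) M)
  (b'^T : Hom M (dual Z)) (a'^T : Hom (dual Z) M).
  by split; do ?[exact: equi_duall | exact: equi_dualr].
by split; rewrite -?trmx_mul ?ba ?ba' ?b0 ?b0' ?trmx1 ?trmx0 // -linearD /= E trmx1.
Qed.

Lemma indec_biprod M U V : indecomposable M -> biprod M U V ->
  rdegree U = 0%N \/ rdegree V = 0%N.
Proof.
move=> indM [a b a' b' [aE bE a'E b'E] [ba ba' b0 b0' E]].
have fE : equi G (a *m b) by apply: equiM.
have ff : a *m b *m (a *m b) = a *m b by rewrite mulmxA -(mulmxA a) ba mulmx1.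
have [uf | [n fn]] := fitting indM fE; [right | left].
  have ab : a *m b = 1%:M by rewrite -[LHS](mulmxK uf) ff mulmxV.
  have a'0 : a' = 0 by rewrite -[a']mul1mx -ab -mulmxA b0 mulmx0.
  by move: ba'; rewrite a'0 mulmx0 => /(congr1 mxrank); rewrite mxrank0 mxrank1.
have ab : a *m b = 0.
  have fX i : (a *m b : Hom M M) ^+ i.+1 = a *m b.
    by elim: i => [|i IH]; [apply: expr1 | rewrite exprS IH; apply: ff].
  by case: n fn => [|n]; rewrite ?fX // expr0 => f1; rewrite -[LHS]mulr1 f1 mulr0.
have b00 : b = 0 by rewrite -[b]mul1mx -ba -mulmxA ab mulmx0.
by move: ba; rewrite b00 mul0mx => /(congr1 mxrank); rewrite mxrank0 mxrank1.
Qed.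

Lemma indecomposable_dual M : indecomposable M -> indecomposable (dual M).
Proof.
move=> indM; have [M_gt0 _] := indM; apply: contrapT => nind.
have [|U [V [/biprod_dual2/(indec_biprod indM)[] /= ->]]] := indecomposable_or_split _ nind.
- exact: M_gt0.
- by [].
- by [].
Qed.

Lemma indecomposable_iso M N : isomorphic M N -> indecomposable M -> indecomposable N.
Proof.
case/isomorphicP=> f [g [fE gE fg gf]] indM; have [M_gt0 _] := indM; apply: contrapT => nind.
have N_gt0 : (0 < rdegree N)%N by apply: leq_trans M_gt0 (mulmx1_min fg).
have [U [V [[a b a' b' [aE bE a'E b'E] [ba ba' b0 b0' E]] U_gt0 V_gt0]]] :=
  indecomposable_or_split N_gt0 nind.
have C m p (x : 'M_(m, rdegree N)) (y : 'M_(rdegree N, p)) :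
  x *m g *m (f *m y) = x *m y by rewrite mulmxA -(mulmxA x) gf mulmx1.
have bp : biprod M U V.
  exists (f *m a) (b *m g) (f *m a') (b' *m g); first by split; apply: equiM.
  split; rewrite ?C //.
  by rewrite !mulmxA -(mulmxA f a b) -(mulmxA f a' b') -mulmxDl -mulmxDr E mulmx1.
by case: (indec_biprod indM bp) => E0; rewrite E0 in U_gt0 V_gt0.
Qed.

Lemma decomposes_dual M l : decomposes M l -> decomposes (dual M) (map dual l).
Proof.
elim=> {M l} [M M0 | M Y Z l indY dM _ IH]; first exact: decomposes0.
exact: decomposesS (indecomposable_dual indY) (biprod_dual dM) IH.
Qed.

Lemma isomorphic_sym M N : isomorphic M N -> isomorphic N M.
Proof.
by case/isomorphicP=> f [g [fE gE fg gf]]; apply: (iso_isomorphic gE gf fg).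
Qed.

Lemma isomorphic_degree M N : isomorphic M N -> rdegree M = rdegree N.
Proof. by case. Qed.

Lemma bidual M : isomorphic (dual (dual M)) M.
Proof.
have E : equi G (1%:M^T : Hom (dual (dual M)) M).
  by apply: equi_duall; apply: equi1.
by apply: (@iso_isomorphic _ _ _ (dual (dual M)) M _ 1%:M E); rewrite trmx1 mulmx1.
Qed.

Lemma irreducible_dual M N (f : ghom M N) : irreducible_map f ->
  exists g : ghom (dual N) (dual M), irreducible_map g.
Proof.
case=> nm ne irf; have [g gE] := equi_ghom (equi_dual (ghom_equi f)); exists g; split.
- case=> h hE; have [h' h'E] := equi_ghom (equi_dual2 (ghom_equi h)).
  by apply: ne; exists h'; rewrite h'E -[ghom_mx f]trmxK -gE -trmx_mul hE trmx1.
- case=> h hE; have [h' h'E] := equi_ghom (equi_dual2 (ghom_equi h)).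
  by apply: nm; exists h'; rewrite h'E -[ghom_mx f]trmxK -gE -trmx_mul hE trmx1.
move=> X u v guv; have [u' u'E] := equi_ghom (equi_duall (ghom_equi u)).
have [v' v'E] := equi_ghom (equi_dualr (ghom_equi v)).
have [||] := irf (dual X) v' u'.
- by rewrite u'E v'E -trmx_mul -guv gE trmxK.
- case=> w wE; right; have [w' w'E] := equi_ghom (equi_duall (ghom_equi w)).
  by exists w'; rewrite w'E -[ghom_mx v]trmxK -v'E -trmx_mul wE trmx1.
- case=> w wE; left; have [w' w'E] := equi_ghom (equi_dualr (ghom_equi w)).
  by exists w'; rewrite w'E -[ghom_mx u]trmxK -u'E -trmx_mul wE trmx1.
Qed.

Lemma irreducible_iso M N M' N' (f : ghom M N) : isomorphic M M' -> isomorphic N N' ->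
  irreducible_map f -> exists g : ghom M' N', irreducible_map g.
Proof.
case/isomorphicP=> a [b [aE bE ab ba]] /isomorphicP[c [d [cE dE cd dc]]] [nm ne irf].
have [b1 b1E] := equi_ghom bE; have [c1 c1E] := equi_ghom cE.
have [a1 a1E] := equi_ghom aE; have [d1 d1E] := equi_ghom dE.
exists (ghom_comp (ghom_comp b1 f) c1); split=> [[h /= hE]|[h /= hE]|X u v /= guv].
- apply: nm; exists (ghom_comp (ghom_comp c1 h) b1); rewrite /= c1E b1E.
  move: hE; rewrite b1E c1E => /(congr1 (fun w => a *m w *m b)); rewrite mulmx1 ab => <-.
  by rewrite !mulmxA ab mul1mx.
- apply: ne; exists (ghom_comp (ghom_comp c1 h) b1); rewrite /= c1E b1E.
  move: hE; rewrite b1E c1E => /(congr1 (fun w => c *m w *m d)); rewrite mulmx1 cd => <-.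
  by rewrite !mulmxA -!(mulmxA _ c d) cd mulmx1.
have [||] := irf X (ghom_comp a1 u) (ghom_comp v d1).
- rewrite /= a1E d1E !mulmxA -(mulmxA a) -guv b1E c1E !mulmxA ab mul1mx.
  by rewrite -mulmxA cd mulmx1.
- case=> w wE; left; exists (ghom_comp w a1); rewrite /= a1E.
  move: wE; rewrite /= a1E => /(congr1 (fun w => b *m w *m a)); rewrite mulmx1 ba => <-.
  by rewrite !mulmxA ba mul1mx.
case=> w wE; right; exists (ghom_comp d1 w); rewrite /= d1E.
move: wE; rewrite /= d1E => /(congr1 (fun w => d *m w *m c)); rewrite mulmx1 dc => <-.
by rewrite !mulmxA -!(mulmxA _ d c) dc mulmx1.
Qed.

End Dual.

Section DualDefect.

Variables (k : closedFieldType) (gT : finGroupType) (G : {group gT}).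
Local Notation module := (representation k G).
Variables s z : gT.
Hypotheses (os : (s * s = 1)%g) (oz : (z * z = 1)%g).

Lemma defect_dual o (M : module) : defect s z o (dual M) = defect s z o M.
Proof.
have Vs : (s^-1 = s)%g by apply/eqP; rewrite eq_invg_mul os.
have Vz : (z^-1 = z)%g by apply/eqP; rewrite eq_invg_mul oz.
rewrite /defect; suff -> : shift s z o (dual M) = (shift s z o M)^T by rewrite mxrank_tr.
by apply/matrixP=> i j; case: o => [c|]; rewrite /= ?Vs ?Vz !mxE [j == i]eq_sym.
Qed.

End DualDefect.

(** * Irreducible maps at projective vertices *)

Section ProjectiveVertices.

Variables (k : closedFieldType) (gT : finGroupType) (G : {group gT}).
Local Notation module := (representation k G).
Local Notation Hom M N := 'M[k]_(rdegree M, rdegree N).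
Implicit Types (M N L P Y Z U V : module).

(** Projective modules are injective: the transfer of [pi *m r] extends to [P] the map that is the
    identity on [U] and zero on [V], and by Fitting's lemma it is a unit or nilpotent. *)
Lemma indec_projective_uniform P (U V : 'M_(rdegree P)) : indecomposable P -> higman G P ->
  mxmodule P U -> mxmodule P V -> (U :&: V)%MS = 0 -> U = 0 \/ V = 0.
Proof.
move=> indP [r rE] modU modV UV0; pose pi := proj_mx U V.
have piU (W : 'M_(rdegree P)) : (W <= U)%MS -> W *m pi = W by apply: proj_mx_id.
have piV (W : 'M_(rdegree P)) : (W <= V)%MS -> W *m pi = 0 by apply: proj_mx_0.
clearbody pi.
pose e : Hom P P := trf G (pi *m r).
have eE : equi G e by apply: trf_equi.
have Ue : U *m e = U.
  rewrite -[RHS]mulmx1 rE /e /trf !mulmx_sumr; apply: eq_bigr => x Gx.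
  rewrite !actE !mulmxA piU //.
  by apply: (mxmoduleP modU); rewrite groupV.
have Ve : V *m e = 0.
  rewrite /e /trf mulmx_sumr big1 // => x Gx.
  rewrite actE !mulmxA piV ?mul0mx //.
  by apply: (mxmoduleP modV); rewrite groupV.
have [ue | [n en]] := fitting indP eE.
  by right; rewrite -[V](mulmxK ue) Ve mul0mx.
have Un i : U *m (e ^+ i : Hom P P) = U.
  by elim: i => [|i IH]; [rewrite mulmx1 | rewrite exprS mulmxA Ue].
by left; rewrite -(Un n) en mulmx0.
Qed.

(* The source of an irreducible map into an indecomposable projective module is
   a maximal submodule, whose dimension is read off the smallest non-zero rank
   of an endomorphism; the latter is invariant under duality. *)
Lemma irreducible_to_projective P N (f : ghom N P) : indecomposable P -> higman G P ->
    (0 < rdegree N)%N -> irreducible_map f ->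
  exists g : Hom P P, [/\ equi G g, g != 0, (rdegree N + \rank g)%N = rdegree P &
    forall g0 : Hom P P, equi G g0 -> g0 != 0 -> (\rank g <= \rank g0)%N].
Proof.
move=> indP hP N_gt0 [_ ne irf]; have prP := higman_projective hP.
have nsurj : ~ row_full f.
  by move=> surf; apply: ne; have [h hE] := prP N P f (ghom_id P) surf; exists h.
pose good r := `[< exists U : 'M_(rdegree P),
  [/\ mxmodule P U, (f <= U)%MS, \rank U = r & (r < rdegree P)%N] >].
have ex_good : exists r, good r.
  exists (\rank f); apply/asboolP; exists (<<f>>)%MS; split.
  - rewrite (eqmx_module _ (genmxE f)); apply/mxmoduleP=> x Gx.
    by rewrite -ghomP // submxMl.
  - by rewrite genmxE.
  - by rewrite genmxE.
  by rewrite ltn_neqAle rank_leq_col andbT; apply/negP.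
have bound r : good r -> (r <= rdegree P)%N by case/asboolP=> U [_ _ _ /ltnW].
case: (ex_maxnP ex_good bound) => r0 /asboolP[U [modU fU <- ltU]] maxU.
have {bound ex_good}max (V : 'M_(rdegree P)) : mxmodule P V -> (U <= V)%MS -> (\rank V < rdegree P)%N ->
    (\rank V <= \rank U)%N.
  move=> modV UV ltV; apply: maxU; apply/asboolP; exists V; split=> //.
  exact: submx_trans UV.
have [g gE] := corestrict modU fU.
(* [U] is proper, so its inclusion does not split and the factor [g] does. The kernel of the
   retraction [r] and the image of [f] meet in zero inside [P], so that kernel vanishes. *)
have dU : rdegree N = \rank U.
  have [|[r rE]|[w wE]] := irf _ g (incl modU); first by rewrite gE.
    pose I2 := <<kermx r *m incl modU>>%MS; pose I1 := <<ghom_mx f>>%MS.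
    have modI1 : mxmodule P I1.
      rewrite (eqmx_module _ (genmxE f)); apply/mxmoduleP=> x Gx.
      by rewrite -ghomP // submxMl.
    have modI2 : mxmodule P I2.
      rewrite (eqmx_module _ (genmxE _)); apply/mxmoduleP=> x Gx.
      rewrite -mulmxA -ghomP // mulmxA; apply: submxMr.
      by apply/sub_kermxP; rewrite -mulmxA ghomP // mulmxA mulmx_ker mul0mx.
    have I0 : (I1 :&: I2)%MS = 0.
      apply/eqP; rewrite -submx0; apply/rV_subP=> v.
      rewrite sub_capmx !genmxE => /andP[/submxP[a ->] /submxP[b]].
      rewrite -gE mulmxA mulmxA => /incl_inj ab.
      have a0 : a = 0.
        by rewrite -[a]mulmx1 -rE mulmxA ab -mulmxA mulmx_ker mulmx0.
      by rewrite a0 !mul0mx sub0mx.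
    have kr0 : kermx r = 0.
      have [I10|I20] := indec_projective_uniform indP hP modI1 modI2 I0.
        have f0 : ghom_mx f = 0.
          by apply/eqP; rewrite -submx0 -I10 genmxE.
        move: gE; rewrite f0 -[0](mul0mx _ (ghom_mx (incl modU))) => /incl_inj g0.
        by move: rE; rewrite g0 mul0mx => /(congr1 mxrank); rewrite mxrank0 mxrank1 => E; rewrite -E in N_gt0.
      have : kermx r *m incl modU = 0 by apply/eqP; rewrite -submx0 -I20 genmxE.
      by rewrite -[0](mul0mx _ (ghom_mx (incl modU))) => /incl_inj.
    have := mxrank_ker r; rewrite kr0 mxrank0 => /esym/eqP; rewrite subn_eq0 => le1.
    apply/eqP; rewrite eqn_leq; apply/andP; split.
      by have := mulmx1_min rE.
    exact: leq_trans le1 (rank_leq_col _).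
  by have := leq_ltn_trans (mulmx1_min wE) ltU; rewrite ltnn.
have [i [j cij]] : exists i, exists j, cokermx U i j != 0.
  apply: contrapT => no; move: ltU; rewrite -subn_gt0 -mxrank_coker lt0n mxrank_eq0 => /negP[].
  apply/eqP/matrixP=> i j; rewrite [RHS]mxE; apply: contrapT => cij.
  by apply: no; exists i, j; apply/eqP.
(* A linear map that kills [U] and has non-zero trace. Its transfer is non-zero because the identity
   of [P] is a transfer too. *)
pose h : Hom P P := cokermx U *m delta_mx j i.
have Uh : U *m h = 0 by rewrite mulmxA mulmx_coker mul0mx.
have trh : \tr h = cokermx U i j by apply: mxtrace_mul_delta.
clearbody h.
pose g1 : Hom P P := trf G h.
have g1E : equi G g1 by apply: trf_equi.
have Ug1 : U *m g1 = 0.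
  rewrite /g1 /trf mulmx_sumr big1 // => x Gx; rewrite actE !mulmxA.
  have /submxP[d ->] : (U *m P x^-1%g <= U)%MS by apply: (mxmoduleP modU); rewrite groupV.
  by rewrite -(mulmxA d) Uh mulmx0 mul0mx.
have g1n0 : g1 != 0.
  have [r rE] := hP; apply: contraNneq cij => g10.
  rewrite -trh -[h]mulmx1 rE -tr_trf //.
  by rewrite -/g1 g10 mul0mx mxtrace0.
have ltker : (\rank (kermx g1) < rdegree P)%N.
  by rewrite mxrank_ker ltn_subrL lt0n mxrank_eq0 g1n0 (leq_trans _ ltU).
have Uker : (U <= kermx g1)%MS by apply/sub_kermxP.
have rk : \rank (kermx g1) = \rank U.
  apply/eqP; rewrite eqn_leq (mxrankS Uker) andbT; apply: max => //; exact: equi_kermx.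
exists g1; split=> //.
  by rewrite dU -rk mxrank_ker subnK // rank_leq_row.
(* [W] is the preimage under [g1] of the image of [g0], and contains the maximal [U]. Either it is
   everything, and the image of [g1] lies in that of [g0], or it is the kernel of [g1], and the two
   images meet in zero. *)
move=> g0 g0E g0n0; pose W := kermx (g1 *m cokermx g0).
have Wg : (W *m g1 <= g0)%MS by rewrite submxE -mulmxA mulmx_ker.
have WP m (a : 'M_(m, rdegree P)) : (a *m g1 <= g0)%MS -> (a <= W)%MS.
  by rewrite submxE -mulmxA => /eqP/sub_kermxP.
have modW : mxmodule P W.
  apply/mxmoduleP=> x Gx; apply: WP.
  rewrite -mulmxA ((actP _ Gx).1 (g1E x Gx)) mulmxA.
  apply: submx_trans (submxMr _ Wg) _.
  by rewrite -((actP _ Gx).1 (g0E x Gx)) submxMl.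
have UW : (U <= W)%MS by apply: WP; rewrite Ug1 sub0mx.
have [ltW | geW] := ltnP (\rank W) (rdegree P); last first.
  have W1 : row_full W by rewrite /row_full eqn_leq rank_leq_col.
  apply: mxrankS; apply: submx_trans Wg.
  by rewrite -[X in (X <= _)%MS]mul1mx submxMr // submx_full.
have kW : (W <= kermx g1)%MS.
  have sub : (kermx g1 <= W)%MS by apply: WP; rewrite mulmx_ker sub0mx.
  have := mxrank_leqif_sup sub; rewrite rk => -[_ <-].
  by rewrite eqn_leq (mxrankS UW) max.
have I0 : (g1 :&: g0)%MS = 0.
  apply/eqP; rewrite -submx0; apply/rV_subP=> v.
  rewrite sub_capmx => /andP[/submxP[a ->] ag].
  have : (a <= W)%MS by apply: WP.
  by move=> /submx_trans/(_ kW)/sub_kermxP->; rewrite sub0mx.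
have [] := indec_projective_uniform indP hP (equi_mxmodule g1E) (equi_mxmodule g0E) I0.
  by move/eqP; rewrite (negPf g1n0).
by move/eqP; rewrite (negPf g0n0).
Qed.

Lemma projective_neighbour_odd P N N' : ~~ odd (rdegree P) -> indecomposable P -> higman G P ->
    indecomposable N -> indecomposable N' ->
    (exists f : ghom N P, irreducible_map f) \/ (exists f : ghom P N, irreducible_map f) ->
    (exists f : ghom N' P, irreducible_map f) \/ (exists f : ghom P N', irreducible_map f) ->
  rdegree N = rdegree N'.
Proof.
move=> evP indP hP indN indN'.
pose good d := exists g : Hom P P, [/\ equi G g, g != 0, (d + \rank g)%N = rdegree P &
    forall g0 : Hom P P, equi G g0 -> g0 != 0 -> (\rank g <= \rank g0)%N].
have goodN L : indecomposable L ->
    (exists f : ghom L P, irreducible_map f) \/ (exists f : ghom P L, irreducible_map f) ->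
    good (rdegree L).
  move=> indL [[f irf]|[f irf]].
    by apply: irreducible_to_projective irf => //; case: indL.
  have [f' irf'] := irreducible_dual irf.
  have [|||g [gE g0 dg ming]] := irreducible_to_projective _ _ _ irf'.
  - exact: indecomposable_dual.
  - exact: higman_dual.
  - by case: indL.
  exists g^T; split.
  - exact: equi_dual2.
  - by rewrite trmx_eq0.
  - by rewrite mxrank_tr.
  move=> g1 g1E g1n0; rewrite mxrank_tr -(mxrank_tr g1); apply: ming.
    exact: equi_dual.
  by rewrite trmx_eq0.
move=> /(goodN _ indN)[g [gE g0 dg ming]] /(goodN _ indN')[g' [g'E g'0 dg' ming']].
have : \rank g = \rank g' by apply/eqP; rewrite eqn_leq ming // ming'.
by move=> rg; apply/eqP; rewrite -(eqn_add2r (\rank g)) dg rg dg'.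
Qed.

End ProjectiveVertices.

(** * The component *)

Lemma mxtrace_rot (k : fieldType) m n p (A : 'M[k]_(m, n)) (B : 'M_(n, p)) (C : 'M_(p, m)) :
  \tr (A *m (B *m C)) = \tr (C *m A *m B).
Proof. by rewrite mulmxA mxtrace_mulC mulmxA. Qed.

Lemma sumn_split (T : Type) (Y : T) l : List.In Y l -> exists l',
  (forall f : T -> nat, sumn (map f l) = (f Y + sumn (map f l'))%N) /\
  (forall Y', List.In Y' l <-> Y = Y' \/ List.In Y' l').
Proof.
elim: l => [//|X l IH] /= [->|/IH[l' [sl inl]]]; first by exists l.
exists (X :: l'); split=> [f|Y']; first by rewrite /= sl addnCA.
by have := inl Y' => /=; tauto.
Qed.

Lemma odd_sumn (T : Type) (f : T -> nat) l : odd (sumn (map f l)) ->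
  exists2 Y, List.In Y l & odd (f Y).
Proof.
elim: l => [//|X l IH] /=; rewrite oddD; case oX: (odd (f X)); first by exists X; [left|].
by case/IH=> Y lY oY; exists Y; [right|].
Qed.

Section Component.

Variables (k : closedFieldType) (gT : finGroupType) (G : {group gT}).
Local Notation module := (representation k G).
Local Notation Hom M N := 'M[k]_(rdegree M, rdegree N).
Implicit Types (M N L P Y : module) (x y : gT) (K H : {group gT}).
Hypothesis char2 : 2%N \in [pchar k]%R.
Let sGG := subxx G.

Variable z : gT.
Hypotheses (Gz : z \in G) (oz : #[z]%g = 2%N).
Local Notation C := (<[z]>%g).
Local Notation etap := (@etap k gT G z).

Variables (S : {group gT}) (s : bool -> gT) (A : bool -> {group gT}) (m : nat).
Hypothesis sSG : S \subset G.
Hypothesis pS : (2.-group S)%g.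
Hypothesis sylS : odd #|G : S|%g.
Hypothesis defS : S :=: <<[set s true; s false]>>%g.
Hypothesis s_neq : s true != s false.
Hypothesis os : forall i, #[s i]%g = 2%N.
Hypotheses (sCA : forall i, C \subset A i) (sBA : forall i, <[s i]>%g \subset A i).
Hypothesis sAS : forall i, A i \subset S.
Hypothesis genA : forall i, A i :=: <<[set s i; z]>>%g.
Hypothesis trfA : forall i M N (f : Hom M N),
  trf (A i) f = trf C (trf <[s i]>%g f).
Hypothesis trfS : forall M N (f : Hom M N),
  trf S f = \sum_(i < (2 ^ m).*2)
    act ((s false * s true) ^+ i)%g (f + act (s true) f).
Hypothesis rq : ((s false * s true) ^+ (2 ^ m) = z)%g.
Hypothesis invS : forall x, x \in S -> #[x]%g = 2%N -> x != z ->
  exists i, exists2 g, g \in S & x = (s i ^ g)%g.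
Hypothesis cSz : z \in 'C(S)%g.
Hypothesis sumA : forall i (V : nmodType) (F : gT -> V),
  \sum_(x in A i) F x = F 1%g + F (s i) + (F z + F (s i * z)%g).

Let Ss i : s i \in S. Proof. by rewrite -cycle_subG (subset_trans (sBA i)). Qed.
Let Gs i : s i \in G. Proof. exact: (subsetP sSG). Qed.
Let sAG i : A i \subset G. Proof. exact: subset_trans (sAS i) sSG. Qed.
Let ss i : (s i * s i = 1)%g. Proof. by have := expg_order (s i); rewrite os expgS expg1. Qed.
Let zz : (z * z = 1)%g. Proof. by have := expg_order z; rewrite oz expgS expg1. Qed.
Let csz i : (s i * z = z * s i)%g. Proof. by rewrite (centP cSz). Qed.
Let evG : ~~ odd #|G|.
Proof.
rewrite -dvdn2; apply: dvdn_trans (cardSg (subset_trans (sAS true) sSG)).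
by apply: dvdn_trans (cardSg (sCA true)); rewrite -orderE oz.
Qed.

(** Summing an [S]-map over the cosets gives a [G]-map; all cosets contribute the same trace, and
    their number is odd. *)
Lemma trnull_index M N (f : Hom M N) : equi G f -> trnull G f -> trnull S f.
Proof.
move=> fE f0 h hE.
have := f0 _ (equi_lcosets_sum sSG hE); rewrite mulmx_sumr linear_sum /=.
rewrite (eq_bigr (fun=> \tr (f *m h))) => [|X /rcosetsP[x Gx ->]]; last first.
  have Gr : repr (S :* x)%g \in G.
    have /rcosetP[y Sy ->] := mem_repr x (rcoset_refl S x).
    by rewrite groupM // (subsetP sSG).
  by rewrite -[in LHS](fE _ Gr) -act_mul // tr_act.
rewrite sumr_const -[#|_|]/(#|G : S|%g) -(odd_double_half #|G : S|%g) sylS mulrS -mul2n mulrnA mulr2n.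
by rewrite (addr2_pchar char2) mul0rn addr0.
Qed.

(** The identity of [Y] is itself a sum of factors of the two kinds, and can be put in front of [c]
    as often as needed: [2 j + 1] factors leave more than [j] of one kind. *)
Lemma trnull_word_split Y N (c : Hom Y N) j n a b :
    trnull S (1%:M : Hom Y Y) -> word S s a b c -> (j.*2.+1 <= n + a + b)%N ->
  trnull S (c *m etap j N).
Proof.
move=> Y0; have [v vE vP] : exists2 v : bool -> Hom Y Y, 1%:M = v true + v false &
    forall i, equi S (v i) /\ null <[s i]>%g (v i).
  exact: (trnull_splitE char2 sSG defS s_neq os sBA sAS Y0 (equi1 _ sSG)).
elim: n a b c => [|n IH] a b c wc le_j.
  apply: (word_trnull char2 Gz oz sSG os sCA sBA sAS trfA wc).
  by clear -le_j; lia.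
rewrite -[c]mul1mx vE mulmxDl mulmxDl; apply: trnullD.
  have [v1E v1n] := vP true.
  by apply: (IH _ _ _ (word_cons v1E v1n wc)) => /=; clear -le_j; lia.
have [v1E v1n] := vP false.
by apply: (IH _ _ _ (word_cons v1E v1n wc)) => /=; clear -le_j; lia.
Qed.

(** The Euler map of degree 2 is orthogonal to the module maps, so it lifts through [e]. If all
    summands of [E] were even, they would each contribute zero to its trace against [etap], which is
    1. *)
Lemma odd_summand N E (e : Hom E N) l : indecomposable N -> odd (rdegree N) ->
    right_almost_split e -> decomposes E l ->
  exists2 Y, List.In Y l & odd (rdegree Y).
Proof.
move=> indN oN [eE ne lift] dE; apply: contrapT => allev.
have [Z [ZE Z0 trZ]] := euler_tr char2 Gz oz sSG sylS defS s_neq os sCA sBA sAS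
  genA trfA trfS rq invS cSz 1 oN.
have [u uE ue] := lift _ Z ZE (Z0 isT).
case/eqP: (oner_neq0 k); rewrite -trZ -ue.
pose Q (h : Hom (Om 1.*2 N) N) := \tr (etap 1.*2 N *m h) = 0.
apply: (decomposes_id dE (Q := Q)) => //.
- by rewrite /Q mulmx0 mxtrace0.
- by move=> h1 h2 H1 H2; rewrite /Q mulmxDr linearD /= H1 H2 addr0.
move=> Y a b lY indY aE bE ba; rewrite /Q.
have evY : ~~ odd (rdegree Y) by apply/negP=> oY; apply: allev; exists Y.
rewrite mxtrace_rot.
have cE : equi S (b *m e) by apply: equiS (equiM sGG bE eE).
have Y0 : trnull S (1%:M : Hom Y Y).
  by apply: trnull_index; [apply: equi1 | apply: indec_even_trnull].
have H : trnull S (b *m e *m etap 1.*2 N).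
  (* The power of [eta] is [j = 2], hence [2 j + 1 = 5] factors, all supplied by the identity of
     [Y]. *)
  by apply: (@trnull_word_split Y N (b *m e) 1.*2 5 0 0) => //; apply: word0.
have uaE : equi S (u *m a) by apply: equiS (equiM sGG uE aE).
exact: H.
Qed.

Lemma decomposes_degree (E : module) l : decomposes E l -> rdegree E = sumn (map (@rdegree _ _ _) l).
Proof. by elim=> {E l} [//|M Y Z l _ dM _ /= <-]; apply: biprod_dim. Qed.

Lemma decomposes_defect i o (E : module) l : decomposes E l ->
  defect (s i) z o E = sumn (map (defect (s i) z o) l).
Proof.
elim=> {E l} [M M0|M Y Z l _ dM _ /= <-].
  by apply/eqP; rewrite /= -leqn0; apply: leq_trans (leq_subr _ _) _; rewrite M0.
exact: (defect_biprod char2 (Gs i) Gz (ss i) zz (csz i)).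
Qed.

(** The pullback that contains the middle term as a summand is an extension of [N] by its second
    syzygy. Defects are subadditive and invariant under syzygies, whence the factor 2. The parity of
    the total dimension later gives a second odd summand. *)
Lemma right_bound N : indecomposable N -> odd (rdegree N) -> exists l,
  [/\ forall Y, List.In Y l -> indecomposable Y /\ exists f : ghom Y N, irreducible_map f,
      forall M, indecomposable M -> (exists f : ghom M N, irreducible_map f) ->
        exists2 Y, List.In Y l & isomorphic M Y,
      exists2 Y, List.In Y l & odd (rdegree Y),
      ~~ odd (sumn (map (@rdegree _ _ _) l)) &
      forall i o, (sumn (map (defect (s i) z o) l) <= (defect (s i) z o N).*2)%N].
Proof.
move=> indN oN.
have [E [e [l [ase [dE evE] lN Nl [E0 [e0 [j [Z [bp [e0E jE] [fj fe] je dE0]]]]]]]]] :=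
  right_neighbours char2 evG indN oN.
exists l; split=> // [M indM [f irf]|||i o].
- exact: Nl irf.
- exact: odd_summand ase dE.
- by rewrite -(decomposes_degree dE).
rewrite -(decomposes_defect i o dE).
have := defect_biprod char2 (Gs i) Gz (ss i) zz (csz i) o bp.
have := defect_extension char2 (Gs i) Gz (ss i) zz (csz i) o jE e0E fj fe je dE0.
by rewrite !(defect_syzygy char2 (Gs i) Gz (ss i) zz (csz i) (sumA i) (sAG i)); clear; lia.
Qed.

Definition linked M N :=
  (exists f : ghom M N, irreducible_map f) \/ (exists f : ghom N M, irreducible_map f).

Lemma linked_sym M N : linked M N -> linked N M.
Proof. by case; [right|left]. Qed.

Lemma linked_iso M N M' N' : isomorphic M M' -> isomorphic N N' -> linked M N -> linked M' N'.
Proof.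
by move=> isoM isoN [[f irf]|[f irf]]; [left|right]; apply: irreducible_iso irf.
Qed.

(* Otherwise there would be a sequence of linked odd modules with decreasing
   defect: two odd summands of the middle term share twice the defect of [Y]. *)
Lemma linked_defect i o n Y N : indecomposable Y -> odd (rdegree Y) ->
    indecomposable N -> odd (rdegree N) -> (defect (s i) z o Y <= n)%N -> linked N Y ->
  (defect (s i) z o N <= defect (s i) z o Y)%N.
Proof.
elim: n Y N => [|n IH] Y N indY oY indN oN le_n.
  by have := odd_defect char2 (Gs i) Gz (ss i) zz (csz i) o Y; rewrite oY; move: le_n; case: defect.
have H Y' N' : indecomposable Y' -> odd (rdegree Y') ->
    indecomposable N' -> odd (rdegree N') -> (defect (s i) z o Y' <= n.+1)%N ->
    (exists f : ghom N' Y', irreducible_map f) ->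
    (defect (s i) z o N' <= defect (s i) z o Y')%N.
  move=> indY' oY' indN' oN' le_n' irf; rewrite leqNgt; apply/negP=> lt_d.
  have [l [lY Yl _ evl sum_d]] := right_bound indY' oY'.
  have [Y1 lY1 iso1] := Yl N' indN' irf.
  have d1 := defect_iso (Gs i) Gz o iso1.
  have r1 : rdegree N' = rdegree Y1 by apply: isomorphic_degree.
  have [l' [sl inl]] := sumn_split lY1.
  have [Y2 lY2 o2] : exists2 Y2, List.In Y2 l' & odd (rdegree Y2).
    by apply: odd_sumn; move: evl; rewrite sl oddD -r1 oN'; case: odd.
  have [l'' [sl' _]] := sumn_split lY2.
  have := sum_d i o; rewrite sl sl' -d1 => le_sum.
  have lt2 : (defect (s i) z o Y2 < defect (s i) z o Y')%N by clear -le_sum lt_d; lia.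
  have [indY2 irf2] := lY Y2 ((inl Y2).2 (or_intror lY2)).
  have : (defect (s i) z o Y' <= defect (s i) z o Y2)%N.
    by apply: IH => //; [clear -lt2 le_n'; lia | right].
  by clear -lt2; lia.
case=> [|[f irf]]; first exact: H.
rewrite -(defect_dual (ss i) zz o N) -(defect_dual (ss i) zz o Y).
apply: H => //; try exact: indecomposable_dual.
  by rewrite defect_dual.
exact: irreducible_dual irf.
Qed.

Lemma even_neighbour N Y : indecomposable N -> odd (rdegree N) ->
  indecomposable Y -> ~~ odd (rdegree Y) -> linked Y N -> higman G Y.
Proof.
move=> indN oN indY evY linkY.
suff d0 i o : defect (s i) z o Y = 0%N.
  apply: (higman_odd_index char2 sSG sylS).
  apply: (higman_four_groups char2 sSG pS defS os oz rq cSz invS) => i.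
  rewrite -genA; apply: (@defect0_higman _ _ _ char2 (s i) z (A i)) => //.
  - exact: pgroupS pS.
  - by apply: (subsetP (sBA i)); apply: cycle_id.
  - by apply: (subsetP (sCA i)); apply: cycle_id.
have H N' Y' : indecomposable N' -> odd (rdegree N') -> indecomposable Y' ->
    ~~ odd (rdegree Y') -> (exists f : ghom Y' N', irreducible_map f) ->
    defect (s i) z o Y' = 0%N.
  move=> indN' oN' indY' evY' irf.
  have [l [lY Yl [Y1 lY1 o1] evl sum_d]] := right_bound indN' oN'.
  have [Y0 lY0 iso0] := Yl Y' indY' irf.
  have d1 := defect_iso (Gs i) Gz o iso0.
  have r1 : rdegree Y' = rdegree Y0 by apply: isomorphic_degree.
  have [l' [sl inl]] := sumn_split lY0.
  have lY1' : List.In Y1 l'.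
    by have [E|//] := (inl Y1).1 lY1; rewrite r1 E o1 in evY'.
  have [l'' [sl' inl']] := sumn_split lY1'.
  have [Y2 lY2 o2] : exists2 Y2, List.In Y2 l'' & odd (rdegree Y2).
    by apply: odd_sumn; move: evl; rewrite sl sl' !oddD -r1 o1 (negPf evY'); case: odd.
  have [l3 [sl'' _]] := sumn_split lY2.
  have [indY1 irf1] := lY Y1 lY1.
  have [indY2 irf2] := lY Y2 ((inl Y2).2 (or_intror ((inl' Y2).2 (or_intror lY2)))).
  have le1 : (defect (s i) z o N' <= defect (s i) z o Y1)%N.
    by apply: (linked_defect indY1 o1 indN' oN' (leqnn _)); right.
  have le2 : (defect (s i) z o N' <= defect (s i) z o Y2)%N.
    by apply: (linked_defect indY2 o2 indN' oN' (leqnn _)); right.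
  by have := sum_d i o; rewrite sl sl' sl'' -d1; clear -le1 le2; lia.
case: linkY => [|[f irf]]; first exact: H.
rewrite -(defect_dual (ss i) zz o Y).
apply: (H (dual N)) => //; try exact: indecomposable_dual.
exact: irreducible_dual irf.
Qed.

(* The only even vertices that a component with an odd one can have are
   projective, with all their neighbours odd. *)
Definition odd_or_hub M := indecomposable M /\
  (odd (rdegree M) \/
   higman G M /\ forall N, indecomposable N -> linked N M -> odd (rdegree N)).

Lemma odd_or_hub_linked M N : odd_or_hub M -> indecomposable N -> linked N M -> odd_or_hub N.
Proof.
case=> indM oM indN link; split=> //; case: oM => [oM|[hM oM]]; last by left; apply: oM.
case oN: (odd (rdegree N)); [by left | right].
have hN : higman G N by apply: (even_neighbour indM oM) => //; rewrite oN.
split=> // N' indN' link'.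
rewrite (projective_neighbour_odd _ indN hN indN' indM) ?oN //.
exact: linked_sym.
Qed.

Lemma odd_or_hub_iso M N : odd_or_hub M -> isomorphic M N -> odd_or_hub N.
Proof.
case=> indM oM isoN; split; first exact: indecomposable_iso isoN indM.
have rN : rdegree M = rdegree N by apply: isomorphic_degree.
case: oM => [oM|[hM oM]]; [by left; rewrite -rN | right; split=> [|N' indN' link]].
  have [f [g [fE gE fg gf]]] := isomorphicP isoN.
  exact: (higman_retract gE fE gf).
apply: oM => //; apply: linked_iso link; last exact: isomorphic_sym.
by apply: mx_rsim_refl.
Qed.

Lemma odd_or_hub_connected M N : AR_connected M N -> odd_or_hub M <-> odd_or_hub N.
Proof.
elim=> {M N} [M N [isoMN|[indM indN link]]|M|M N _ IH|M N L _ IH1 _ IH2].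
- split=> oM; first exact: odd_or_hub_iso isoMN.
  by apply: odd_or_hub_iso oM _; apply: isomorphic_sym.
- by split=> /odd_or_hub_linked; apply=> //; [right | left].
- by [].
- by rewrite IH.
- by rewrite IH1.
Qed.

Lemma component_odd (D : module -> Prop) : AR_component D ->
    (exists M, D M /\ odd (rdegree M)) ->
  forall M, D M -> indecomposable M /\ (odd (rdegree M) \/ higman G M).
Proof.
case=> M0 indM0 DE [M1 [/DE[ind1 c1] o1]] M /DE[indM cM]; split=> //.
have h1 : odd_or_hub M1 by split; [|left].
have h0 : odd_or_hub M0 by apply/(odd_or_hub_connected c1).
by have /(odd_or_hub_connected cM)[_ [|[hM _]]] := h0; [left | right].
Qed.

Variable D : module -> Prop.
Hypothesis D_odd : forall M, D M -> indecomposable M /\ (odd (rdegree M) \/ higman G M).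
Hypothesis D_iso : forall M N, isomorphic M N -> D M -> D N.
Hypothesis D_linked : forall M N, D M -> indecomposable N -> linked N M -> D N.

Lemma distinct_trnull M N (f : Hom M N) : indecomposable M -> indecomposable N ->
  ~ isomorphic M N -> equi G f -> trnull G f.
Proof.
move=> indM indN niso fE; apply: nonsplit_epi_trnull => // -[h hE hf].
apply/niso/isomorphic_sym/(indec_retract_iso indN indM hE fE).
by rewrite hf unitmx1.
Qed.

Let split N L (e : Hom N L) : equi G e -> trnull G e ->
  exists2 v : bool -> Hom N L, e = v true + v false &
    forall i, equi S (v i) /\ null <[s i]>%g (v i).
Proof.
move=> eE e0; apply: (trnull_splitE char2 sSG defS s_neq os sBA sAS).
  exact: trnull_index.
exact: equiS eE.
Qed.

Let word_null := word_trnull char2 Gz oz sSG os sCA sBA sAS trfA.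

(* A map from outside the component into it factors through the almost split
   maps of the component over and over, and thus is a sum of arbitrarily long
   words. *)
Lemma into_component_trnull j n a b M N N' (d : Hom N N') (g : Hom M N) :
    indecomposable M -> ~ D M -> D N -> equi G g -> word S s a b d ->
    (j.*2.+1 <= n + a + b)%N ->
  trnull S (g *m d *m etap j N').
Proof.
move=> indM nM; elim: n a b N N' d g => [|n IH] a b N N' d g dN gE wd le_j.
  rewrite -mulmxA; apply: trnullMl => //; first exact: equiS gE.
  by apply: word_null wd _; clear -le_j; lia.
have gS : equi S g by apply: equiS gE.
have [indN [oN|hN]] := D_odd dN; last first.
  apply: (null_trnull char2 Gz oz sSG sCA sAS) => //; last exact: word_equi wd.
  by apply: higman_nullr => //; apply: null_sub hN.
have [E [e [l [[eE ne lift] [dE _] lN _ _]]]] := right_neighbours char2 evG indN oN.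
have niso : ~ isomorphic M N by move=> /isomorphic_sym isoM; apply: nM; apply: D_iso isoM dN.
have [u uE <-] := lift _ g gE (distinct_trnull indM indN niso gE).
have [v -> vP] := split eE (nonsplit_epi_trnull indN eE ne).
rewrite mulmxDr !mulmxDl.
suff H i : trnull S (u *m v i *m d *m etap j N') by apply: trnullD.
have [viE vin] := vP i; rewrite -(mulmxA u).
pose Q (h : Hom M N') := trnull S (h *m etap j N').
apply: (decomposes_id dE (Q := Q)); rewrite /Q.
- by move=> h _; rewrite !mul0mx mxtrace0.
- by move=> h1 h2 H1 H2; rewrite mulmxDl; apply: trnullD.
move=> Y a' b' lY indY a'E b'E _.
apply: (IH (i + a)%N (~~ i + b)%N Y N').
- by apply: (D_linked dN) => //; left; have [_] := lN Y lY.
- exact: equiM.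
- by apply: wordMl => //; [apply: equiS b'E | apply: word_cons].
by clear -le_j; case: i; lia.
Qed.

(** The mirror image of the preceding lemma: the almost split map ending in [dual N] is transposed
    to one that starts in [N], so the word grows at its right end. *)
Lemma from_component_trnull j n a b M N N' (c : Hom N' N) (f : Hom N M) :
    indecomposable M -> ~ D M -> D N -> equi G f -> word S s a b c ->
    (j.*2.+1 <= n + a + b)%N ->
  trnull S (c *m f *m etap j M).
Proof.
move=> indM nM; elim: n a b N N' c f => [|n IH] a b N N' c f dN fE wc le_j.
  have wcf : word S s (a + 0) (b + 0) (c *m f).
    by apply: word_cat wc _ => //; apply: word0; apply: equiS fE.
  by apply: word_null wcf _; clear -le_j; lia.
have fS : equi S f by apply: equiS fE.
have cS := word_equi sSG wc.
have [indN [oN|hN]] := D_odd dN; last first.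
  rewrite -[c *m f]mulmx1.
  apply: (null_trnull char2 Gz oz sSG sCA sAS); [exact: equiM | | exact: equi1].
  by apply: nullMr => //; apply: higman_null => //; apply: null_sub hN.
have [E [e [l [[eE ne lift] [dE _] lN _ _]]]] :=
  right_neighbours char2 evG (indecomposable_dual indN) (oN : odd (rdegree (dual N))).
have niso : ~ isomorphic N M by move=> isoM; apply: nM; apply: D_iso isoM dN.
have f0 := distinct_trnull indN indM niso fE.
have [w wE weq] := lift (dual M) f^T (equi_dual fE) (trnull_dual f0).
have {weq} -> : f = e^T *m w^T by rewrite -trmx_mul weq trmxK.
have e0 := nonsplit_epi_trnull (indecomposable_dual indN) eE ne.
have [v vE vP] := split (equi_dualr eE) (trnull_dualr e0).
rewrite mulmxA vE mulmxDr !mulmxDl.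
suff H i : trnull S (c *m v i *m w^T *m etap j M) by apply: trnullD.
have [viE vin] := vP i.
pose Q (h : Hom N' M) := trnull S (h *m etap j M).
apply: (decomposes_id (decomposes_dual dE) (Q := Q)); rewrite /Q.
- by move=> h _; rewrite !mul0mx mxtrace0.
- by move=> h1 h2 H1 H2; rewrite mulmxDl; apply: trnullD.
move=> Y a' b' lY indY a'E b'E _.
apply: (IH (a + (i + 0))%N (b + (~~ i + 0))%N Y N').
- apply: (D_linked dN) => //; have [Y0 [<- lY0]] := (List.in_map_iff _ _ _).1 lY.
  have [_ [f' irf']] := lN Y0 lY0; right.
  have [f2 irf2] := irreducible_dual irf'.
  by apply: irreducible_iso irf2; [apply: bidual | apply: mx_rsim_refl].
- by apply: equiM => //; apply: equi_duall.
- rewrite -mulmxA; apply: word_cat wc _ => //; apply: word_cons => //.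
  by apply: word0; apply: equiS a'E.
by clear -le_j; case: i; lia.
Qed.

Lemma cross_null j M N (f : Hom M N) : indecomposable M -> indecomposable N ->
  (D M <-> ~ D N) -> equi G f -> null G (f *m psi z j N).
Proof.
move=> indM indN xor fE; apply/(psi_nullP char2 Gz oz) => //; apply: (trnullS sSG).
have [dN|nN] := pselect (D N).
  rewrite -[f]mulmx1; apply: (@into_component_trnull j j.*2.+1 0 0) => //; last first.
  - by clear; lia.
  - by apply: word0; apply: equi1.
  by move/xor.
rewrite -[f]mul1mx; apply: (@from_component_trnull j j.*2.+1 0 0) => //; last first.
- by clear; lia.
- by apply: word0; apply: equi1.
exact/xor.
Qed.

(* [p] is a sum of composites through members of [D], and [1 - p] of composites
   through other indecomposable modules. *)
Definition component_proj M (p : Hom M M) : Prop := equi G p /\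
  forall L N (f : Hom L M) (g : Hom M N) (Q : Hom L N -> Prop),
    Q 0 -> (forall u v, Q u -> Q v -> Q (u + v)) ->
    ((forall Y (a : Hom M Y) (b : Hom Y M), D Y -> indecomposable Y ->
        equi G a -> equi G b -> Q (f *m a *m (b *m g))) -> Q (f *m p *m g)) /\
    ((forall Y (a : Hom M Y) (b : Hom Y M), ~ D Y -> indecomposable Y ->
        equi G a -> equi G b -> Q (f *m a *m (b *m g))) -> Q (f *m (1%:M - p) *m g)).

Lemma component_projector M : exists p : Hom M M, component_proj p.
Proof.
have [l dM] := decomposition M.
elim: dM => {M l} [M M0|M Y Z l indY [a b a' b' [aE bE a'E b'E] [_ _ _ _ E1]] _ [p [pE pP]]].
  exists 0; split; first exact: equi0.
  move=> L N f g Q Q0 _; suff f0 : f = 0 by rewrite f0 !mul0mx.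
  by move: (f); rewrite M0 => h; apply/matrixP=> ? [].
have E2 (r : Hom Y Y) (q : Hom Z Z) L N (f : Hom L M) (g : Hom M N) :
    f *m (a *m r *m b + a' *m q *m b') *m g =
    f *m a *m (r *m (b *m g)) + f *m a' *m q *m (b' *m g).
  by rewrite mulmxDr mulmxDl !mulmxA.
have [dY|nY] := pselect (D Y).
  exists (a *m 1%:M *m b + a' *m p *m b'); split.
    by apply: equiD; do ?apply: equiM => //; apply: equi1.
  have -> : 1%:M - (a *m 1%:M *m b + a' *m p *m b') = a *m 0 *m b + a' *m (1%:M - p) *m b'.
    by rewrite -E1 mulmx0 mul0mx add0r mulmx1 mulmxBr mulmx1 mulmxBl opprD addrACA subrr add0r.
  move=> L N f g Q Q0 QD; have [H1 H2] := pP L N (f *m a') (b' *m g) Q Q0 QD.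
  split=> H; rewrite E2; apply: (QD).
  - by rewrite mul1mx; apply: H.
  - apply: H1 => X c d dX indX cE dE; rewrite -(mulmxA f) (mulmxA d); apply: H => //; exact: equiM.
  - by rewrite mul0mx mulmx0.
  - apply: H2 => X c d dX indX cE dE; rewrite -(mulmxA f) (mulmxA d); apply: H => //; exact: equiM.
exists (a *m 0 *m b + a' *m p *m b'); split.
  by apply: equiD; do ?apply: equiM => //; apply: equi0.
have -> : 1%:M - (a *m 0 *m b + a' *m p *m b') = a *m 1%:M *m b + a' *m (1%:M - p) *m b'.
  by rewrite -E1 mulmx0 mul0mx add0r mulmx1 mulmxBr mulmx1 mulmxBl addrA.
move=> L N f g Q Q0 QD; have [H1 H2] := pP L N (f *m a') (b' *m g) Q Q0 QD.
split=> H; rewrite E2; apply: (QD).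
- by rewrite mul0mx mulmx0.
- apply: H1 => X c d dX indX cE dE; rewrite -(mulmxA f) (mulmxA d); apply: H => //; exact: equiM.
- by rewrite mul1mx; apply: H.
- apply: H2 => X c d dX indX cE dE; rewrite -(mulmxA f) (mulmxA d); apply: H => //; exact: equiM.
Qed.

Lemma component_transformation r :
  exists psi : nat_trans (id_functor (stmod k G)) (functor_pow (Omega k G) r.*2.+1),
    forall M, nat_support psi M <-> D M /\ ~ projective M.
Proof.
pose j := r.*2.
have ex M : exists c : ghom M (Om j.+1 M), exists2 p : Hom M M, component_proj p & ghom_mx c = p *m psi z j M.
  have [p [pE pP]] := component_projector M.
  have [c cE] := equi_ghom (equiM sGG pE (psi_equi char2 Gz oz j M)).
  by exists c, p.
pose comp M := sval (cid (ex M)).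
have compP M : exists2 p : Hom M M, component_proj p & ghom_mx (comp M) = p *m psi z j M := svalP (cid (ex M)).
(* Naturality moves [psi] in front of the last factor [d]; then [cross_null] applies to the single
   map [h] between indecomposable modules. *)
have cross X Y M N (a : Hom M X) (h : Hom X Y) (d : Hom Y N) :
    indecomposable X -> indecomposable Y -> (D X <-> ~ D Y) -> equi G a -> equi G h ->
    equi G d -> null G (a *m h *m d *m psi z j N).
  move=> indX indY xor aE hE dE; have [d' d'E] := equi_ghom dE.
  have nat := psi_natural char2 Gz oz j d'; rewrite d'E in nat.
  have -> : a *m h *m d *m psi z j N = a *m (h *m psi z j Y *m fmapOm j.+1 d') -
      a *m h *m (psi z j Y *m fmapOm j.+1 d' - d *m psi z j N).
    by rewrite mulmxBr !mulmxA opprB addrC subrK.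
  apply: nullB => //; last by apply: nullMr => //; apply: equiM.
  apply: nullMr => //; apply: nullMl => //.
    exact: ghom_equi.
  exact: cross_null.
have natural M N (f : ghom M N) :
    stable_eq (ghom_comp f (comp N)) (ghom_comp (comp M) (fmapOm j.+1 f)).
  apply/stable_eqP => /=; have fE := ghom_equi f.
  have [p [pE pP] ->] := compP M; have [q [qE qP] ->] := compP N.
  (* The failure of naturality consists of the two parts of [f] that cross between [D] and its
     complement, and of a multiple of the failure for [psi], which is null. *)
  have -> : f *m (q *m psi z j N) - p *m psi z j M *m fmapOm j.+1 f =
      (1%:M - p) *m (f *m q) *m psi z j N - p *m f *m (1%:M - q) *m psi z j N -
      p *m (psi z j M *m fmapOm j.+1 f - f *m psi z j N).
    rewrite mulmxBl mul1mx (mulmxBr (p *m f)) mulmx1 mulmxBl (mulmxBl (p *m f)) mulmxBr !mulmxA.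
    by rewrite !opprB !addrA !subrK.
  have pN : null G (p *m (psi z j M *m fmapOm j.+1 f - f *m psi z j N)).
    by apply: nullMr => //; apply: (psi_natural char2 Gz oz).
  pose Q (h : Hom M N) := null G (h *m psi z j N).
  have Q0 : Q 0 by rewrite /Q mul0mx; apply: null0.
  have QD u v : Q u -> Q v -> Q (u + v).
    by rewrite /Q mulmxDl => Qu Qv; apply: nullD.
  apply: nullB => //; apply: nullB => //.
    rewrite -/(Q _) -[(1%:M - p) *m _]mul1mx mulmxA.
    apply: (pP M N 1%:M (f *m q) Q Q0 QD).2 => X a b nX indX aE bE.
    rewrite !mulmxA -[_ *m q]mulmx1.
    apply: (qP M N _ 1%:M Q Q0 QD).1 => Y c d dY indY cE dE.
    have := cross X Y M N a (b *m f *m c) d indX indY _ aE (equiM sGG (equiM sGG bE fE) cE) dE.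
    by rewrite /Q mulmx1 mul1mx !mulmxA; apply; split.
  rewrite -/(Q _) -mulmxA -[p *m _]mul1mx mulmxA.
  apply: (pP M N 1%:M (f *m (1%:M - q)) Q Q0 QD).1 => X a b nX indX aE bE.
  rewrite !mulmxA -[_ *m (_ - _)]mulmx1.
  apply: (qP M N _ 1%:M Q Q0 QD).2 => Y c d dY indY cE dE.
  have := cross X Y M N a (b *m f *m c) d indX indY _ aE (equiM sGG (equiM sGG bE fE) cE) dE.
  by rewrite /Q mulmx1 mul1mx !mulmxA; apply; split.
pose Psi := @NatTrans (stmod k G) (stmod k G) (id_functor _) (functor_pow (Omega k G) j.+1)
  comp natural.
exists Psi => M; rewrite /nat_support.
have E : stable_eq (comp M) (ghom0 M (Om j.+1 M)) <-> null G (ghom_mx (comp M)).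
  by rewrite -[X in null G X]subr0; apply: stable_eqP.
split=> [[indM nz]|[dM nprM]].
  have {E nz} nz : ~ null G (ghom_mx (comp M)) by move/E.
  have [p [pE pP] cE] := compP M.
  split; last first.
    move=> /projectiveP hM; apply: nz; rewrite cE.
    by apply: nullMl => //; [apply: psi_equi | apply: higman_null].
  apply: contrapT => nM; apply: nz; rewrite cE.
  pose Q (h : Hom M M) := null G (h *m psi z j M).
  suff: Q (1%:M *m p *m 1%:M) by rewrite mul1mx mulmx1.
  apply: (pP M M 1%:M 1%:M Q _ _).1.
  - by rewrite /Q mul0mx; apply: null0.
  - by move=> u v; rewrite /Q mulmxDl => Qu Qv; apply: nullD.
  move=> Y a b dY indY aE bE; rewrite /Q mul1mx mulmx1 -mulmxA.
  by apply: nullMr => //; apply: cross_null => //; split.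
have [indM [oM|hM]] := D_odd dM; last by case: nprM; apply: higman_projective.
split=> // /E; have [p [pE pP] ->] := compP M => np.
(* For [M] in [D] a composite through an indecomposable module outside [D] is not a unit. In a local
   ring sums of non-units are non-units, so [1 - p] is not a unit and [p] is one. *)
have up : p \in unitmx.
  have : (p + (1%:M - p) : Hom M M) = 1%:M by rewrite addrC subrK.
  have qE : equi G (1%:M - p) by apply: equiB => //; apply: equi1.
  case/(indec_unit_add indM pE qE) => // uq.
  pose Q (h : Hom M M) := equi G h /\ h \notin unitmx.
  have [] : Q (1%:M *m (1%:M - p) *m 1%:M); last by rewrite mul1mx mulmx1 uq.
  apply: (pP M M 1%:M 1%:M Q _ _).2.
  - split; first exact: equi0.
    have [M_gt0 _] := indM; rewrite -row_free_unit /row_free mxrank0.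
    by rewrite eq_sym -lt0n.
  - move=> u v [uE nu] [vE nv]; split; first exact: equiD.
    by apply/negP=> /(indec_unit_add2 indM uE vE)[] h; [case/negP: nu | case/negP: nv].
  move=> Y a b nY indY aE bE; rewrite mul1mx mulmx1; split; first exact: equiM.
  apply/negP=> /(indec_retract_iso indM indY aE bE) isoY.
  by apply: nY; apply: D_iso isoY dM.
have npsi : null G (psi z j M).
  rewrite -[psi z j M](mulKmx up); apply: nullMr => //; exact: equi_invmx.
have [Z [ZE _ trZ]] := euler_tr char2 Gz oz sSG sylS defS s_neq os sCA sBA sAS
  genA trfA trfS rq invS cSz r oM.
rewrite -[psi z j M]mul1mx in npsi.
have /(psi_nullP char2 Gz oz) := npsi; case/(_ (equi1 _ sGG) Z ZE)/eqP.
by rewrite mul1mx trZ oner_eq0.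
Qed.

End Component.

(** * Dihedral Sylow subgroups *)

Lemma sum_cycle (gT : finGroupType) (V : nmodType) (x : gT) (F : gT -> V) :
  \sum_(y in <[x]>%g) F y = \sum_(i < #[x]%g) F (x ^+ i)%g.
Proof.
have injX : {in 'I_#[x]%g &, injective (fun i : 'I_#[x]%g => x ^+ i)%g}.
  move=> i j _ _ /eqP; rewrite eq_expg_mod_order !modn_small ?ltn_ord //.
  by move/eqP/val_inj.
rewrite -(big_imset _ injX) /=; apply: eq_bigl => y.
apply/cycleP/imsetP => [[i ->]|[i _ ->]]; last by exists i.
exists (Ordinal (ltn_pmod i (order_gt0 x))) => //=.
by rewrite expg_mod_order.
Qed.

Section DihedralSylow.

Variables (gT : finGroupType) (S : {group gT}) (m : nat).
Hypotheses (m_gt2 : (2 < m)%N) (isoS : (S \isog 'D_(2 ^ m))%g).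

Lemma dihedral_involutions : exists (s : bool -> gT) (z : gT),
  [/\ S :=: <<[set s true; s false]>>%g /\ s true != s false,
      (forall i, #[s i]%g = 2%N) /\ #[z]%g = 2%N,
      ((s false * s true) ^+ (2 ^ (m - 2)) = z)%g,
      z \in 'C(S)%g /\ (forall i, s i \notin <[s false * s true]>%g) /\
        #[s false * s true]%g = (2 ^ (m - 2)).*2 &
      forall x, x \in S -> #[x]%g = 2%N -> x != z ->
        exists i, exists2 g, g \in S & x = (s i ^ g)%g].
Proof.
have m_gt1 : (1 < m)%N by apply: ltnW.
have [[x y] gen [oy xy]] := generators_2dihedral m_gt1 isoS.
have [[sd inv _] _ _ [cls _ _]] := dihedral2_structure m_gt1 gen isoS.
rewrite (gtn_eqF m_gt2) => -[ZS oZ _ _ _]; have [oS Sx ox /setDP[Sy ncy]] := gen.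
have em : (2 ^ m.-1 = (2 ^ (m - 2)).*2)%N.
  by rewrite -mul2n -expnS; congr (2 ^ _)%N; lia.
have xyN : (x * y)%g \notin <[x]>%g by rewrite groupMl ?cycle_id.
have oxy : #[(x * y)%g]%g = 2%N by apply: inv; rewrite inE xyN groupM.
have yy : (y * y = 1)%g by have := expg_order y; rewrite oy expgS expg1.
(* The reflections [x * y] and [y] have the rotation [x] as their product and represent the classes
   of non-central involutions; [z] is the rotation by half a turn. *)
exists (fun i => if i then y else (x * y)%g), (x ^+ (2 ^ (m - 2)))%g.
have m2 : (m - 2 = m.-2)%N by lia.
rewrite -mulgA yy mulg1; split=> //.
- split; last first.
    apply/eqP=> E; have x1 : x = 1%g by apply: (mulIg y); rewrite mul1g -E.
    by move: ox; rewrite x1 order1 em => /(congr1 odd); rewrite odd_double.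
  have [Ky Kxy] : y \in <<[set y; (x * y)%g]>>%g /\ (x * y)%g \in <<[set y; (x * y)%g]>>%g.
    by split; apply: mem_gen; rewrite !inE eqxx ?orbT.
  apply/eqP; rewrite eqEsubset; apply/andP; split.
    rewrite -(sdprodW sd) mul_subG ?cycle_subG //.
    have xE : x = (x * y * y)%g by rewrite -mulgA yy mulg1.
    by rewrite [X in X \in _]xE groupM.
  by rewrite gen_subG; apply/subsetP=> t /set2P[] ->; rewrite ?groupM.
- split; first by case.
  by rewrite m2 orderE -ZS.
- split; first by have := cycle_id (x ^+ (2 ^ (m - 2)))%g; rewrite m2 -ZS => /setIP[].
  by split; [case | rewrite ox em].
move=> t St ot tz; have [ct|nct] := boolP (t \in <[x]>%g); last first.
  have : t \in (y ^: S :|: (x * y) ^: S)%g by rewrite cls inE nct.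
  by case/setUP=> /imsetP[g Sg ->]; [exists true | exists false]; exists g.
case/eqP: tz; have : (<[t]> == <[x ^+ (2 ^ (m - 2))]>)%g.
  rewrite (eq_subG_cyclic (cycle_cyclic x)) ?cycle_subG ?mem_cycle // -!orderE ot.
  by rewrite orderE m2 -ZS oZ.
move/eqP=> E; have := cycle_id t; rewrite E cycle2g; last by rewrite orderE m2 -ZS.
by case/set2P=> // t1; move: ot; rewrite t1 order1.
Qed.

End DihedralSylow.

Section FourGroups.

Variables (k : fieldType) (gT : finGroupType) (G : {group gT}).
Local Notation module := (representation k G).
Local Notation Hom M N := 'M[k]_(rdegree M, rdegree N).
Implicit Types (M N : module) (s z x : gT).

Lemma sum_four_group s z (V : nmodType) (F : gT -> V) : #[s]%g = 2%N -> #[z]%g = 2%N ->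
    s != z -> (s * z = z * s)%g ->
  \sum_(x in <<[set s; z]>>%g) F x = F 1%g + F s + (F z + F (s * z)%g).
Proof.
move=> os oz nsz csz.
have ss : (s * s = 1)%g by have := expg_order s; rewrite os expgS expg1.
have zz : (z * z = 1)%g by have := expg_order z; rewrite oz expgS expg1.
have s1 : s != 1%g by rewrite -order_eq1 os.
have z1 : z != 1%g by rewrite -order_eq1 oz.
have n1 : (s * z)%g != 1%g.
  by apply: contraNneq nsz => E; rewrite -[s]mulg1 -zz mulgA E mul1g.
have osz : #[(s * z)%g]%g = 2%N.
  apply: nt_prime_order; [by [] | | exact: n1].
  by rewrite expgS expg1 {2}csz mulgA -(mulgA s z z) zz mulg1 ss.
rewrite dihedral_sum //; last first.
  rewrite cycle2g // !inE negb_or s1 /=; apply: contraNneq z1 => E.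
  by apply/eqP/(mulgI s); rewrite mulg1 -E.
rewrite cycle2g // big_setU1 ?big_set1; last by rewrite inE eq_sym.
by rewrite mulg1 mulgA ss mul1g; congr (_ + _); apply: addrC.
Qed.

Lemma trf_four_group s z M N (f : Hom M N) : s \in G -> z \in G ->
    #[s]%g = 2%N -> #[z]%g = 2%N -> s != z -> (s * z = z * s)%g ->
  trf <<[set s; z]>>%g f = trf <[z]>%g (trf <[s]>%g f).
Proof.
move=> Gs Gz os oz nsz csz; rewrite {1}/trf sum_four_group // !trf_cycle2 //.
by rewrite act1g linearD /= actM.
Qed.

Lemma trf_dihedral (a b : gT) M N (f : Hom M N) : a \in G -> b \in G ->
    #[a]%g = 2%N -> #[b]%g = 2%N -> a \notin <[b * a]>%g ->
  trf <<[set a; b]>>%g f = \sum_(i < #[b * a]%g) act ((b * a) ^+ i)%g (f + act a f).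
Proof.
move=> Ga Gb oa ob na.
have aa : (a * a = 1)%g by have := expg_order a; rewrite oa expgS expg1.
have bb : (b * b = 1)%g by have := expg_order b; rewrite ob expgS expg1.
have Va : (a^-1 = a)%g by apply/eqP; rewrite eq_invg_mul aa.
have Vb : (b^-1 = b)%g by apply/eqP; rewrite eq_invg_mul bb.
have cE : <[a * b]>%g = <[b * a]>%g by rewrite -cycleV invMg Va Vb.
rewrite /trf dihedral_sum ?cE // sum_cycle; apply: eq_bigr => i _.
by rewrite linearD /= actM // groupX // groupM.
Qed.

End FourGroups.

Theorem theorem4p3 (k : closedFieldType) (gT : finGroupType)
    (G S : {group gT}) (m : nat) (D : representation k G -> Prop) (n : nat) :
  2%N \in [pchar k]%R ->
  (2.-Sylow(G) S)%g -> (8 <= 2 ^ m)%N -> (S \isog 'D_((2 ^ m)%N))%g ->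
  AR_component D -> (exists M, D M /\ odd (rdegree M)) ->
  (0 < n)%N ->
  exists psi : nat_trans (id_functor (stmod k G))
                         (functor_pow (Omega k G) (2 * n - 1)),
    forall M : representation k G,
      nat_support psi M <-> D M /\ ~ projective M.
Proof.
move=> char2 sylS m_ge3 isoS compD oddD n_gt0.
have m_gt2 : (2 < m)%N by rewrite -(ltn_exp2l _ _ (isT : 1 < 2)%N); apply: leq_trans m_ge3.
have [s [z [[defS s_neq] [os oz] rq [cSz [ncs ors]] invS]]] := dihedral_involutions m_gt2 isoS.
have sSG := pHall_sub sylS; have pS := pHall_pgroup sylS.
have odS : odd #|G : S|%g.
  by have /and3P[_ _] := sylS; rewrite odd_2'nat.
have Ss i : s i \in S.
  by rewrite defS; apply: mem_gen; rewrite !inE; case: i; rewrite eqxx ?orbT.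
have Sz : z \in S by rewrite -rq groupX // groupM.
have [Gs Gz] := (fun i => subsetP sSG _ (Ss i), subsetP sSG _ Sz).
have nsz i : s i != z by apply: contraNneq (ncs i) => ->; rewrite -rq mem_cycle.
have csz i : (s i * z = z * s i)%g by rewrite (centP cSz).
pose A i := <<[set s i; z]>>%G.
have trfA i (M N : representation k G) (f : 'M[k]_(rdegree M, rdegree N)) :
  trf (A i) f = trf <[z]>%g (trf <[s i]>%g f) by apply: trf_four_group.
have trfS (M N : representation k G) (f : 'M[k]_(rdegree M, rdegree N)) :
    trf S f = \sum_(i < (2 ^ (m - 2)).*2) act ((s false * s true) ^+ i)%g (f + act (s true) f).
  by rewrite -ors defS; apply: trf_dihedral.
have sumA i (V : nmodType) (F : gT -> V) :
  \sum_(x in A i) F x = F 1%g + F (s i) + (F z + F (s i * z)%g) by apply: sum_four_group.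
have sCA i : <[z]>%g \subset A i by rewrite cycle_subG; apply: mem_gen; rewrite !inE eqxx orbT.
have sBA i : <[s i]>%g \subset A i by rewrite cycle_subG; apply: mem_gen; rewrite !inE eqxx.
have sAS i : A i \subset S by rewrite gen_subG; apply/subsetP=> x /set2P[] ->.
have D_odd := component_odd char2 Gz oz sSG pS odS defS s_neq os sCA sBA sAS
  (fun i => erefl) trfA trfS rq invS cSz sumA compD oddD.
have [D0 indD0 DE] := compD.
have D_iso (M N : representation k G) : isomorphic M N -> D M -> D N.
  move=> isoMN /DE[indM cM]; apply/DE; split; first exact: indecomposable_iso isoMN indM.
  by apply: rst_trans cM _; apply: rst_step; left.
have D_linked (M N : representation k G) : D M -> indecomposable N -> linked N M -> D N.
  move=> /DE[indM cM] indN link; apply/DE; split=> //; apply: rst_trans cM _.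
  by case: link => irf; [apply: rst_sym|]; apply: rst_step; right.
(* The power of [eta] is [2 (n - 1)], and the connecting map adds one syzygy. *)
have -> : (2 * n - 1 = n.-1.*2.+1)%N by clear -n_gt0; lia.
exact: (component_transformation char2 Gz oz sSG odS defS s_neq os sCA sBA sAS
  (fun i => erefl) trfA trfS rq invS cSz D_odd D_iso D_linked n.-1).
Qed.
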